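(* Let $k$, $r$, $m$, and $n$ be integers such that $1\le k\le m-1$, $r\ge 1$, and $2\le m\le n-1$. Suppose the distribution function $F$ is absolutely continuous. Then $F$ is exponential, i.e. $F(x)=1-e^{-c(x-l_F)}$ for $x\ge l_F$ with some constant $c>0$, if and only if for all $l_F<s<u<v<t$ $$E\left[kR_n-(n-m+k)R_m\mid R_{m-k}=u,\ R_{n+r}=v\right]=\frac{du}{(d+1)s-t}\,E\left[kR_n-(n-m+k)R_m\mid R_{m-k+1}=s,\ R_{n+r-1}=t\right],$$ where $d=n-m+k+r-2$ (and $du$ denotes the product of $d$ and $u$).
   Context: Let $X_1,X_2,\ldots$ be independent copies of a random variable $X$ with distribution function $F$, absolutely continuous with respect to Lebesgue measure. The record times are $T_1=1$ and $T_n=\min\{j: j>T_{n-1},\ X_j>X_{T_{n-1}}\}$ for $n>1$, and the (upper) record values are $R_n=X_{T_n}$, $n=1,2,\ldots$. The number $l_F>-\infty$ denotes the left endpoint of the support of $F$.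
   Formalization: The equality is required only for those s<u<v<t with t ≠ (d+1)s, where the fraction du/((d+1)s−t) is defined; conditional expectations are read as suitably chosen versions of the (generalized) regression functions. *)

(* Defs.v *)
From HB Require Import structures.
From mathcomp Require Import all_boot all_order all_algebra.
From mathcomp Require Import all_classical all_reals all_analysis.

Set Implicit Arguments.
Unset Strict Implicit.
Unset Printing Implicit Defensive.

Import Order.TTheory GRing.Theory Num.Theory.
Import numFieldNormedType.Exports.

Local Open Scope classical_set_scope.
Local Open Scope ring_scope.

Section Probability.
Context {disp : measure_display} {T : measurableType disp} {R : realType}.
Variable P : probability T R.

Definition mutually_independent (I : set nat) (X : nat -> T -> R) : Prop :=
  forall J : seq nat, uniq J -> (forall i, i \in J -> I i) ->
  forall B : nat -> set R, (forall i, measurable (B i)) ->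
  P (\big[setI/setT]_(i <- J) (X i @^-1` B i)) =
  (\prod_(i <- J) P (X i @^-1` B i))%E.

(* [g] is a version of z |-> E[Y | Z = z], i.e. g(Z) is a version of
   E[Y | sigma(Z)].  Y need not be integrable: as usual for conditional
   expectations that are finite a.s., integrability is only asked on the
   members of some countable sigma(Z)-measurable cover, and the averaging
   identity is tested on the events of sigma(Z) on which Y is integrable.
   When Y is integrable this is the ordinary conditional expectation. *)
Definition is_cond_exp {disp' : measure_display} {U : measurableType disp'}
    (Y : T -> R) (Z : T -> U) (g : U -> R) : Prop :=
  [/\ measurable_fun setT g,
      exists C : nat -> set U,
        [/\ forall i, measurable (C i), \bigcup_i C i = setT &
            forall i, P.-integrable (Z @^-1` C i) (EFin \o Y)] &
      forall C : set U, measurable C ->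
        P.-integrable (Z @^-1` C) (EFin \o Y) ->
        P.-integrable (Z @^-1` C) (EFin \o g \o Z) /\
        (\int[P]_(w in Z @^-1` C) (Y w)%:E =
         \int[P]_(w in Z @^-1` C) (g (Z w))%:E)%E].

End Probability.

Section Records.
Context {R : realType}.

(* min {j | t < j, x_t < x_j}.  If the set is empty, the value is t; for
   i.i.d. observations with a continuous distribution function this happens
   with probability zero. *)
Definition next_record_time (x : nat -> R) (t : nat) : nat :=
  if pselect (exists j, (t < j)%N && (x t < x j)) is left h
  then ex_minn h else t.

(* T_n for the observations x_1, x_2, ...; x_0 is not used, and neither is
   the value at n = 0. *)
Fixpoint record_time (x : nat -> R) (n : nat) : nat :=
  match n with
  | 0 | 1 => 1
  | n'.+1 => next_record_time x (record_time x n')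
  end.

Definition record_value (x : nat -> R) (n : nat) : R := x (record_time x n).

End Records.

Section DistributionFunction.
Context {R : realType}.

(* Topological support of the measure with distribution function F. *)
Definition cdf_support (F : R -> R) : set R :=
  [set x | forall e, 0 < e -> F (x - e) < F (x + e)].

Definition left_endpoint (F : R -> R) : R := inf (cdf_support F).

Definition is_exponential (F : R -> R) : Prop :=
  exists c : R, 0 < c /\
    forall x, left_endpoint F <= x ->
      F x = 1 - expR (- (c * (x - left_endpoint F))).

End DistributionFunction.

(* Main.v *)
(* Let G be the inverse of x |-> - ln (1 - F x) and l the left endpoint.  The
   records are distributed as the values of G at the partial sums of independent
   standard exponentials, so with J f s = \int_s^oo f the joint law of several
   records is given by iterates of J applied to exp(-s).

   If F is exponential, G is affine and E[R_j | R_a, R_b] interpolates linearly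
   between R_a and R_b, which makes both conditional expectations explicit.

   Conversely, the functional equation forces E[k R_n - (n-m+k) R_m | u, v] to be
   kappa u for l < u < v.  Conditioning on G(alpha) < R_{m-k} and
   R_{n+r} <= G(beta) with beta decreasing to alpha gives kappa = -(n-m).  Testing
   on the events {R_{m-k} in A, R_{n+r} <= G(beta)} yields, for g = G - l,
   N = n-m+k and w = exp(-s) 1_{[0,beta]}(s),
     k J^N (g J^r w) + (n-m) g J^(N+r) w = N J^k (g J^(N+r-k) w)
   almost everywhere on (0, oo), for every beta > 0.  As J regularises, g is twice
   differentiable; letting beta decrease to s in the equation at s annihilates
   g''(s).  Hence G is affine and F is exponential. *)

(* If F is exponential, E[k R_n - N R_m | u, v] = -(n-m) u, the coefficient of v being proportional
   to k N - N k = 0. For the inner pair, one record further in at each end and d = N + r - 2 steps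
   apart, the result is -(n-m) ((d+1) s - t) / d. The quotient of the two is the factor of the
   theorem.

   Everything rests on the commutation J y = y J + J^2, y being multiplication by the variable. It
   gives J^j ((y-s) f) (s) = j J^(j+1) f (s) and J^j ((y-s)^2 f) (s) = j (j+1) J^(j+2) f (s). Put a
   Taylor polynomial of g at s into the equation for g: order 0 balances because k + (n-m) = N,
   order 1 because k N = N k, but at order 2 the sides differ by k N (N+1) - N k (k+1) = k N (n-m),
   which is not 0. So affine functions pass and curvature is excluded.

   In the converse the records need not be integrable; the bound R_{n+r} <= G(beta) keeps the test
   integrals finite. Integrals are mostly taken of nonnegative extended functions, and [fine]
   returns to the reals for subtraction and calculus. *)
Require Import Defs.
From HB Require Import structures.
From mathcomp Require Import all_boot all_order all_algebra.
From mathcomp Require Import all_classical all_reals all_analysis.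
From mathcomp Require Import measurable_realfun.
From mathcomp Require Import ring lra zify.

Set Implicit Arguments.
Unset Strict Implicit.
Unset Printing Implicit Defensive.

Import Order.TTheory GRing.Theory Num.Theory.
Import numFieldNormedType.Exports.

Local Open Scope classical_set_scope.
Local Open Scope ring_scope.

(** * Iterated tail integrals *)

Section MeasurePreliminaries.
Local Open Scope ereal_scope.
Import HBNNSimple.

(** Turns a density into a measure, so that uniqueness theorems for measures can compare integrals;
    used for the exponential law and in [eq_integral_rectangles]. *)
Lemma density_measure d (T : measurableType d) (R : realType)
    (m : {measure set T -> \bar R}) (h1 : T -> R) :
  measurable_fun setT h1 -> (forall x, 0 <= h1 x)%R ->
  exists nu : {measure set T -> \bar R},
    (forall B, measurable B -> nu B = \int[m]_(x in B) (h1 x)%:E) /\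
    (forall f, measurable_fun setT f -> (forall x, 0 <= f x) ->
      \int[nu]_x f x = \int[m]_x (f x * (h1 x)%:E)).
Proof.
move=> mh0 h00; pose h x := (h1 x)%:E.
have mh : measurable_fun setT h by exact/measurable_EFinP.
have h0 x : 0 <= h x by rewrite lee_fin.
pose n0 := fun B => \int[m]_(x in B) h x.
have n00 : n0 set0 = 0 by rewrite /n0 integral_set0.
have nge B : 0 <= n0 B by apply: integral_ge0.
have nsa : semi_sigma_additive n0.
  move=> /= A mA tA mUA; rewrite /n0; apply: cvg_toP.
    apply: ereal_nondecreasing_is_cvgn => i j ij.
    by apply: lee_sum_nneg_natr => // k _ _; apply: integral_ge0.
  by rewrite ge0_integral_bigcup //; exact: measurable_funTS.
pose mix := isMeasure.Build _ _ _ n0 n00 nge nsa.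
pose nu : {measure set T -> \bar R} := HB.pack n0 mix.
exists nu; split=> // f mf f0.
pose f_ := nnsfun_approx measurableT mf.
have simple (g : {nnsfun T >-> R}) :
    \int[nu]_x (g x)%:E = \int[m]_x ((g x)%:E * h x).
  rewrite integralT_nnsfun sintegralE.
  under [RHS]eq_integral do rewrite fimfunE -fsumEFin //.
  have -> : \int[m]_x ((\sum_(y \in range g) (y * \1_(g @^-1` [set y]) x)%:E) * h x) =
    \int[m]_x (\sum_(y \in range g) ((y * \1_(g @^-1` [set y]) x)%:E * h x)).
    apply: eq_integral => x _; rewrite ge0_mule_fsuml // => y.
    exact: nnfun_muleindic_ge0.
  rewrite ge0_integral_fsum //; last 2 first.
  - move=> y; apply: emeasurable_funM => //; apply/measurable_EFinP.
    by apply: measurable_funM => //; exact: measurable_indic.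
  - by move=> y x _; rewrite mule_ge0 // nnfun_muleindic_ge0.
  apply: eq_fsbigr => y; rewrite inE => -[z _ <-].
  rewrite -[nu _]/(\int[m]_(x in _) h x).
  under [RHS]eq_integral do rewrite EFinM -muleA.
  have mI : measurable_fun setT
      (fun x => (\1_(g @^-1` [set g z]) x)%:E * h x).
    apply: emeasurable_funM => //; apply/measurable_EFinP.
    exact: measurable_indic.
  have I0 x : 0 <= (\1_(g @^-1` [set g z]) x)%:E * h x.
    by rewrite mule_ge0 // lee_fin.
  rewrite ge0_integralZl // ?lee_fin //.
  congr (_ * _); rewrite integral_mkcond; apply: eq_integral => x _.
  by rewrite patchE indicE; case: ifPn; rewrite ?mul1e ?mul0e.
transitivity (limn (fun n => \int[nu]_x (f_ n x)%:E)).
  rewrite -monotone_convergence //.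
  - apply: eq_integral => x _; apply/esym/cvg_lim => //.
    exact: cvg_nnsfun_approx.
  - by move=> n; exact/measurable_EFinP/measurable_funTS.
  - by move=> n x _; rewrite lee_fin.
  - by move=> x _ a b ab; rewrite lee_fin; exact/lefP/nd_nnsfun_approx.
have -> : (fun n => \int[nu]_x (f_ n x)%:E) =
    (fun n => \int[m]_x ((f_ n x)%:E * h x)).
  by apply/funext => n; exact: simple.
rewrite -monotone_convergence //.
- apply: eq_integral => x _.
  apply/cvg_lim => //; apply: cvgeZr => //.
  exact: cvg_nnsfun_approx.
- by move=> n; apply: emeasurable_funM => //; exact/measurable_EFinP.
- by move=> n x _; rewrite mule_ge0 // lee_fin.
- move=> x _ a b ab; apply: lee_wpmul2r => //.
  by rewrite lee_fin; exact/lefP/nd_nnsfun_approx.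
Qed.

(** Closed rays are the convenient generators: by [le_exp_quantile] their preimages under the
    quantile transform are explicit. *)
Lemma measure_unique_rays (R : realType) (m1 m2 : {measure set R -> \bar R}) :
  (forall x, m1 `[x, +oo[%classic = m2 `[x, +oo[%classic) ->
  (forall x, m1 `[x, +oo[%classic < +oo) ->
  forall A, measurable A -> m1 A = m2 A.
Proof.
move=> m12 fin A mA.
apply: (@measure_unique _ R R (@RGenCInfty.G R)
  (fun n => `[(- n%:R)%R, +oo[%classic)) => //.
- exact: RGenCInfty.measurableE.
- move=> _ _ [x ->] [y ->]; exists (Num.max x y).
  by apply/seteqP; split=> z /=; rewrite !in_itv /= !andbT ge_max;
    [move=> [-> ->]|move=> /andP[]].
- by move=> n; exists (- n%:R)%R.
- apply/seteqP; split=> // x _; exists (Num.truncn `|x|).+1 => //=.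
  rewrite in_itv /= andbT lerNl.
  by rewrite (le_trans _ (ltW (truncnS_gt _))) // -normrN ler_norm.
- by move=> _ [x ->]; exact: m12.
Qed.

Definition tail_integral (R : realType) (m : {measure set R -> \bar R})
    (f : R -> \bar R) (x : R) : \bar R :=
  \int[m]_(y in `]x, +oo[) f y.

Lemma tail_integral_ge0 (R : realType) (m : {measure set R -> \bar R}) f x :
  (forall y, 0 <= f y) -> 0 <= tail_integral m f x.
Proof. by move=> f0; apply: integral_ge0. Qed.

(** Integration over a moving ray becomes integration of a function of the pair, the form in which
    Tonelli gives measurability in [x]. *)
Lemma tail_integralE (R : realType) (m : {measure set R -> \bar R}) f x :
  tail_integral m f x = \int[m]_y (f y * (\1_[set z : R * R | (z.1 < z.2)%R] (x, y))%:E).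
Proof.
rewrite /tail_integral integral_mkcond; apply: eq_integral => y _.
rewrite patchE indicE mem_setE in_itv /= andbT; case: ifPn => xy.
  by rewrite mem_set ?mule1.
by rewrite memNset ?mule0 //; exact/negP.
Qed.

Lemma measurable_set_ltr d (T : measurableType d) (R : realType) (f g : T -> R) :
  measurable_fun setT f -> measurable_fun setT g ->
  measurable [set x | (f x < g x)%R].
Proof.
move=> mf mg; rewrite -[X in measurable X]setTI.
have mb := measurable_fun_ltr mf mg.
by rewrite (_ : [set x | _] = (fun x => (f x < g x)%R) @^-1` [set true]) //; exact: mb.
Qed.

Lemma measurable_set_ler d (T : measurableType d) (R : realType) (f g : T -> R) :
  measurable_fun setT f -> measurable_fun setT g ->
  measurable [set x | (f x <= g x)%R].
Proof.
move=> mf mg; rewrite -[X in measurable X]setTI.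
have mb := measurable_fun_ler mf mg.
by rewrite (_ : [set x | _] = (fun x => (f x <= g x)%R) @^-1` [set true]) //; exact: mb.
Qed.

Lemma measurable_tail_integral (R : realType)
    (m : {sigma_finite_measure set R -> \bar R}) f :
  measurable_fun setT f -> (forall y, 0 <= f y) ->
  measurable_fun setT (tail_integral m f).
Proof.
move=> mf f0.
have mh : measurable_fun setT
    (fun z : R * R => f z.2 * (\1_[set z : R * R | (z.1 < z.2)%R] z)%:E).
  apply: emeasurable_funM; first exact: measurableT_comp.
  apply/measurable_EFinP; apply: measurable_indic; exact: measurable_set_ltr.
have h0 (z : R * R) : 0 <= f z.2 * (\1_[set z : R * R | (z.1 < z.2)%R] z)%:E.
  by rewrite mule_ge0 // lee_fin.
rewrite (_ : tail_integral m f = fubini_F m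
  (fun z : R * R => f z.2 * (\1_[set z : R * R | (z.1 < z.2)%R] z)%:E)).
  exact: measurable_fun_fubini_tonelli_F.
by apply/funext => x; rewrite tail_integralE.
Qed.

(** The operator J of the overview. *)
Definition leb_tail (R : realType) (f : R -> \bar R) (x : R) : \bar R :=
  \int[lebesgue_measure]_(y in `]x, +oo[) f y.

Lemma leb_tail_ge0 (R : realType) (f : R -> \bar R) x :
  (forall y, 0 <= f y) -> 0 <= leb_tail f x.
Proof. by move=> f0; apply: integral_ge0. Qed.

Lemma leb_tailE (R : realType) (f : R -> \bar R) x :
  leb_tail f x = \int[lebesgue_measure]_y
    (f y * (\1_[set z : R * R | (z.1 < z.2)%R] (x, y))%:E).
Proof.
rewrite /leb_tail integral_mkcond; apply: eq_integral => y _.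
rewrite patchE indicE mem_setE in_itv /= andbT; case: ifPn => xy.
  by rewrite mem_set ?mule1.
by rewrite memNset ?mule0 //; exact/negP.
Qed.

Lemma measurable_leb_tail (R : realType) (f : R -> \bar R) :
  measurable_fun setT f -> (forall y, 0 <= f y) ->
  measurable_fun setT (leb_tail f).
Proof.
move=> mf f0; pose T := measurableTypeR R.
have mh : measurable_fun setT
    (fun z : T * T => f z.2 * (\1_[set z : T * T | (z.1 < z.2)%R] z)%:E).
  apply: emeasurable_funM.
    exact: (@measurableT_comp _ _ _ (T * T)%type T _ f _ snd).
  apply/measurable_EFinP; apply: measurable_indic.
  exact: (@measurable_set_ltr _ (T * T)%type R fst snd).
have h0 (z : T * T) : 0 <= f z.2 * (\1_[set z : T * T | (z.1 < z.2)%R] z)%:E.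
  by rewrite mule_ge0 // lee_fin.
rewrite (_ : leb_tail f = fubini_F (@lebesgue_measure R)
  (fun z : T * T => f z.2 * (\1_[set z : T * T | (z.1 < z.2)%R] z)%:E)).
  move=> _ B mB.
  exact: (measurable_fun_fubini_tonelli_F (m2 := @lebesgue_measure R) _ mh h0
    measurableT _ mB).
by apply/funext => x; rewrite leb_tailE.
Qed.

(** Tonelli on s < x < y: the inner integral over x has length y - s. *)
Lemma leb_tail_tail (R : realType) (f : R -> \bar R) (s : R) :
  measurable_fun setT f -> (forall y, 0 <= f y) ->
  leb_tail (leb_tail f) s =
  \int[lebesgue_measure]_(y in `]s, +oo[) ((y - s)%:E * f y).
Proof.
move=> mf f0; pose T := measurableTypeR R.
pose h (z : T * T) := f z.2 * (\1_[set z : T * T | (z.1 < z.2)%R] z)%:E *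
  (\1_(`]s, +oo[%classic : set T) z.1)%:E.
have mh : measurable_fun setT h.
  apply: emeasurable_funM; first apply: emeasurable_funM.
  - exact: (@measurableT_comp _ _ _ (T * T)%type T _ f _ snd).
  - apply/measurable_EFinP; apply: measurable_indic.
    exact: (@measurable_set_ltr _ (T * T)%type R fst snd).
  - apply/measurable_EFinP; 
    have mI : measurable_fun setT (\1_(`]s, +oo[%classic : set T) : T -> R).
      exact: measurable_indic.
    exact: (measurableT_comp mI measurable_fst).
have h0 z : 0 <= h z by rewrite !mule_ge0 // lee_fin.
have := fubini_tonelli (m1 := @lebesgue_measure R) (m2 := @lebesgue_measure R) _ mh h0.
rewrite /fubini_F /fubini_G => H.
transitivity (\int[lebesgue_measure]_x \int[lebesgue_measure]_y h (x, y)).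
  rewrite {1}/leb_tail integral_mkcond; apply: eq_integral => x _.
  rewrite patchE; case: ifPn => sx.
    rewrite leb_tailE; apply: eq_integral => y _.
    have I1 : \1_(`]s, +oo[%classic : set T) x = 1%R :> R by rewrite indicE sx.
    by rewrite /h /= I1 mule1.
  apply/esym/integral0_eq => y _.
  have I0 : \1_(`]s, +oo[%classic : set T) x = 0%R :> R.
    by rewrite indicE (negbTE sx).
  by rewrite /h /= I0 mule0.
rewrite H [RHS]integral_mkcond; apply: eq_integral => y _.
transitivity (f y * \int[lebesgue_measure]_x (\1_(`]s, y[%classic : set T) x)%:E).
  have mI : measurable_fun setT (EFin \o (\1_(`]s, y[%classic : set T) : T -> R)).
    by apply/measurable_EFinP; exact: measurable_indic.
  rewrite -(ge0_integralZl lebesgue_measure measurableT mI _ (f0 y)); last first.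
    by move=> x _; rewrite lee_fin.
  apply: eq_integral => x _; rewrite /h /= -muleA -EFinM; congr (_ * _%:E).
  rewrite !indicE -natrM mulnb; congr ((nat_of_bool _)%:R); apply/idP/idP.
    move=> /andP[/set_mem /= xy /set_mem]; rewrite /= in_itv /= andbT => sx.
    by rewrite mem_setE in_itv /= sx.
  rewrite mem_setE in_itv /= => /andP[sx xy].
  by apply/andP; split; apply/mem_set => //=; rewrite in_itv /= sx.

have mI : measurable (`]s, y[%classic : set T) by exact: measurable_itv.
have E := integral_indic (@lebesgue_measure R) measurableT mI.
rewrite [X in f y * X]E.
rewrite setIT patchE.
rewrite muleC.
have Ls : (@lebesgue_measure R `]s, y[%classic = if (s < y)%R then (y - s)%:E else 0).
  apply: (eq_trans (lebesgue_measure_itv `]s, y[)).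
  by rewrite /= lte_fin.
rewrite [X in X * _]Ls.
rewrite mem_setE in_itv /= andbT.
by case: ifPn => _; rewrite ?mul0e.
Qed.

(* The identity [T y = y T + T^2] for the operator [T f s = \int_s^oo f], [y]
   being multiplication by the variable. *)
Lemma leb_tail_mulr (R : realType) (f : R -> \bar R) (s : R) :
  measurable_fun setT f -> (forall y, 0 <= f y) -> (0 <= s)%R ->
  leb_tail (fun y => y%:E * f y) s =
  s%:E * leb_tail f s + leb_tail (leb_tail f) s.
Proof.
move=> mf f0 s0; rewrite leb_tail_tail // /leb_tail.
have mf' (D : set (measurableTypeR R)) : measurable_fun D f.
  by apply: (@measurable_funTS _ _ (measurableTypeR R)).
rewrite -ge0_integralZl; last 4 first.
- exact: measurable_itv.
- exact: mf'.
- by move=> y _.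
- by rewrite lee_fin.
rewrite -ge0_integralD; last 5 first.
- exact: measurable_itv.
- by move=> y _; rewrite mule_ge0.
- exact: measurable_funeM.
- by move=> y; rewrite /= in_itv /= andbT => sy; rewrite mule_ge0 // lee_fin subr_ge0 ltW.
- apply: emeasurable_funM => //; apply/measurable_EFinP.
  by apply: measurable_funB.
apply: eq_integral => y; rewrite inE /= in_itv /= andbT => sy.
by rewrite -ge0_muleDl ?lee_fin // ?subr_ge0 ?ltW // -EFinD addrC subrK.
Qed.

End MeasurePreliminaries.

(** * Events determined by the first observations *)

Section Past.
Context {disp : measure_display} {T : measurableType disp} {R : realType}.
Variables (P : probability T R) (X : nat -> {RV P >-> R}).

Definition past_cylinders t : set (set T) :=
  [set A | exists2 B : nat -> set R, (forall i, measurable (B i)) &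
    A = \big[setI/setT]_(i <- iota 1 t) (X i @^-1` B i)].

(** A copy of [T] carrying the sigma-algebra of X_1, ..., X_t, so that measurability with respect to
    the past is ordinary measurability for another domain type. *)
Definition past t := g_sigma_algebraType (past_cylinders t).

HB.instance Definition _ t := Measurable.copy (past t)
  (g_sigma_algebraType (past_cylinders t)).

Lemma bigsetIE (I : eqType) (r : seq I) (A : I -> set T) w :
  (\big[setI/setT]_(i <- r) A i) w <-> {in r, forall i, A i w}.
Proof.
elim: r => [|i r IH]; first by rewrite big_nil.
rewrite big_cons; split=> [[Ai /IH Ar] j|H].
  by rewrite inE => /orP[/eqP ->//|]; exact: Ar.
split; first by apply: H; rewrite mem_head.
by apply/IH => j jr; apply: H; rewrite inE jr orbT.
Qed.

Lemma measurable_cylinder t (B : nat -> set R) : (forall i, measurable (B i)) ->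
  measurable (\big[setI/setT]_(i <- iota 1 t) (X i @^-1` B i)).
Proof.
by move=> mB; apply: bigsetI_measurable => i _; exact: measurable_funPTI.
Qed.

Lemma past_cylinders_setI t : setI_closed (past_cylinders t).
Proof.
move=> _ _ [B1 m1 ->] [B2 m2 ->]; exists (fun i => B1 i `&` B2 i).
  by move=> i; exact: measurableI.
by rewrite -big_split.
Qed.

Lemma past_cylindersT t : past_cylinders t setT.
Proof.
exists (fun=> setT) => //; apply/seteqP; split=> // w _.
by apply/bigsetIE => i.
Qed.

Lemma measurable_past_sub t (A : set (past t)) :
  measurable A -> measurable (A : set T).
Proof.
apply: smallest_sub; first exact: sigma_algebra_measurable.
by move=> _ [B mB ->]; exact: measurable_cylinder.
Qed.

Lemma measurable_fun_past_sub d' (U : measurableType d') t (D : set (past t))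
    (f : past t -> U) : measurable D -> measurable_fun D f ->
  measurable_fun (D : set T) (f : T -> U).
Proof. by move=> mD mf _ B mB; apply: (@measurable_past_sub t); exact: mf. Qed.

Lemma measurable_pastS t u (A : set T) : (t <= u)%N ->
  measurable (A : set (past t)) -> measurable (A : set (past u)).
Proof.
move=> tu; apply: smallest_sub.
  exact: (@sigma_algebra_measurable _ (past u)).
move=> _ [B mB ->]; apply: sub_sigma_algebra.
exists (fun i => if (i <= t)%N then B i else setT).
  by move=> i; case: ifP.
apply/seteqP; split=> w /bigsetIE H; apply/bigsetIE => i.
  rewrite mem_iota /preimage /= => iu; case: ifPn => // it.
  by apply: H; rewrite mem_iota; lia.
rewrite mem_iota => it; have := H i; rewrite mem_iota /preimage /=.
by rewrite ifT; [apply|]; lia.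
Qed.

Lemma measurable_fun_pastS d' (U : measurableType d') t u (D : set T)
    (f : T -> U) : (t <= u)%N -> measurable (D : set (past t)) ->
  measurable_fun (D : set (past t)) f -> measurable_fun (D : set (past u)) f.
Proof. by move=> tu mD mf _ B mB; apply: (measurable_pastS tu); exact: mf. Qed.

Lemma measurable_fun_past t i : (1 <= i <= t)%N ->
  measurable_fun setT (X i : past t -> R).
Proof.
move=> it _ B mB; rewrite setTI; apply: sub_sigma_algebra.
exists (fun j => if j == i then B else setT) => [j|]; first by case: ifP.
apply/seteqP; split=> w; last first.
  move=> /bigsetIE/(_ i); rewrite mem_iota /preimage /= eqxx; apply.
  by move: it; lia.
by move=> wB; apply/bigsetIE => j _; rewrite /preimage /=; case: eqP => // ->.
Qed.

Lemma measurable_id_past t : measurable_fun setT (id : T -> past t).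
Proof. by move=> _ B mB; rewrite setTI; exact: (measurable_past_sub mB). Qed.

Hypothesis X_indep : mutually_independent P [set i | (1 <= i)%N] X.

(** Both sides are finite measures in [A]. On cylinders they agree by mutual independence, and
    cylinders are stable under intersection. *)
Lemma past_indep t (A : set (past t)) (B : set R) :
  measurable A -> measurable B ->
  P (A `&` X t.+1 @^-1` B) = (P A * P (X t.+1 @^-1` B))%E.
Proof.
move=> mA mB; set E := X t.+1 @^-1` B.
have mE : measurable E by exact: measurable_funPTI.
have PE : (fine (P E))%:E = P E by rewrite fineK// fin_num_measure.
have p0 : 0 <= fine (P E) by rewrite fine_ge0.
pose m2 := mscale (NngNum p0) P.
have -> : P (A `&` E) = mrestr P mE A by [].
have m2E C : m2 C = (P C * P E)%E by rewrite muleC -[in RHS]PE.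
rewrite -m2E.
apply: (@g_sigma_algebra_measure_unique _ _ _ (past_cylinders t) _ (fun=> setT)) => //.
- by move=> _ [C mC ->]; exact: measurable_cylinder.
- by move=> _; exact: past_cylindersT.
- by rewrite bigcup_const.
- exact: past_cylinders_setI.
- move=> _ [C mC ->]; apply: (eq_trans _ (esym (m2E _))); rewrite /mrestr.
  have iotaS : iota 1 t.+1 = rcons (iota 1 t) t.+1.
    by rewrite -{1}(addn1 t) iotaD cats1 add1n.
  have t1i : t.+1 \notin iota 1 t by rewrite mem_iota; lia.
  pose C' i := if i == t.+1 then B else C i.
  have := X_indep (J := iota 1 t.+1) (iota_uniq _ _) _ (B := C').
  rewrite iotaS !big_rcons /= /C' eqxx.
  rewrite (eq_big_seq (fun i => X i @^-1` C i)); last first.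
    by move=> i it; case: eqP it => [->|//]; rewrite (negbTE t1i).
  rewrite (eq_big_seq (F1 := fun i => P (X i @^-1` _)) (fun i => P (X i @^-1` C i))); last first.
    by move=> i it; case: eqP it => [->|//]; rewrite (negbTE t1i).
  rewrite /mrestr -/E => ->.
  - congr (_ * _)%E; apply/esym; apply: X_indep => //.
      exact: iota_uniq.
    by move=> i; rewrite mem_iota => /andP[].
  - by move=> i; rewrite -iotaS mem_iota => /andP[].
  - by move=> i; case: ifP.
- by move=> k; rewrite /mrestr ltey_eq fin_num_measure// setTI.
Qed.

Variable mu : probability R R.
Hypothesis X_law : forall i, (1 <= i)%N ->
  forall B, measurable B -> P (X i @^-1` B) = mu B.

(** By independence the pair of the past and the next observation has the product law; Tonelli then
    freezes the past. *)
Lemma integral_past t (h : past t * R -> \bar R) :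
  measurable_fun setT h -> (forall z, 0 <= h z)%E ->
  (\int[P]_w h (w : past t, X t.+1 w) =
   \int[P]_w \int[mu]_y h (w : past t, y))%E.
Proof.
move=> mh h0.
pose phi := fun w : T => (w : past t, X t.+1 w).
have mphi : measurable_fun setT phi.
  apply/measurable_fun_pairP; split; first exact: measurable_id_past.
  exact: measurable_funPT.
pose idp : T -> past t := id.
have midp : measurable_fun setT idp by exact: measurable_id_past.
pose Pid := pushforward P idp.
have Pid1 : Pid setT = 1%E by rewrite /Pid /pushforward preimage_setT probability_setT.
pose Pphi := pushforward P phi.
pose idM := isMeasurableFun.Build _ _ _ _ _ midp.
pose idm : {mfun T >-> past t} := HB.pack idp idM.
pose phM := isMeasurableFun.Build _ _ _ _ _ mphi.
pose phm : {mfun T >-> (past t * R)%type} := HB.pack phi phM.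
have E (C : set (past t * R)) : measurable C ->
    (distribution P idm \x mu)%E C = distribution P phm C.
  apply: product_measure_unique => A B mA mB.
  by have := past_indep mA mB; rewrite X_law.
transitivity (\int[distribution P phm]_z h z)%E.
  by rewrite ge0_integral_pushforward //; exact: measurable_funPT.
transitivity (\int[distribution P idm \x mu]_z h z)%E.
  by apply: eq_measure_integral => C mC _; exact/esym/E.
rewrite fubini_tonelli1 // ge0_integral_pushforward //.
- exact: measurable_fun_fubini_tonelli_F.
- by move=> y _; apply: integral_ge0.
Qed.

End Past.

(** * Quantiles of an atomless law *)

Section Quantile.
Context {R : realType}.
Variables (mu : probability R R) (F : R -> R).
Hypothesis F_cdf : forall x, mu `]-oo, x]%classic = (F x)%:E.
Hypothesis mu_atomless : forall x, mu [set x] = 0%E.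

Lemma cdf_ge0 x : 0 <= F x.
Proof. by rewrite -lee_fin -F_cdf. Qed.

Lemma cdf_le1 x : F x <= 1.
Proof. by rewrite -lee_fin -F_cdf probability_le1. Qed.

Lemma cdf_nd x y : x <= y -> F x <= F y.
Proof.
move=> xy; rewrite -lee_fin -!F_cdf le_measure ?inE //.
by apply: subset_itvl; rewrite bnd_simp.
Qed.

Lemma cdf_lt x y : F x < F y -> x < y.
Proof. by rewrite !ltNge; apply: contra; exact: cdf_nd. Qed.

Lemma mu_itvoy x : mu `]x, +oo[%classic = (1 - F x)%:E.
Proof.
by rewrite -setCitvl probability_setC // F_cdf.
Qed.

Lemma mu_itvcy x : mu `[x, +oo[%classic = (1 - F x)%:E.
Proof.
have -> : mu `[x, +oo[%classic = (mu [set x] + mu `]x, +oo[%classic)%E.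
  rewrite -(@setU1itv _ _ +oo%O x false) ?bnd_simp //; apply: measureU => //.
  by apply/seteqP; split=> y //= [->]; rewrite in_itv /= ltxx.
by rewrite mu_atomless add0e mu_itvoy.
Qed.

Lemma mu_itvNyo x : mu `]-oo, x[%classic = (F x)%:E.
Proof.
by rewrite -setCitvr probability_setC // mu_itvcy -EFinB subKr.
Qed.

(** Left continuity of F, which is where atomlessness enters: the open ray below x still has mass F
    x. *)
Lemma cdf_left x e : 0 < e -> exists2 y, y < x & F x - e < F y.
Proof.
move=> e0.
pose A n := `]-oo, x - n.+1%:R^-1]%classic : set R.
have UA : \bigcup_n A n = `]-oo, x[%classic.
  apply/seteqP; split=> y /=.
    move=> [n _]; rewrite /A /= !in_itv /= => /le_lt_trans; apply.
    by rewrite ltrBlDr ltrDl invr_gt0.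
  rewrite in_itv /= -subr_gt0 => /ltr_add_invr[n]; rewrite add0r => nx.
  by exists n => //; rewrite /A /= in_itv /= lerBrDr -lerBrDl ltW.
have : mu \o A @ \oo --> mu (\bigcup_n A n).
  have mA n : measurable (A n) by exact: measurable_itv.
  apply: nondecreasing_cvg_mu => //; first exact: bigcupT_measurable.
  move=> i j ij; apply/subsetPset; apply: subset_itvl; rewrite bnd_simp.
  by rewrite lerB // lef_pV2 ?posrE // ler_nat.
rewrite UA mu_itvNyo => /fine_cvgP[_].
move=> /cvgrPdist_lt/(_ _ e0)[N _ /(_ N (leqnn N))] /=.
rewrite /A F_cdf /= => H; exists (x - N.+1%:R^-1).
  by rewrite ltrBlDr ltrDl invr_gt0.
by rewrite ltrBlDr -ltrBlDl (le_lt_trans (ler_norm _)).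
Qed.

Lemma cdf_right x e : 0 < e -> exists2 y, x < y & F y < F x + e.
Proof.
move=> e0.
pose A n := `]x + n.+1%:R^-1, +oo[%classic : set R.
have UA : \bigcup_n A n = `]x, +oo[%classic.
  apply/seteqP; split=> y /=.
    move=> [n _]; rewrite /A /= !in_itv /= !andbT; apply: le_lt_trans.
    by rewrite lerDl invr_ge0.
  rewrite in_itv /= andbT -subr_gt0 => /ltr_add_invr[n]; rewrite add0r => nx.
  by exists n => //; rewrite /A /= in_itv /= andbT -ltrBrDl.
have : mu \o A @ \oo --> mu (\bigcup_n A n).
  have mA n : measurable (A n) by exact: measurable_itv.
  apply: nondecreasing_cvg_mu => //; first exact: bigcupT_measurable.
  move=> i j ij; apply/subsetPset; apply: subset_itvr; rewrite bnd_simp.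
  by rewrite lerD2l lef_pV2 ?posrE // ler_nat.
rewrite UA mu_itvoy => /fine_cvgP[_].
move=> /cvgrPdist_lt/(_ _ e0)[N _ /(_ N (leqnn N))] /=.
rewrite /A mu_itvoy /= => H; exists (x + N.+1%:R^-1).
  by rewrite ltrDl invr_gt0.
have := le_lt_trans (ler_norm _) H; lra.
Qed.

Lemma cdf_small e : 0 < e -> exists y, F y < e.
Proof.
move=> e0.
pose A n := `](- n%:R)%R, +oo[%classic : set R.
have UA : \bigcup_n A n = setT.
  apply/seteqP; split=> // y _; exists (Num.truncn `|y|).+1 => //=.
  rewrite /A /= in_itv /= andbT ltrNl.
  by rewrite (le_lt_trans _ (truncnS_gt _)) // -normrN ler_norm.
have : mu \o A @ \oo --> mu (\bigcup_n A n).
  have mA n : measurable (A n) by exact: measurable_itv.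
  apply: nondecreasing_cvg_mu => //; first exact: bigcupT_measurable.
  move=> i j ij; apply/subsetPset; apply: subset_itvr; rewrite bnd_simp.
  by rewrite lerN2 ler_nat.
rewrite UA probability_setT => /fine_cvgP[_].
move=> /cvgrPdist_lt/(_ _ e0)[N _ /(_ N (leqnn N))] /=.
rewrite /A mu_itvoy /= => H; exists (- N%:R).
have := le_lt_trans (ler_norm _) H; lra.
Qed.

Lemma cdf_large e : 0 < e -> exists y, 1 - e < F y.
Proof.
move=> e0.
pose A n := `]-oo, n%:R]%classic : set R.
have UA : \bigcup_n A n = setT.
  apply/seteqP; split=> // y _; exists (Num.truncn `|y|).+1 => //=.
  rewrite /A /= in_itv /=.
  by rewrite (le_trans _ (ltW (truncnS_gt _))) // ler_norm.
have : mu \o A @ \oo --> mu (\bigcup_n A n).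
  have mA n : measurable (A n) by exact: measurable_itv.
  apply: nondecreasing_cvg_mu => //; first exact: bigcupT_measurable.
  move=> i j ij; apply/subsetPset; apply: subset_itvl; rewrite bnd_simp.
  by rewrite ler_nat.
rewrite UA probability_setT => /fine_cvgP[_].
move=> /cvgrPdist_lt/(_ _ e0)[N _ /(_ N (leqnn N))] /=.
rewrite /A F_cdf /= => H; exists N%:R.
have := le_lt_trans (ler_norm _) H; lra.
Qed.

(** The largest p-quantile. The sup of {F <= p} is right-continuous in p and gives the Galois
    relation [le_quantile]. *)
Definition quantile (p : R) : R := sup [set x | F x <= p].

Lemma quantile_has_sup p : p < 1 -> (exists x, F x <= p) ->
  has_sup [set x | F x <= p].
Proof.
move=> p1 [x Fx]; split; first by exists x.
have /cdf_large[y] : 0 < 1 - p by rewrite subr_gt0.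
rewrite subKr => py; exists y => z /= Fz.
by apply/ltW/cdf_lt; exact: le_lt_trans py.
Qed.

(** The forward direction is left continuity: were F x > p, F would exceed p already at some y < x,
    and the sup could not reach x. *)
Lemma le_quantile p x : p < 1 -> (exists x, F x <= p) ->
  (x <= quantile p) = (F x <= p).
Proof.
move=> p1 ex; have hs := quantile_has_sup p1 ex.
apply/idP/idP => [xq|Fx]; last by apply: ub_le_sup; [exact: hs.2|].
rewrite leNgt; apply/negP => pF.
have /(cdf_left x)[y yx] : 0 < F x - p by rewrite subr_gt0.
rewrite subKr => py.
have d0 : 0 < quantile p - y by rewrite subr_gt0 (lt_le_trans yx).
have [e1 Fe1] := sup_adherent d0 hs.
rewrite -/(quantile p) subKr => ye1.
by have := lt_le_trans py (le_trans (cdf_nd (ltW ye1)) Fe1); rewrite ltxx.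
Qed.

Lemma cdf_quantile p : p < 1 -> (exists x, F x <= p) -> 0 <= p ->
  F (quantile p) = p.
Proof.
move=> p1 ex p0; apply/eqP; rewrite eq_le -le_quantile // lexx /=.
rewrite leNgt; apply/negP => Fp.
have /(cdf_right (quantile p))[y qy] : 0 < p - F (quantile p).
  by rewrite subr_gt0.
rewrite addrC subrK => /ltW; rewrite -le_quantile // => yq.
by have := lt_le_trans qy yq; rewrite ltxx.
Qed.

Lemma measurable_cdf : measurable_fun setT F.
Proof. by apply: nondecreasing_measurable => // x y; exact: cdf_nd. Qed.

(** If F x > 0 for some x < l, the quantile of p = F x / 2 lies left of x and belongs to the
    support, since F <= p before it and F > p after it. Left continuity then carries F = 0 up to
    l. *)
Lemma cdf_left_endpoint : has_lbound (cdf_support F) -> F (left_endpoint F) = 0.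
Proof.
move=> hl.
have Fl0 x : x < left_endpoint F -> F x = 0.
  move=> xl; apply/eqP; rewrite eq_le cdf_ge0 andbT leNgt; apply/negP => Fx0.
  pose p := F x / 2.
  have p0 : 0 < p by rewrite divr_gt0.
  have pFx : p < F x by rewrite ltr_pdivrMr // ltr_pMr // ltr1n.
  have p1 : p < 1 := lt_le_trans pFx (cdf_le1 x).
  have ex : exists y, F y <= p by have [y /ltW] := cdf_small p0; exists y.
  have Fq := cdf_quantile p1 ex (ltW p0).
  have qx : quantile p < x by apply: cdf_lt; rewrite Fq.
  have : cdf_support F (quantile p).
    move=> e e0; apply: (@le_lt_trans _ _ p).
      by rewrite -le_quantile // gerBl ltW.
    by rewrite ltNge -le_quantile // -ltNge ltrDl.
  move=> /(ge_inf hl) => lq.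
  by have := lt_trans (le_lt_trans lq qx) xl; rewrite ltxx.
apply/eqP; rewrite eq_le cdf_ge0 andbT leNgt; apply/negP => Fl.
have [y /Fl0 Fy] := cdf_left (left_endpoint F) Fl.
by rewrite Fy subrr ltxx.
Qed.

(* The reparametrisation [s = - ln (1 - F x)], inverted: it carries the
   standard exponential law to [mu]. *)
Definition exp_quantile (s : R) : R := quantile (1 - expR (- Num.max s 0)).

Variable l : R.
Hypothesis F_l : F l = 0.

Let ex_small (s : R) : exists x, F x <= 1 - expR (- Num.max s 0).
Proof.
by exists l; rewrite F_l subr_ge0 -expR0 ler_expR lerNl oppr0 le_max lexx orbT.
Qed.

Let small_lt1 (s : R) : 1 - expR (- s) < 1.
Proof. by rewrite ltrBlDr ltrDl expR_gt0. Qed.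

Lemma le_exp_quantile s x : 0 <= s ->
  (x <= exp_quantile s) = (F x <= 1 - expR (- s)).
Proof.
move=> s0; rewrite /exp_quantile le_quantile //.
by rewrite (max_idPl s0).
Qed.

Lemma cdf_exp_quantile s : 0 <= s -> F (exp_quantile s) = 1 - expR (- s).
Proof.
move=> s0; rewrite /exp_quantile cdf_quantile //.
- by rewrite (max_idPl s0).
- by rewrite subr_ge0 -expR0 ler_expR lerNl oppr0 le_max lexx orbT.
Qed.

Lemma exp_quantile_lt s t : 0 <= s -> s < t ->
  exp_quantile s < exp_quantile t.
Proof.
move=> s0 st; apply: cdf_lt; rewrite !cdf_exp_quantile //.
  by rewrite ltrD2l ltrN2 ltr_expR ltrN2.
by rewrite ltW // (le_lt_trans s0).
Qed.

(** The clamp [Num.max s 0] gives monotonicity on the whole line, negative arguments included, and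
    with it measurability. *)
Lemma exp_quantile_nd s t : s <= t -> exp_quantile s <= exp_quantile t.
Proof.
move=> st; rewrite {2}/exp_quantile le_quantile //.
rewrite cdf_quantile //; last first.
- by rewrite subr_ge0 -expR0 ler_expR lerNl oppr0 le_max lexx orbT.
- by rewrite lerD2l lerN2 ler_expR lerN2 ge_max !le_max st lexx orbT.
Qed.

Lemma measurable_exp_quantile : measurable_fun setT exp_quantile.
Proof. by apply: nondecreasing_measurable => // s t; exact: exp_quantile_nd. Qed.

Lemma exp_quantile_ge s : 0 <= s -> l <= exp_quantile s.
Proof.
move=> s0; rewrite le_exp_quantile // F_l subr_ge0 -expR0 ler_expR.
by rewrite lerNl oppr0.
Qed.

Lemma exp_quantile_right s e : 0 <= s -> 0 < e ->
  exists2 t, s < t & exp_quantile t < exp_quantile s + e.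
Proof.
move=> s0 e0; set x := exp_quantile s + e.
have : ~~ (x <= exp_quantile s) by rewrite -ltNge ltrDl.
rewrite le_exp_quantile // -ltNge => sx.
(* The level [q] is above that of s, at most F x and below 1, so that the logarithm used below is
   that of a positive number. [r] lies strictly between the level of s and [q], and t is its
   exponential coordinate. *)
pose q := Num.min (F x) ((1 + (1 - expR (- s))) / 2).
have sq : 1 - expR (- s) < q.
  rewrite lt_min sx /=; have := small_lt1 s; lra.
have q1 : q < 1.
  by rewrite gt_min; apply/orP; right; have := small_lt1 s; lra.
pose r := (q + (1 - expR (- s))) / 2.
have r1 : 0 < 1 - r by rewrite /r; lra.
have sr : s < - ln (1 - r).
  by rewrite ltrNr -ltr_expR lnK ?posrE // /r; lra.
exists (- ln (1 - r)) => //.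
have t0 : 0 <= - ln (1 - r) by rewrite ltW // (le_lt_trans s0).
rewrite ltNge le_exp_quantile // opprK lnK ?posrE // subKr -ltNge.
rewrite (_ : r < F x) //.
have : q <= F x by rewrite ge_min lexx.
by rewrite /r; lra.
Qed.

Lemma integral_expRN (s : R) :
  (\int[lebesgue_measure]_(y in `]s, +oo[) (expR (- y))%:E = (expR (- s))%:E)%E.
Proof.
rewrite integral_itv_obnd_cbnd; last first.
  apply/measurable_EFinP/measurable_funTS/measurableT_comp => //.
rewrite (@ge0_continuous_FTC2y R _ (fun y => - expR (- y)) s 0).
- by rewrite sub0e -EFinN opprK.
- by move=> x _; exact: expR_ge0.
- apply: continuous_subspaceT => x.
  by apply: continuous_comp; [exact: opp_continuous|exact: continuous_expR].
- rewrite -[X in _ --> X]oppr0; apply: cvgN.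
  exact: cvgr_expR.
- by move=> x _; exact: ex_derive.
- apply: cvg_at_right_filter.
  apply: cvgN; apply: continuous_comp; [exact: opp_continuous|exact: continuous_expR].
- move=> x _; rewrite derive1E.
  by rewrite derive_val; ring.
Qed.
(** Checked on closed rays: within the half-line the preimage of [x, oo[ is the ray from - ln (1 - F
    x), of exponential mass 1 - F x. *)
Lemma integral_exp_quantile (f : R -> \bar R) : measurable_fun setT f ->
  (forall x, 0 <= f x)%E ->
  (\int[mu]_x f x =
   \int[lebesgue_measure]_(s in `]0%R, +oo[)
     (f (exp_quantile s) * (expR (- s))%:E))%E.
Proof.
move=> mf f0.
pose h (s : R) : R := expR (- s) * \1_(`]0, +oo[%classic : set R) s.
have mh : measurable_fun setT h.
  apply: measurable_funM; last exact: measurable_indic.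
  exact: measurableT_comp.
have h0 s : 0 <= h s by rewrite mulr_ge0 ?expR_ge0.
have [nu [nuE nu_int]] := density_measure (@lebesgue_measure R) mh h0.
have hE (A : set R) : (\int[lebesgue_measure]_(x in A) (h x)%:E =
    \int[lebesgue_measure]_(x in A `&` `]0%R, +oo[) (expR (- x))%:E)%E.
  rewrite [RHS]integral_mkcondr; apply: eq_integral => x _.
  by rewrite /h patchE indicE; case: ifPn => _; rewrite ?mulr1 ?mulr0.
have mG := measurable_exp_quantile.
pose idM := isMeasurableFun.Build _ _ _ _ _ mG.
pose Gm : {mfun R >-> R} := HB.pack exp_quantile idM.
have muE A : measurable A -> mu A = pushforward nu Gm A.
  apply: measure_unique_rays => x; last first.
    exact: le_lt_trans (probability_le1 mu (measurable_itv _)) (ltry _).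
  apply: (eq_trans (mu_itvcy x)); apply/esym.
  have mGx : measurable (Gm @^-1` `[x, +oo[%classic).
    by rewrite -[X in measurable X]setTI; exact: measurable_exp_quantile.
  apply: (eq_trans (nuE _ mGx)).
  rewrite hE; apply/esym.
  (* When F x = 1 the preimage is empty, because 1 - exp (-s) < 1. *)
  have [Fx1|Fx1] := ltP (F x) 1; last first.
    rewrite (_ : _ `&` _ = set0) ?integral_set0.
      by congr EFin; apply/eqP; rewrite subr_eq0 eq_le Fx1 cdf_le1.
    apply/seteqP; split => // s /=; rewrite !in_itv /= !andbT => -[+ s0].
    rewrite (le_exp_quantile _ (ltW s0)) => H.
    by have := le_lt_trans H (small_lt1 _); rewrite ltNge Fx1.
  have q0 : 0 <= - ln (1 - F x).
    by rewrite oppr_ge0 ln_le0 // gerBl cdf_ge0.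
  have eF : expR (- - ln (1 - F x)) = 1 - F x.
    by rewrite opprK lnK // posrE subr_gt0.
  rewrite -[in LHS]eF -integral_expRN.
  have -> : Gm @^-1` `[x, +oo[ `&` `]0, +oo[ =
      (`[- ln (1 - F x), +oo[ `&` `]0, +oo[)%classic.
    have qle s : (- ln (1 - F x) <= s) = (F x <= 1 - expR (- s)).
      rewrite lerNl -[LHS]ler_expR lnK ?posrE ?subr_gt0 //.
      by rewrite lerBrDr addrC -lerBrDr.
    by apply/seteqP; split=> s /=; rewrite !in_itv /= !andbT => -[+ s0];
      rewrite (le_exp_quantile _ (ltW s0)) qle.
  move: q0; rewrite le_eqVlt => /predU1P[<-|q0].
    congr (integral _ _ _); apply/seteqP; split=> s /=.
      by rewrite !in_itv /= !andbT => s0; rewrite (ltW s0).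
    by move=> [].
  rewrite integral_itv_obnd_cbnd; last exact/measurable_EFinP/measurable_funTS/measurableT_comp.
  congr (integral _ _ _); apply/seteqP; split=> s /=; last by case.
  by rewrite !in_itv /= !andbT => qs; split=> //; exact: lt_le_trans qs.
transitivity (\int[pushforward nu Gm]_x f x)%E.
  by apply: eq_measure_integral => A mA _; exact: muE.
rewrite ge0_integral_pushforward // nu_int; last 2 first.
- exact: measurableT_comp.
- by move=> s /=.
rewrite [RHS]integral_mkcond; apply: eq_integral => s _.
rewrite patchE /h indicE; case: ifPn => _; rewrite ?mulr1 ?mulr0 ?mule0 //.
Qed.

(** In the coordinate s one has F (G s) = 1 - exp (-s) < 1. Only where F < 1 can a further record
    occur with positive probability. *)
Lemma cdf_eq1_null : mu [set x | F x = 1] = 0%E.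
Proof.
have mA : measurable [set x | F x = 1].
  by rewrite -[X in measurable X]setTI; exact: (measurable_cdf measurableT (measurable_set1 1)).
have := integral_indic mu measurableT mA; rewrite setIT => <-.
rewrite integral_exp_quantile; last 2 first.
- exact/measurable_EFinP/measurable_indic.
- by move=> x; rewrite lee_fin.
apply: integral0_eq => s; rewrite /= in_itv /= andbT => /ltW s0.
rewrite indicE memNset ?mul0e //= cdf_exp_quantile //.
by have := expR_gt0 (- s) => ? ?; lra.
Qed.

(* E[g | > x] under [mu]; the factor is 1 / (1 - F x), and 1 where F x = 1. *)
Definition cond_above (g : R -> \bar R) (x : R) : \bar R :=
  ((expR (- ln (1 - F x)))%:E * tail_integral mu g x)%E.

Lemma cond_above_ge0 g x : (forall y, 0 <= g y)%E -> (0 <= cond_above g x)%E.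
Proof.
by move=> g0; rewrite mule_ge0 ?tail_integral_ge0 // lee_fin expR_ge0.
Qed.

Lemma measurable_cond_above g : measurable_fun setT g -> (forall y, 0 <= g y)%E ->
  measurable_fun setT (cond_above g).
Proof.
move=> mg g0; apply: emeasurable_funM; last exact: measurable_tail_integral.
apply/measurable_EFinP; apply: measurableT_comp => //.
apply: measurableT_comp => //; apply: measurableT_comp => //.
by apply: measurable_funB => //; exact: measurable_cdf.
Qed.

(** In the coordinate s, conditioning above is J conjugated by exp (s), since strict monotonicity of
    G turns G s < G y into s < y. *)
Lemma cond_above_exp_quantile g (s : R) : measurable_fun setT g ->
  (forall y, 0 <= g y)%E -> 0 <= s ->
  (cond_above g (exp_quantile s) =
   (expR s)%:E * leb_tail
     (fun y => g (exp_quantile y) * (expR (- y))%:E) s)%E.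
Proof.
move=> mg g0 s0; rewrite /cond_above cdf_exp_quantile // subKr expRK opprK.
congr (_ * _)%E; rewrite tail_integralE integral_exp_quantile; last 2 first.
- apply: emeasurable_funM => //; apply/measurable_EFinP.
  apply: measurable_fun_pair2; apply: measurable_indic.
  exact: measurable_set_ltr.
- by move=> y; rewrite mule_ge0 // lee_fin.
rewrite leb_tailE integral_mkcond; apply: eq_integral => y _.
rewrite patchE mem_setE in_itv /= andbT !indicE -muleAC.
have [y0|y0] := ltP; last first.
  by rewrite memNset ?mule0 //=; apply/negP; rewrite -leNgt (le_trans y0).
congr (_ * ((nat_of_bool _)%:R)%:E)%E; apply/idP/idP; rewrite !inE /=.
  by rewrite !ltNge; apply: contra; exact: exp_quantile_nd.
exact: exp_quantile_lt.
Qed.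

End Quantile.

(** * Records *)

Section RecordTimes.
Context {R : realType}.
Implicit Types (x : nat -> R) (i j s t : nat).

(* [t] is the time of the [i.+1]-st record, and that record really exists
   ([record_time] stalls when there is no further record). *)
Fixpoint rec_at x i t : Prop :=
  match i with
  | 0 => t = 1%N
  | i'.+1 => exists s, [/\ (s < t)%N, rec_at x i' s,
      (forall j, (s < j < t)%N -> x j <= x s) & x s < x t]
  end.

Lemma next_record_timeP x s t : next_record_time x s = t <->
  ([/\ (s < t)%N, x s < x t & forall j, (s < j < t)%N -> x j <= x s] \/
   (s = t /\ forall j, (s < j)%N -> x j <= x s)).
Proof.
rewrite /next_record_time; case: pselect => [h|h].
  case: ex_minnP => u /andP[su xu] umin; split=> [<-|].
    left; split=> // j /andP[sj ju]; rewrite leNgt; apply/negP => xj.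
    by have := umin j; rewrite sj xj leqNgt ju => /(_ isT).
  move=> [[st xt tmin]|[_ sj]]; last by move: xu; rewrite ltNge sj.
  apply/eqP; rewrite eqn_leq umin ?st // leqNgt; apply/negP => ut.
  by move: xu; rewrite ltNge tmin // su.
split=> [<-|]; last by case=> [[st xt _]|[]//]; case: h; exists t; rewrite st.
right; split=> // j sj; rewrite leNgt; apply/negP => xj.
by case: h; exists j; rewrite sj.
Qed.

Lemma rec_at_time x i t : rec_at x i t -> record_time x i.+1 = t.
Proof.
elim: i t => [t ->//|i IH t [s [st /IH rs sj xst]]].
by rewrite -[LHS]/(next_record_time x (record_time x i.+1)) rs;
  apply/next_record_timeP; left.
Qed.

Lemma rec_at_gt0 x i t : rec_at x i t -> (0 < t)%N.
Proof. by case: i => [->//|i [s [st _ _ _]]]; exact: leq_ltn_trans st. Qed.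

Lemma rec_at_uniq x i s t : rec_at x i s -> rec_at x i t -> s = t.
Proof. by move=> /rec_at_time <- /rec_at_time. Qed.

Lemma rec_at_value x i t : rec_at x i t -> record_value x i.+1 = x t.
Proof. by rewrite /record_value => /rec_at_time ->. Qed.

(** Holds for every sequence: a stalled record time repeats the value. *)
Lemma record_value_ndS x i : record_value x i.+1 <= record_value x i.+2.
Proof.
rewrite /record_value -[record_time x i.+2]/(next_record_time x _).
set s := record_time x i.+1.
have /next_record_timeP[[_ /ltW //]|[<- //]] :
  next_record_time x s = next_record_time x s by [].
Qed.

Lemma record_value_nd x i j : (i <= j)%N ->
  record_value x i.+1 <= record_value x j.+1.
Proof.
move=> /subnK <-; elim: (j - i)%N => [//|k IH].
by rewrite addSn (le_trans IH) // record_value_ndS.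
Qed.

End RecordTimes.

Section RecordMeasurability.
Context {disp : measure_display} {T : measurableType disp} {R : realType}.
Variables (P : probability T R) (X : nat -> {RV P >-> R}).

(* R_{i+1}: the index is shifted by one. *)
Definition record_rv i (w : T) : R := record_value (fun j => X j w) i.+1.

Lemma measurable_no_record s (J : set nat) :
  measurable [set w : T | forall j, J j -> X j w <= X s w].
Proof.
rewrite (_ : [set w | _] = \bigcap_(j in J) [set w | X j w <= X s w]) //.
by apply: bigcap_measurableType => j _; exact: measurable_set_ler.
Qed.

Lemma measurable_record_time i t :
  measurable [set w : T | record_time (fun j => X j w) i.+1 = t].
Proof.
elim: i t => [|i IH] t.
  rewrite (_ : [set w | _] = if t == 1%N then setT else set0); first by case: ifP.
  apply/seteqP; split=> w /=; first by move=> <-; rewrite eqxx.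
  by case: eqP.
rewrite (_ : [set w | _] = \bigcup_s ([set w | record_time (fun j => X j w) i.+1 = s] `&`
   [set w | next_record_time (fun j => X j w) s = t])); last first.
  apply/seteqP; split=> w /=; last by move=> [s _ [/= <-]].
  by exists (record_time (fun j => X j w) i.+1).
apply: bigcup_measurable => s _; apply: measurableI => //.
rewrite (_ : [set w | _] =
  ((if (s < t)%N then setT else set0) `&` ([set w | X s w < X t w] `&`
    [set w | forall j, (s < j < t)%N -> X j w <= X s w])) `|`
  ((if s == t then setT else set0) `&` [set w | forall j, (s < j)%N -> X j w <= X s w])).
  apply: measurableU; apply: measurableI.
  - by case: ifP.
  - apply: measurableI; first exact: measurable_set_ltr.
    exact: (measurable_no_record s [set j | s < j < t]%N).
  - by case: ifP.
  - exact: (measurable_no_record s [set j | s < j]%N).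
apply/seteqP; split=> w /=.
  by move/next_record_timeP => [[-> xs sj]|[-> sj]]; [left|right; rewrite eqxx].
move=> H; apply/next_record_timeP; move: H.
case=> [[+ [xs sj]]|[+ sj]]; first by case: ifP => // st _; left.
by case: eqP => // st _; right.
Qed.

Lemma measurable_record_rv i : measurable_fun setT (record_rv i).
Proof.
move=> _ B mB; rewrite setTI.
rewrite (_ : _ @^-1` _ = \bigcup_t
  ([set w | record_time (fun j => X j w) i.+1 = t] `&` X t @^-1` B)); last first.
  apply/seteqP; split=> w /=; last first.
    by rewrite /record_rv /record_value; move=> [t _ [/= ->]].
  by exists (record_time (fun j => X j w) i.+1).
apply: bigcup_measurable => t _; apply: measurableI.
  exact: measurable_record_time.
exact: measurable_funPTI.
Qed.

Definition rec_event i t : set T := [set w | rec_at (fun j => X j w) i t].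

Definition no_rec_event t j : set T :=
  [set w | forall l, (t < l <= t + j)%N -> X l w <= X t w].

Lemma measurable_past_ltr t a b : (1 <= a <= t)%N -> (1 <= b <= t)%N ->
  measurable ([set w | X a w < X b w] : set (past X t)).
Proof. by move=> at_ bt; apply: measurable_set_ltr; exact: measurable_fun_past. Qed.

Lemma measurable_past_ler t a b : (1 <= a <= t)%N -> (1 <= b <= t)%N ->
  measurable ([set w | X a w <= X b w] : set (past X t)).
Proof. by move=> at_ bt; apply: measurable_set_ler; exact: measurable_fun_past. Qed.

Lemma measurable_no_rec_event t j : (1 <= t)%N ->
  measurable (no_rec_event t j : set (past X (t + j))).
Proof.
move=> t1; rewrite (_ : no_rec_event t j =
  \bigcap_(l in [set l | t < l <= t + j]%N) [set w | X l w <= X t w]) //.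
apply: bigcap_measurableType => l /= /andP[tl lj].
by apply: measurable_past_ler; lia.
Qed.

(** Splits by the time t of the preceding record; [s - t.+1] observations lie strictly between the
    two. *)
Lemma rec_eventS i s : rec_event i.+1 s =
  \bigcup_(t in [set t | 1 <= t < s]%N)
    (rec_event i t `&` (no_rec_event t (s - t.+1) `&` [set w | X t w < X s w])).
Proof.
apply/seteqP; split=> w /=.
  move=> [t [ts rt tj xt]]; exists t; first by rewrite /= (rec_at_gt0 rt).
  by split=> //; split=> // l H; apply: tj; lia.
move=> [t /= /andP[t1 ts] [rt [tj xt]]]; exists t; split=> // l H.
by apply: tj; lia.
Qed.

(** Record times are stopping times. *)
Lemma measurable_rec_event i t : measurable (rec_event i t : set (past X t)).
Proof.
elim: i t => [|i IH] t.
  rewrite (_ : rec_event 0 t = if t == 1%N then setT else set0); first by case: ifP.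
  by apply/seteqP; split=> w; rewrite /rec_event /=; case: eqP.
rewrite rec_eventS; apply: bigcup_measurable => s /= /andP[s1 st].
apply: measurableI; first exact: (measurable_pastS (ltnW st) (IH s)).
apply: measurableI; last by apply: measurable_past_ltr; lia.
apply: (@measurable_pastS _ _ _ _ X (s + (t - s.+1))); first by lia.
exact: measurable_no_rec_event.
Qed.

End RecordMeasurability.

(** The sum is written with exp and ln to match [cond_above]; [x] may be infinite. *)
Lemma nneseries_geometric (R : realType) (x : \bar R) (q : R) :
  (0 <= x)%E -> 0 <= q -> q < 1 ->
  (\sum_(j <oo) (x * (q ^+ j)%:E) = x * (expR (- ln (1 - q)))%:E)%E.
Proof.
move=> x0 q0 q1; rewrite expRN lnK ?posrE ?subr_gt0 //.
apply/cvg_lim => //.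
rewrite (_ : (fun n => _) = (fun n => x * (series (geometric 1 q) n)%:E)%E); last first.
  apply/funext => n; rewrite -ge0_sume_distrr; last first.
    by move=> i _; rewrite lee_fin exprn_ge0.
  by congr (_ * _)%E; rewrite sumEFin; congr EFin; apply: eq_bigr => i _; rewrite /= mul1r.
apply: cvgeM.
- by case: x x0 => [x||] //= _; rewrite /mule_def /= invr_eq0 subr_eq0 gt_eqF.
- exact: cvg_cst.
- apply: cvg_EFin; first exact: nearW.
  rewrite -[X in _ --> X]mul1r; apply: cvg_geometric_series.
  by rewrite ger0_norm.
Qed.

(** * Markov property of the record values *)

Section RecordMarkov.
Context {disp : measure_display} {T : measurableType disp} {R : realType}.
Variables (P : probability T R) (X : nat -> {RV P >-> R}).
Hypothesis X_indep : mutually_independent P [set i | (1 <= i)%N] X.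
Variables (mu : probability R R) (F : R -> R).
Hypothesis X_law : forall i, (1 <= i)%N ->
  forall B, measurable B -> P (X i @^-1` B) = mu B.
Hypothesis F_cdf : forall x, mu `]-oo, x]%classic = (F x)%:E.
Hypothesis mu_F1 : mu [set x | F x = 1] = 0%E.
Local Open Scope ereal_scope.

(** Each of the j observations after t is independent of what precedes it and stays at or below X_t
    with conditional probability F (X_t). *)
Lemma integral_no_record t j (V : past X t -> \bar R) (f : R -> \bar R) :
  (1 <= t)%N -> measurable_fun setT V -> (forall w, 0 <= V w) ->
  measurable_fun setT f -> (forall x, 0 <= f x) ->
  \int[P]_w (V w * (\1_(no_rec_event X t j) w)%:E * f (X t w)) =
  \int[P]_w (V w * (f (X t w) * (F (X t w) ^+ j)%:E)).
Proof.
move=> t1 mV V0; elim: j f => [|j IH] f mf f0.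
  apply: eq_integral => w _; rewrite expr0 mule1 indicE mem_set ?mule1 //.
  by rewrite /no_rec_event /= => l; lia.
have tj : (t <= t + j)%N by lia.
have mF : measurable_fun setT F.
  by apply: nondecreasing_measurable => // x y; exact: (cdf_nd F_cdf).
have mVj : measurable_fun setT (V : past X (t + j) -> \bar R).
  by apply: (@measurable_fun_pastS _ _ _ _ X _ _ t).
have mN : measurable_fun setT
    ((\1_(no_rec_event X t j) : past X (t + j) -> R)).
  by apply: measurable_indic; exact: measurable_no_rec_event.
have mXt : measurable_fun setT (X t : past X (t + j) -> R).
  by apply: measurable_fun_past; rewrite t1.
pose A : set (past X (t + j) * R) := [set z | (z.2 <= X t z.1)%R].
have mA : measurable A.
  exact: (measurable_set_ler measurable_snd (measurableT_comp mXt measurable_fst)).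
pose V1 (w : past X (t + j)) := V w * (\1_(no_rec_event X t j) w)%:E * f (X t w).
have mV1 : measurable_fun setT V1.
  apply: emeasurable_funM; last exact: measurableT_comp.
  by apply: emeasurable_funM => //; exact/measurable_EFinP.
have V10 w : 0 <= V1 w by rewrite !mule_ge0 // lee_fin.
pose h (z : past X (t + j) * R) := V1 z.1 * (\1_A z)%:E.
have mh : measurable_fun setT h.
  apply: emeasurable_funM; first exact: (measurableT_comp mV1 measurable_fst).
  by apply/measurable_EFinP; exact: measurable_indic.
have h0 z : 0 <= h z by rewrite mule_ge0 // lee_fin.
transitivity (\int[P]_w h (w : past X (t + j), X (t + j).+1 w)).
  apply: eq_integral => w _; rewrite /h /V1 /=.
  rewrite -!muleA; congr (_ * _); rewrite [RHS]muleCA muleC; congr (_ * _).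
  rewrite -EFinM; congr EFin; rewrite !indicE -natrM mulnb.
  congr ((nat_of_bool _)%:R)%R; apply/idP/andP => [/set_mem H|[/set_mem H /set_mem /= xt]].
    split; apply/mem_set; last by apply: H; lia.
    by move=> l lj; apply: H; lia.
  apply/mem_set => l lj; have [lj'|lj'] := leqP l (t + j); first by apply: H; lia.
  by rewrite (_ : l = (t + j).+1) //; lia.
rewrite (integral_past X_indep X_law mh h0).
transitivity (\int[P]_w (V1 w * (F (X t w))%:E)).
  apply: eq_integral => w _; rewrite /h /=.
  have mAw : measurable ([set y | (y <= X t w)%R] : set R).
    by rewrite (_ : [set y | _] = `]-oo, X t w]%classic) //; apply/seteqP; split=> y /=; rewrite in_itv.
  have mI : measurable_fun setT (fun y : R => (\1_A (w : past X (t + j), y))%:E : \bar R).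
    apply/measurable_EFinP; rewrite (_ : (fun y => _) = \1_[set y | (y <= X t w)%R]).
      exact: measurable_indic.
    by apply/funext => y; rewrite !indicE.
  rewrite (ge0_integralZl mu measurableT mI _ (V10 w)); last first.
    by move=> y _; rewrite lee_fin.
  congr (_ * _); rewrite -F_cdf.
  transitivity (\int[mu]_y (\1_(`]-oo, X t w]%classic : set R) y)%:E).
    apply: eq_integral => y _; rewrite !indicE.
    have -> : (y \in `]-oo, X t w]%classic) = ((w : past X (t + j), y) \in A).
      by apply/idP/idP => /set_mem H; apply/mem_set; move: H; rewrite /A /= in_itv.
    by [].
  by rewrite integral_indic // setIT.
under eq_integral do rewrite /V1 -muleA.
(* The new factor is absorbed into [f], which is why the induction runs over all [f]. *)
rewrite (IH (fun x => f x * (F x)%:E)); first last.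
- by move=> x; rewrite mule_ge0 // lee_fin (cdf_ge0 F_cdf).
- by apply: emeasurable_funM => //; exact/measurable_EFinP.
apply: eq_integral => w _; rewrite -!muleA; congr (_ * (_ * _)).
by rewrite exprS EFinM.
Qed.

Lemma integral_next_record t j (V : past X t -> \bar R) (g : R -> \bar R) :
  (1 <= t)%N -> measurable_fun setT V -> (forall w, 0 <= V w) ->
  measurable_fun setT g -> (forall x, 0 <= g x) ->
  \int[P]_w (V w * (\1_(no_rec_event X t j) w)%:E *
    (g (X (t + j).+1 w) * (\1_[set w | (X t w < X (t + j).+1 w)%R] w)%:E)) =
  \int[P]_w (V w * (tail_integral mu g (X t w) * (F (X t w) ^+ j)%:E)).
Proof.
move=> t1 mV V0 mg g0; rewrite -integral_no_record //; last 2 first.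
- exact: measurable_tail_integral.
- by move=> x; exact: tail_integral_ge0.
have tj : (t <= t + j)%N by lia.
have mVj : measurable_fun setT (V : past X (t + j) -> \bar R).
  by apply: (@measurable_fun_pastS _ _ _ _ X _ _ t).
have mN : measurable_fun setT
    ((\1_(no_rec_event X t j) : past X (t + j) -> R)).
  by apply: measurable_indic; exact: measurable_no_rec_event.
have mXt : measurable_fun setT (X t : past X (t + j) -> R).
  by apply: measurable_fun_past; rewrite t1.
pose A : set (past X (t + j) * R) := [set z | (X t z.1 < z.2)%R].
have mA : measurable A.
  exact: (measurable_set_ltr (measurableT_comp mXt measurable_fst) measurable_snd).
pose V1 (w : past X (t + j)) := V w * (\1_(no_rec_event X t j) w)%:E.
have mV1 : measurable_fun setT V1.
  by apply: emeasurable_funM => //; exact/measurable_EFinP.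
have V10 w : 0 <= V1 w by rewrite !mule_ge0 // lee_fin.
pose h (z : past X (t + j) * R) := V1 z.1 * (g z.2 * (\1_A z)%:E).
have mh : measurable_fun setT h.
  apply: emeasurable_funM; first exact: (measurableT_comp mV1 measurable_fst).
  apply: emeasurable_funM; first exact: (measurableT_comp mg measurable_snd).
  by apply/measurable_EFinP; exact: measurable_indic.
have h0 z : 0 <= h z by rewrite !mule_ge0 // lee_fin.
transitivity (\int[P]_w h (w : past X (t + j), X (t + j).+1 w)).
  by apply: eq_integral => w _; rewrite /h /V1 /= !indicE.
rewrite (integral_past X_indep X_law mh h0).
apply: eq_integral => w _; rewrite /h /= tail_integralE.
pose B : set (R * R) := [set z | (z.1 < z.2)%R].
have mI : measurable_fun setT (fun y : R => g y * (\1_B (X t w, y))%:E).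
  apply: emeasurable_funM => //; apply/measurable_EFinP.
  by apply: measurable_fun_pair2; apply: measurable_indic; exact: measurable_set_ltr.
by rewrite -(ge0_integralZl mu measurableT mI _ (V10 w)) // => y _; rewrite mule_ge0 // lee_fin.
Qed.

Definition rec_events i : set T := \bigcup_t rec_event X i t.+1.

Lemma measurable_rec_events i : measurable (rec_events i).
Proof.
apply: bigcup_measurable => t _; apply: (@measurable_past_sub _ _ _ _ X t.+1).
exact: measurable_rec_event.
Qed.

Lemma trivIset_rec_event i : trivIset setT (fun t => rec_event X i t.+1).
Proof.
apply/trivIsetP => s t _ _ st; apply/seteqP; split=> // w [/= ws wt].
by move/eqP: st; apply; apply: succn_inj; exact: rec_at_uniq ws wt.
Qed.

(** Record [i], counted from 0, at time t + 1, then exactly j non-records, then the next record. *)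
Let E i t j : set T := rec_event X i t.+1 `&` (no_rec_event X t.+1 j `&`
  [set w | (X t.+1 w < X (t.+1 + j).+1 w)%R]).

Let E_rec i t j : E i t j `<=` rec_event X i.+1 (t.+1 + j).+1.
Proof.
move=> w [rt [nt xt]]; exists t.+1; split; [by lia|exact: rt| |exact: xt].
by move=> l H; apply: nt; lia.
Qed.

Let measurable_E i t j : measurable (E i t j).
Proof.
apply: measurableI.
  by apply: (@measurable_past_sub _ _ _ _ X t.+1); exact: measurable_rec_event.
apply: measurableI; last exact: measurable_set_ltr.
apply: (@measurable_past_sub _ _ _ _ X (t.+1 + j)).
exact: measurable_no_rec_event.
Qed.

Let rec_eventsS i : rec_events i.+1 = \bigcup_t \bigcup_j E i t j.
Proof.
apply/seteqP; split=> w.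
  move=> [s _]; rewrite rec_eventS => -[t /= /andP[t1 ts] [rt [nt xt]]].
  exists t.-1 => //; exists (s.+1 - t.+1)%N => //.
  by rewrite /E prednK //; split=> //; split=> //=; rewrite subnKC.
move=> [t _ [j _ /E_rec Ew]]; by exists (t.+1 + j)%N.
Qed.

(* [W] is a function of the observations up to the [i.+1]-st record time. *)
Definition adapted i (W : T -> \bar R) :=
  forall t, measurable_fun (rec_event X i t : set (past X t)) W.

(** Summing over the waiting time j for the next record turns the factors F^j into 1 / (1 - F),
    which normalises the tail integral to [cond_above]. *)
Lemma integral_rec_eventsS i (W : T -> \bar R) (g : R -> \bar R) :
  measurable_fun setT W -> (forall w, 0 <= W w) -> adapted i W ->
  measurable_fun setT g -> (forall x, 0 <= g x) ->
  \int[P]_(w in rec_events i.+1) (W w * g (record_rv X i.+1 w)) =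
  \int[P]_(w in rec_events i) (W w * cond_above mu F g (record_rv X i w)).
Proof.
move=> mW W0 aW mg g0.
have mc := measurable_cond_above F_cdf mg g0.
have c0 x : 0 <= cond_above mu F g x by exact: cond_above_ge0.
have mWg : measurable_fun setT (fun w => W w * g (record_rv X i.+1 w)).
  by apply: emeasurable_funM => //; apply: measurableT_comp => //; exact: measurable_record_rv.
have mWc : measurable_fun setT (fun w => W w * cond_above mu F g (record_rv X i w)).
  by apply: emeasurable_funM => //; apply: measurableT_comp => //; exact: measurable_record_rv.
rewrite rec_eventsS ge0_integral_bigcup; first last.
- apply/trivIsetP => s t _ _ st; apply/seteqP; split=> // w [[j _ [ws _]] [l _ [wt _]]].
  by move/eqP: st; apply; apply: succn_inj; exact: rec_at_uniq ws wt.
- by move=> w _; rewrite mule_ge0.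
- exact: measurable_funTS.
- by move=> t; exact: bigcup_measurable.
rewrite ge0_integral_bigcup; first last.
- exact: trivIset_rec_event.
- by move=> w _; rewrite mule_ge0.
- exact: measurable_funTS.
- move=> t; apply: (@measurable_past_sub _ _ _ _ X t.+1); exact: measurable_rec_event.
apply: eq_eseriesr => t _.
rewrite ge0_integral_bigcup; first last.
- apply/trivIsetP => j l _ _ jl; apply/seteqP; split=> // w [/E_rec ws /E_rec wt].
  by move/eqP: jl; apply; have := rec_at_uniq ws wt; lia.
- by move=> w _; rewrite mule_ge0.
- exact: measurable_funTS.
- by [].
have mR := @measurable_rec_event _ _ _ P X i t.+1.
pose V : past X t.+1 -> \bar R := W \_ (rec_event X i t.+1).
have mV : measurable_fun setT V.
  by apply/(@measurable_restrictT _ _ (past X t.+1) _ _ W mR); exact: aW.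
have V0 w : 0 <= V w by rewrite /V patchE; case: ifP.
have VE w : V w = W w * (\1_(rec_event X i t.+1) w)%:E.
  by rewrite /V patchE indicE; case: ifP; rewrite ?mule1 ?mule0.
transitivity (\sum_(j <oo) \int[P]_w
    (V w * (tail_integral mu g (X t.+1 w) * (F (X t.+1 w) ^+ j)%:E))).
  apply: eq_eseriesr => j _; rewrite -integral_next_record //.
  rewrite integral_mkcond; apply: eq_integral => w _.
  rewrite patchE VE; case: ifPn => [/set_mem Ew|Ew].
    rewrite {1}/record_rv (rec_at_value (E_rec Ew)); case: Ew => [rt [nt xt]].
    by rewrite !indicE !mem_set // !mule1.
  rewrite -!muleA; have [rt|rt] := boolP (w \in rec_event X i t.+1); last first.
    by rewrite indicE (negbTE rt) mul0e mule0.
  have [nt|nt] := boolP (w \in no_rec_event X t.+1 j); last first.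
    by rewrite [\1_(no_rec_event _ _ _) _]indicE (negbTE nt) mul0e !mule0.
  rewrite [\1_[set w | (X t.+1 w < _)%R] _]indicE memNset ?mule0 ?mule0 //= => xt.
  by move/negP: Ew; apply; apply/mem_set; split; [exact: set_mem|split=> //; exact: set_mem].
have mXt : measurable_fun setT (X t.+1 : T -> R) by exact: measurable_funPT.
have mVT : measurable_fun setT (V : T -> \bar R).
  exact: (@measurable_fun_past_sub _ _ _ _ X _ _ t.+1).
have mtail : measurable_fun setT (fun w => tail_integral mu g (X t.+1 w)).
  by apply: measurableT_comp => //; exact: measurable_tail_integral.
have mF : measurable_fun setT (fun w => F (X t.+1 w)).
  by apply: measurableT_comp => //; apply: nondecreasing_measurable => // x y; exact: (cdf_nd F_cdf).
have F0 x : (0 <= F x)%R by exact: (cdf_ge0 F_cdf).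
rewrite -integral_nneseries //; last 2 first.
- move=> j; apply: emeasurable_funM => //; apply: emeasurable_funM => //.
  by apply/measurable_EFinP; exact: measurable_funX.
- move=> j w _; rewrite mule_ge0 // mule_ge0 ?tail_integral_ge0 //.
  by rewrite lee_fin exprn_ge0.
(* The geometric series needs F < 1 at the current record; the event F = 1 is null. *)
transitivity (\int[P]_w (V w * cond_above mu F g (X t.+1 w))).
  have mA : measurable [set x | F x = 1%R].
    rewrite -[X in measurable X]setTI.
    have mF' : measurable_fun setT F.
      by apply: nondecreasing_measurable => // x y; exact: (cdf_nd F_cdf).
    exact: (mF' measurableT _ (measurable_set1 1%R)).
  apply: ge0_ae_eq_integral => //.
  - apply: ge0_emeasurable_sum => [j w _ _|j _].
      by rewrite !mule_ge0 ?tail_integral_ge0 // lee_fin exprn_ge0.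
    apply: emeasurable_funM => //; apply: emeasurable_funM => //.
    by apply/measurable_EFinP; exact: measurable_funX.
  - by apply: emeasurable_funM => //; exact: measurableT_comp.
  - move=> w _; apply: nneseries_ge0 => j _ _.
    by rewrite !mule_ge0 ?tail_integral_ge0 // lee_fin exprn_ge0.
  - by move=> w _; rewrite mule_ge0.
  exists (X t.+1 @^-1` [set x | F x = 1%R]); split.
  - exact: measurable_funPTI.
  - exact: (eq_trans (X_law (ltn0Sn t) mA) mu_F1).
  move=> w /= /not_implyP[_ H]; apply: contrapT => F1; apply: H.
  have F1' : (F (X t.+1 w) < 1)%R.
    by rewrite lt_neqAle (cdf_le1 F_cdf) andbT; exact/eqP.
  rewrite /cond_above.
  under eq_eseriesr do rewrite muleA.
  rewrite nneseries_geometric //; last by rewrite mule_ge0 // tail_integral_ge0.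
  by rewrite -muleA [X in _ * X]muleC.
rewrite [RHS]integral_mkcond; apply: eq_integral => w _.
rewrite VE patchE; case: ifPn => rt; last first.
  by rewrite indicE (negbTE rt) mule0 mul0e.
by rewrite indicE rt mule1 /record_rv (rec_at_value (set_mem rt)).
Qed.

Lemma prob_preimage_F1 t : (1 <= t)%N -> P (X t @^-1` [set x | F x = 1%R]) = 0.
Proof.
move=> t1; apply: (eq_trans (X_law t1 _) mu_F1).
rewrite -[X in measurable X]setTI.
have mF : measurable_fun setT F.
  by apply: nondecreasing_measurable => // x y; exact: (cdf_nd F_cdf).
exact: (mF measurableT _ (measurable_set1 1%R)).
Qed.

Lemma cond_above1 x : F x != 1%R -> cond_above mu F (cst 1) x = 1.
Proof.
move=> F1; rewrite /cond_above.
have -> : tail_integral mu (cst 1) x = (1 - F x)%:E.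
  rewrite /tail_integral integral_cst // mul1e; exact: (mu_itvoy F_cdf).
rewrite expRN lnK ?posrE; last first.
  by rewrite subr_gt0 lt_neqAle F1 (cdf_le1 F_cdf).
by rewrite -EFinM mulVf // subr_eq0 eq_sym.
Qed.

(** This is the one-step identity with W = g = 1: [cond_above] of 1 is 1 off F = 1, so each record
    exists with the same probability as the one before, and the first always exists. *)
Lemma prob_rec_events i : P (rec_events i) = 1.
Proof.
elim: i => [|i IH].
  rewrite (_ : rec_events 0 = setT) ?probability_setT //.
  by apply/seteqP; split=> // w _; exists 0%N.
have a1 : adapted i (cst 1) by move=> t; exact: measurable_cst.
have m1 : measurable_fun setT (cst 1 : R -> \bar R) by exact: measurable_cst.
have c0 x : 0 <= cond_above mu F (cst 1) x.
  by apply: cond_above_ge0.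
have := @integral_rec_eventsS i (cst 1) (cst 1) (measurable_cst _) (fun=> lee01) a1
  m1 (fun=> lee01).
under eq_integral do rewrite /cst mul1e.
rewrite integral_cst //; last exact: measurable_rec_events.
rewrite mul1e => ->.
transitivity (\int[P]_(w in rec_events i) cst 1 w); last first.
  by rewrite integral_cst ?mul1e //; exact: measurable_rec_events.
have mR := measurable_record_rv X i.
apply: ge0_ae_eq_integral => //.
- exact: measurable_rec_events.
- apply: measurable_funTS; apply: emeasurable_funM => //.
  apply: (@measurableT_comp _ _ _ _ _ _ (cond_above mu F (cst 1))) => //.
  exact: measurable_cond_above.
- by move=> w _; rewrite mule_ge0.
have mFX t : measurable (X t.+1 @^-1` [set x | F x = 1%R]).
  apply: measurable_funPTI; rewrite -[X in measurable X]setTI.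
  have mF : measurable_fun setT F.
    by apply: nondecreasing_measurable => // x y; exact: (cdf_nd F_cdf).
  exact: (mF measurableT _ (measurable_set1 1%R)).
exists (\bigcup_t X t.+1 @^-1` [set x | F x = 1%R]); split.
- by apply: bigcup_measurable => t _; exact: mFX.
- apply/negligibleP; last first.
    by apply: negligible_bigcup => t; apply/negligibleP; [exact: mFX|exact: prob_preimage_F1].
  by apply: bigcup_measurable => t _; exact: mFX.
move=> w /= /not_implyP[[t _ rt] H]; exists t => //=; apply: contrapT => /eqP F1.
by apply: H; rewrite mul1e /record_rv (rec_at_value rt) cond_above1.
Qed.

Lemma integral_rec_eventsT i (h : T -> \bar R) : measurable_fun setT h ->
  (forall w, 0 <= h w) -> \int[P]_(w in rec_events i) h w = \int[P]_w h w.
Proof.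
move=> mh h0; have mD := measurable_rec_events i.
rewrite [RHS](@ge0_negligible_integral _ _ _ _ _ (~` rec_events i)) //.
- by rewrite setTD setCK.
- exact: measurableC.
- by rewrite -[LHS]/(P (~` rec_events i)) probability_setC // prob_rec_events subee.
Qed.

Lemma record_markov i (W : T -> \bar R) (g : R -> \bar R) :
  measurable_fun setT W -> (forall w, 0 <= W w) -> adapted i W ->
  measurable_fun setT g -> (forall x, 0 <= g x) ->
  \int[P]_w (W w * g (record_rv X i.+1 w)) =
  \int[P]_w (W w * cond_above mu F g (record_rv X i w)).
Proof.
move=> mW W0 aW mg g0.
have mc := measurable_cond_above F_cdf mg g0.
have c0 x : 0 <= cond_above mu F g x by exact: cond_above_ge0.
rewrite -(@integral_rec_eventsT i.+1); last 2 first.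
- by apply: emeasurable_funM => //; apply: measurableT_comp => //; exact: measurable_record_rv.
- by move=> w; rewrite mule_ge0.
rewrite -[RHS](@integral_rec_eventsT i); last 2 first.
- by apply: emeasurable_funM => //; apply: measurableT_comp => //; exact: measurable_record_rv.
- by move=> w; rewrite mule_ge0.
exact: integral_rec_eventsS.
Qed.

(** What is known at one record time is known at the next: after splitting by the earlier time, the
    past only grows. *)
Lemma adaptedS i W : adapted i W -> adapted i.+1 W.
Proof.
move=> aW s; rewrite rec_eventS.
have mD t : (1 <= t < s)%N -> measurable
    (rec_event X i t `&` (no_rec_event X t (s - t.+1) `&` [set w | (X t w < X s w)%R]) : set (past X s)).
  move=> /andP[t1 ts].
  apply: measurableI; first exact: (measurable_pastS (ltnW ts) (@measurable_rec_event _ _ _ P X i t)).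
  apply: measurableI; last by apply: measurable_past_ltr; lia.
  apply: (@measurable_pastS _ _ _ _ X (t + (s - t.+1))); first by lia.
  exact: measurable_no_rec_event.
rewrite bigcup_mkcond; apply/(@measurable_fun_bigcup _ _ (past X s)) => t.
  by case: ifPn => [/set_mem /mD //|_]; exact: measurable0.
case: ifPn => [/set_mem /= ts|_]; last exact: measurable_fun_set0.
have ts' : (t <= s)%N by lia.
have mR := @measurable_rec_event _ _ _ P X i t.
apply: (@measurable_funS _ _ (past X s) _ (rec_event X i t)).
- exact: (measurable_pastS ts' mR).
- by move=> w [].
- exact: (measurable_fun_pastS ts' mR (aW t)).
Qed.

Lemma adapted_record i a (f : R -> \bar R) : (a <= i)%N ->
  measurable_fun setT f -> adapted i (fun w => f (record_rv X a w)).
Proof.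
move=> ai mf; have {ai} : exists k, i = (k + a)%N by exists (i - a)%N; lia.
case=> k ->; elim: k => [|k IH]; last by rewrite addSn; exact: adaptedS.
rewrite add0n => -[|t].
  rewrite (_ : rec_event X a 0 = set0); first exact: measurable_fun_set0.
  by apply/seteqP; split=> // w /rec_at_gt0.
apply: (@eq_measurable_fun _ _ (past X t.+1) _ _ (fun w => f (X t.+1 w))).
  by move=> w /set_mem rt; rewrite /record_rv (rec_at_value rt).
apply: measurable_funTS; apply: (@measurableT_comp _ _ _ (past X t.+1) _ _ f) => //.
by apply: measurable_fun_past; rewrite leqnn.
Qed.

Lemma adaptedM i W V : adapted i W -> adapted i V -> adapted i (fun w => W w * V w).
Proof. by move=> aW aV t; apply: emeasurable_funM. Qed.

Lemma iter_cond_above j (g : R -> \bar R) : measurable_fun setT g ->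
  (forall x, 0 <= g x) ->
  measurable_fun setT (iter j (cond_above mu F) g) /\
  (forall x, 0 <= iter j (cond_above mu F) g x).
Proof.
move=> mg g0; elim: j => [//|j [mj j0]] /=; split.
  exact: measurable_cond_above.
by move=> x; exact: cond_above_ge0.
Qed.

Lemma record_markov_iter i j (W : T -> \bar R) (g : R -> \bar R) :
  measurable_fun setT W -> (forall w, 0 <= W w) -> adapted i W ->
  measurable_fun setT g -> (forall x, 0 <= g x) ->
  \int[P]_w (W w * g (record_rv X (j + i) w)) =
  \int[P]_w (W w * iter j (cond_above mu F) g (record_rv X i w)).
Proof.
move=> mW W0 aW; elim: j g => [//|j IH] g mg g0.
have aWj : adapted (j + i) W.
  by elim: (j) => [//|k IHk]; rewrite addSn; exact: adaptedS.
rewrite addSn (record_markov mW W0 aWj mg g0) IH.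
- by apply: eq_integral => w _; rewrite iterSr.
- exact: measurable_cond_above.
- by move=> x; exact: cond_above_ge0.
Qed.

Lemma record_rv0 (f : R -> \bar R) : measurable_fun setT f ->
  (forall x, 0 <= f x) -> \int[P]_w f (record_rv X 0 w) = \int[mu]_x f x.
Proof.
move=> mf f0.
rewrite -[LHS]/(\int[P]_w (f \o X 1%N) w).
rewrite -[LHS](@ge0_integral_pushforward _ _ _ _ _ _ _ _ setT) //.
by apply: eq_measure_integral => A mA _; exact: X_law.
Qed.

(** The records are integrated out from the last to the first. Three factors suffice: the two
    conditioning records and one between them. *)
Lemma record_joint a p q (f1 f2 f3 : R -> \bar R) :
  measurable_fun setT f1 -> (forall x, 0 <= f1 x) ->
  measurable_fun setT f2 -> (forall x, 0 <= f2 x) ->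
  measurable_fun setT f3 -> (forall x, 0 <= f3 x) ->
  let K j := iter j (cond_above mu F) in
  \int[P]_w (f1 (record_rv X a w) * f2 (record_rv X (p + a) w) *
    f3 (record_rv X (q + (p + a)) w)) =
  \int[mu]_x K a (fun x => f1 x * K p (fun x => f2 x * K q f3 x) x) x.
Proof.
move=> m1 p1 m2 p2 m3 p3 K.
have mR j := measurable_record_rv X j.
have mfR f j : measurable_fun setT f ->
    measurable_fun setT (fun w => f (record_rv X j w) : \bar R).
  by move=> mf; apply: (@measurableT_comp _ _ _ _ _ _ f).
have [mq q0] := iter_cond_above q m3 p3.
have m2q : measurable_fun setT (fun x => f2 x * K q f3 x) by exact: emeasurable_funM.
have p2q x : 0 <= f2 x * K q f3 x by exact: mule_ge0 (p2 x) (q0 x).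
have [mp p0] := iter_cond_above p m2q p2q.
have m1p : measurable_fun setT (fun x => f1 x * K p (fun x => f2 x * K q f3 x) x).
  exact: emeasurable_funM.
have p1p x : 0 <= f1 x * K p (fun x => f2 x * K q f3 x) x.
  exact: mule_ge0 (p1 x) (p0 x).
have [ma a0] := iter_cond_above a m1p p1p.
have mW : measurable_fun setT (fun w => f1 (record_rv X a w) * f2 (record_rv X (p + a) w)).
  by apply: emeasurable_funM; exact: mfR.
have W0 w : 0 <= f1 (record_rv X a w) * f2 (record_rv X (p + a) w).
  exact: mule_ge0.
have aW : adapted (p + a) (fun w => f1 (record_rv X a w) * f2 (record_rv X (p + a) w)).
  by apply: adaptedM; apply: adapted_record => //; lia.
rewrite (record_markov_iter q mW W0 aW m3 p3).
under eq_integral do rewrite -muleA.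
have aW1 : adapted a (fun w => f1 (record_rv X a w)) by exact: adapted_record.
rewrite (record_markov_iter p (mfR _ a m1) (fun w => p1 _) aW1 m2q p2q).
have a1 : adapted 0 (cst 1) by move=> t; exact: measurable_cst.
have := record_markov_iter a (measurable_cst 1) (fun=> lee01) a1 m1p p1p.
under eq_integral do rewrite /cst mul1e addn0.
move=> ->.
under eq_integral do rewrite /cst mul1e.
by rewrite record_rv0.
Qed.

Lemma record_rv_lt a b : (a < b)%N ->
  {ae P, forall w, (record_rv X a w < record_rv X b w)%R}.
Proof.
move=> ab; have mD := measurable_rec_events a.+1.
exists (~` rec_events a.+1); split.
- exact: measurableC.
- by rewrite probability_setC // prob_rec_events subee.
move=> w /= H [s _ [t [ts rt tj xt]]]; apply: H.
apply: (lt_le_trans _ (record_value_nd (fun j => X j w) ab)).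
rewrite /record_rv (rec_at_value rt) (@rec_at_value _ _ a.+1 s.+1) //.
by exists t.
Qed.

End RecordMarkov.

(** * Algebra of the tail operator J *)

Section TailOperator.
Context {R : realType}.
Local Open Scope ereal_scope.
Local Notation J := (@leb_tail R).

Lemma eq_leb_tail (f g : R -> \bar R) s : (forall y, (s < y)%R -> f y = g y) ->
  J f s = J g s.
Proof.
by move=> fg; apply: eq_integral => y; rewrite inE /= in_itv /= andbT; exact: fg.
Qed.

(** J^j f at s sees only f on [s, oo[, so identities valid on the half-line may be substituted under
    J^j. *)
Lemma eq_iter_leb_tail j (f g : R -> \bar R) s :
  (forall y, (s <= y)%R -> f y = g y) -> iter j J f s = iter j J g s.
Proof.
elim: j s => [|j IH] s fg /=; first exact: fg.
by apply: eq_leb_tail => y sy; apply: IH => z yz; rewrite fg // (le_trans _ yz) // ltW.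
Qed.

Lemma iter_leb_tail j (g : R -> \bar R) : measurable_fun setT g ->
  (forall x, 0 <= g x) ->
  measurable_fun setT (iter j J g) /\ (forall x, 0 <= iter j J g x).
Proof.
move=> mg g0; elim: j => [//|j [mj j0]] /=; split.
  exact: measurable_leb_tail.
by move=> x; exact: leb_tail_ge0.
Qed.

Lemma leb_tailZ (f : R -> \bar R) (a : R) s : measurable_fun setT f ->
  (forall y, 0 <= f y) -> (0 <= a)%R ->
  J (fun y => a%:E * f y) s = a%:E * J f s.
Proof.
move=> mf f0 a0; rewrite /leb_tail ge0_integralZl //.
by apply: (@measurable_funTS _ _ (measurableTypeR R)).
Qed.

Lemma leb_tailD (f g : R -> \bar R) s : measurable_fun setT f ->
  (forall y, 0 <= f y) -> measurable_fun setT g -> (forall y, 0 <= g y) ->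
  J (fun y => f y + g y) s = J f s + J g s.
Proof.
move=> mf f0 mg g0; rewrite /leb_tail ge0_integralD //.
  by apply: (@measurable_funTS _ _ (measurableTypeR R)).
by apply: (@measurable_funTS _ _ (measurableTypeR R)).
Qed.

Lemma iter_leb_tailZ j (f : R -> \bar R) (a : R) s : measurable_fun setT f ->
  (forall y, 0 <= f y) -> (0 <= a)%R ->
  iter j J (fun y => a%:E * f y) s = a%:E * iter j J f s.
Proof.
move=> mf f0 a0; elim: j s => [//|j IH] s /=.
have [mj j0] := iter_leb_tail j mf f0.
by rewrite -leb_tailZ //; congr (J _ s); apply/funext => y; rewrite IH.
Qed.

Lemma iter_leb_tailD j (f g : R -> \bar R) s : measurable_fun setT f ->
  (forall y, 0 <= f y) -> measurable_fun setT g -> (forall y, 0 <= g y) ->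
  iter j J (fun y => f y + g y) s = iter j J f s + iter j J g s.
Proof.
move=> mf f0 mg g0; elim: j s => [//|j IH] s /=.
have [mj j0] := iter_leb_tail j mf f0.
have [mk k0] := iter_leb_tail j mg g0.
by rewrite -leb_tailD //; congr (J _ s); apply/funext => y; rewrite IH.
Qed.

(** Iterating J y = y J + J^2 gives J^j y = y J^j + j J^(j+1). The absolute value keeps the
    integrand nonnegative on the whole line and is invisible to the right of s >= 0. *)
Lemma iter_leb_tail_mulr j (f : R -> \bar R) (s : R) :
  measurable_fun setT f -> (forall y, 0 <= f y) -> (0 <= s)%R ->
  iter j J (fun y => `|y|%:E * f y) s =
  s%:E * iter j J f s + j%:R%:E * iter j.+1 J f s.
Proof.
move=> mf f0; elim: j s => [|j IH] s s0 /=.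
  by rewrite mul0e adde0 ger0_norm.
have [mj j0] := iter_leb_tail j mf f0.
have [mj1 j10] := iter_leb_tail j.+1 mf f0.
rewrite (@eq_leb_tail _ (fun y => `|y|%:E * iter j J f y + j%:R%:E * iter j.+1 J f y)); last first.
  by move=> y sy; rewrite IH ?ger0_norm // (le_trans s0) // ltW.
rewrite leb_tailD; last 4 first.
- by apply: emeasurable_funM => //; apply/measurable_EFinP; exact: normr_measurable.
- by move=> y; rewrite mule_ge0 // lee_fin.
- exact: measurable_funeM.
- by move=> y; rewrite mule_ge0 // lee_fin.
rewrite leb_tailZ // (@eq_leb_tail _ (fun y => y%:E * iter j J f y)); last first.
  by move=> y sy; rewrite ger0_norm // (le_trans s0) // ltW.
rewrite leb_tail_mulr // -addeA; congr (_ + _).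
have -> : (j.+1%:R)%:E = 1 + j%:R%:E :> \bar R by rewrite -EFinD -natr1 addrC.
by rewrite ge0_muleDl ?lee_fin // mul1e.
Qed.

Lemma leb_tail_eq0P (f : R -> \bar R) (s : R) : measurable_fun setT f ->
  (forall y, 0 <= f y) ->
  J f s = 0 <-> ae_eq (@lebesgue_measure R) `]s, +oo[%classic f (cst 0).
Proof.
move=> mf f0.
have mD : measurable (`]s, +oo[%classic : set (measurableTypeR R)) by exact: measurable_itv.
have mf' : measurable_fun (`]s, +oo[%classic : set (measurableTypeR R)) f.
  by apply: (@measurable_funTS _ _ (measurableTypeR R)).
have H := ae_eq_integral_abs (@lebesgue_measure R) mD mf'.
rewrite (_ : J f s = \int[lebesgue_measure]_(x in `]s, +oo[) `|f x|) //.
by apply: eq_integral => y _; rewrite gee0_abs.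
Qed.

(** J (J f) s integrates f against y - s, which is positive on the open ray, so its vanishing forces
    f = 0 almost everywhere there. *)
Lemma leb_tail_tail_eq0 (f : R -> \bar R) (s : R) : measurable_fun setT f ->
  (forall y, 0 <= f y) -> J (J f) s = 0 -> J f s = 0.
Proof.
move=> mf f0; rewrite leb_tail_tail // => H.
pose h y := `|y - s|%:E * f y.
have mh : measurable_fun setT h.
  apply: emeasurable_funM => //; apply/measurable_EFinP.
  apply: (@measurableT_comp _ _ _ _ _ _ (@Num.norm R R)) => //.
  exact: measurable_funB.
have h0 y : 0 <= h y by rewrite mule_ge0.
have /leb_tail_eq0P - /(_ mh h0) : J h s = 0.
  rewrite -H; apply: eq_integral => y; rewrite inE /= in_itv /= andbT => sy.
  by rewrite /h ger0_norm // subr_ge0 ltW.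
move=> hN; apply/leb_tail_eq0P => //.
apply: filterS hN => y H1 sy; have /= := H1 sy.
move/eqP; rewrite mule_eq0 eqe normr_eq0 subr_eq0 => /orP[|/eqP //].
by move: sy; rewrite /= in_itv /= andbT => /gt_eqF ->.
Qed.

Lemma iter_leb_tail_eq0 j (f : R -> \bar R) s : measurable_fun setT f ->
  (forall y, 0 <= f y) -> iter j.+1 J f s = 0 -> J f s = 0.
Proof.
move=> mf f0; elim: j => [//|j IH] H; apply: IH.
have [mj j0] := iter_leb_tail j mf f0.
exact: leb_tail_tail_eq0.
Qed.

Lemma iter_leb_tail_expRN j s :
  iter j J (fun y => (expR (- y))%:E) s = (expR (- s))%:E.
Proof.
elim: j s => [//|j IH] s /=; rewrite (@eq_leb_tail _ (fun y => (expR (- y))%:E)) //.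
exact: integral_expRN.
Qed.

End TailOperator.

(** * Joint laws of records in the exponential coordinate *)

Section Transport.
Context {R : realType}.
Variables (mu : probability R R) (F : R -> R).
Hypothesis F_cdf : forall x, mu `]-oo, x]%classic = (F x)%:E.
Hypothesis mu_atomless : forall x, mu [set x] = 0%E.
Variable l : R.
Hypothesis F_l : F l = 0.
Local Open Scope ereal_scope.
Local Notation J := (@leb_tail R).
Local Notation K := (cond_above mu F).
Local Notation G := (exp_quantile F).

(** The conjugations telescope: between successive steps exp (y) and exp (-y) cancel. *)
Lemma iter_cond_above_exp_quantile j (g : R -> \bar R) (s : R) :
  measurable_fun setT g -> (forall x, 0 <= g x) -> (0 <= s)%R ->
  iter j K g (G s) = (expR s)%:E * iter j J (fun y => g (G y) * (expR (- y))%:E) s.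
Proof.
move=> mg g0; elim: j s => [|j IH] s s0 /=.
  by rewrite muleCA -EFinM -expRD subrr expR0 mule1.
have [mj j0] := iter_cond_above F_cdf j mg g0.
rewrite (cond_above_exp_quantile F_cdf mu_atomless F_l) //; congr (_ * _).
apply: eq_leb_tail => y sy; rewrite IH; last by rewrite (le_trans s0) // ltW.
by rewrite muleAC -EFinM -expRD subrr expR0 mul1e.
Qed.

(** The exponent is [a.+1] because the integral against [mu] contributes one more J, evaluated at
    0. *)
Lemma integral_iter_exp_quantile a p q (f1 f2 f3 : R -> \bar R) :
  measurable_fun setT f1 -> (forall x, 0 <= f1 x) ->
  measurable_fun setT f2 -> (forall x, 0 <= f2 x) ->
  measurable_fun setT f3 -> (forall x, 0 <= f3 x) ->
  \int[mu]_x iter a K (fun x => f1 x * iter p K (fun x => f2 x * iter q K f3 x) x) x =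
  iter a.+1 J (fun s => f1 (G s) * iter p J (fun s => f2 (G s) *
    iter q J (fun y => f3 (G y) * (expR (- y))%:E) s) s) 0%R.
Proof.
move=> m1 p1 m2 p2 m3 p3.
have [mq q0] := iter_cond_above F_cdf q m3 p3.
pose h2 x := f2 x * iter q K f3 x.
have m2q : measurable_fun setT h2 by exact: emeasurable_funM.
have p2q x : 0 <= h2 x by exact: mule_ge0 (p2 x) (q0 x).
have [mp p0] := iter_cond_above F_cdf p m2q p2q.
pose h1 x := f1 x * iter p K h2 x.
have m1p : measurable_fun setT h1 by exact: emeasurable_funM.
have p1p x : 0 <= h1 x by exact: mule_ge0 (p1 x) (p0 x).
have [ma a0] := iter_cond_above F_cdf a m1p p1p.
have step j f g s : measurable_fun setT g -> (forall x, 0 <= g x) -> (0 <= s)%R ->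
    f (G s) * iter j K g (G s) * (expR (- s))%:E =
    f (G s) * iter j J (fun y => g (G y) * (expR (- y))%:E) s :> \bar R.
  move=> mg g0 s0; rewrite iter_cond_above_exp_quantile //.
  rewrite -muleA; congr (_ * _).
  by rewrite muleAC -EFinM -expRD subrr expR0 mul1e.
rewrite (integral_exp_quantile F_cdf mu_atomless F_l ma a0) /=.
apply: eq_leb_tail => s s0.
rewrite (iter_cond_above_exp_quantile a m1p p1p (ltW s0)).
rewrite muleAC -EFinM -expRD subrr expR0 mul1e.
apply: eq_iter_leb_tail => y sy; have y0 : (0 <= y)%R := le_trans (ltW s0) sy.
rewrite /h1 step //; congr (_ * _).
apply: eq_iter_leb_tail => z yz; have z0 : (0 <= z)%R := le_trans y0 yz.
by rewrite /h2 step.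
Qed.

End Transport.

(** * Records of an exponential law *)

Section Linear.
Local Open Scope ereal_scope.

Lemma integrable_lin2 d (T : measurableType d) (R : realType)
    (P : {measure set T -> \bar R}) (E : set T) (f g : T -> R) (x y : R) :
  measurable E -> P.-integrable E (EFin \o f) -> P.-integrable E (EFin \o g) ->
  P.-integrable E (fun w => (x * f w + y * g w)%:E).
Proof.
move=> mE fi gi.
have xfi := integrableZl mE x fi; have ygi := integrableZl mE y gi.
exact: (integrableD mE xfi ygi).
Qed.

Lemma integral_lin2 d (T : measurableType d) (R : realType)
    (P : {measure set T -> \bar R}) (E : set T) (f g : T -> R) (x y : R) :
  measurable E -> P.-integrable E (EFin \o f) -> P.-integrable E (EFin \o g) ->
  \int[P]_(w in E) (x * f w + y * g w)%:E =
  (x * fine (\int[P]_(w in E) (f w)%:E) + y * fine (\int[P]_(w in E) (g w)%:E))%:E.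
Proof.
move=> mE fi gi.
have xfi := integrableZl mE x fi; have ygi := integrableZl mE y gi.
rewrite -[LHS]/(\int[P]_(w in E) ((x%:E * (EFin \o f) w) + (y%:E * (EFin \o g) w))).
rewrite integralD // !integralZl // EFinD !EFinM !fineK //; exact: integrable_fin_num.
Qed.

(** The images under [Z] of the measures with densities [h1] and [h2] are finite and agree on
    rectangles, which are stable under intersection and generate. *)
Lemma eq_integral_rectangles d (T : measurableType d) (R : realType)
    (P : {measure set T -> \bar R}) (Z : T -> R * R) (h1 h2 : T -> R) :
  measurable_fun setT Z ->
  measurable_fun setT h1 -> (forall w, 0 <= h1 w)%R ->
  measurable_fun setT h2 -> (forall w, 0 <= h2 w)%R ->
  \int[P]_w (h1 w)%:E < +oo ->
  (forall A B, measurable A -> measurable B ->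
    \int[P]_(w in Z @^-1` (A `*` B)) (h1 w)%:E =
    \int[P]_(w in Z @^-1` (A `*` B)) (h2 w)%:E) ->
  forall C, measurable C ->
    \int[P]_(w in Z @^-1` C) (h1 w)%:E = \int[P]_(w in Z @^-1` C) (h2 w)%:E.
Proof.
move=> mZ m1 p1 m2 p2 fin eqr C mC.
have [n1 [n1E _]] := density_measure P m1 p1.
have [n2 [n2E _]] := density_measure P m2 p2.
have mZC D : measurable D -> measurable (Z @^-1` D).
  by move=> mD; rewrite -[X in measurable X]setTI; exact: mZ.
pose ZM := isMeasurableFun.Build _ _ _ _ _ mZ.
pose Zm : {mfun T >-> (R * R)%type} := HB.pack Z ZM.
rewrite -(n1E _ (mZC _ mC)) -(n2E _ (mZC _ mC)).
apply: (@measure_unique _ R (R * R)%type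
  [set A `*` B | A in measurable & B in measurable] (fun=> setT)
  _ _ _ _ (pushforward n1 Zm) (pushforward n2 Zm)) => //.
- exact: measurable_prod_measurableType.
- move=> _ _ [A1 mA1 [B1 mB1 <-]] [A2 mA2 [B2 mB2 <-]].
  rewrite -setXI; exists (A1 `&` A2); first exact: measurableI.
  by exists (B1 `&` B2) => //; exact: measurableI.
- by move=> _; exists setT => //; exists setT => //; rewrite setXTT.
- by rewrite bigcup_const.
- move=> _ [A mA [B mB <-]].
  have mAB : measurable (A `*` B) := measurableX mA mB.
  apply: (eq_trans (n1E _ (mZC _ mAB))); apply/esym.
  by apply: (eq_trans (n2E _ (mZC _ mAB))); apply/esym; exact: eqr.
- by move=> _; apply: (le_lt_trans _ fin); rewrite -(n1E _ measurableT); exact: lexx.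
Qed.

End Linear.

Section ExponentialRecords.
Context {disp : measure_display} {T : measurableType disp} {R : realType}.
Variables (P : probability T R) (X : nat -> {RV P >-> R}).
Hypothesis X_indep : mutually_independent P [set i | (1 <= i)%N] X.
Variables (mu : probability R R) (F : R -> R).
Hypothesis X_law : forall i, (1 <= i)%N ->
  forall B, measurable B -> P (X i @^-1` B) = mu B.
Hypothesis F_cdf : forall x, mu `]-oo, x]%classic = (F x)%:E.
Hypothesis mu_atomless : forall x, mu [set x] = 0%E.
Variable l : R.
Hypothesis F_l : F l = 0.
Local Open Scope ereal_scope.
Local Notation J := (@leb_tail R).
Local Notation G := (exp_quantile F).
Local Notation Rec := (record_rv X).

Let mu_F1 : mu [set x | F x = 1%R] = 0.
Proof. exact: (cdf_eq1_null F_cdf mu_atomless F_l). Qed.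

Lemma record_joint_exp a p q (f1 f2 f3 : R -> \bar R) :
  measurable_fun setT f1 -> (forall x, 0 <= f1 x) ->
  measurable_fun setT f2 -> (forall x, 0 <= f2 x) ->
  measurable_fun setT f3 -> (forall x, 0 <= f3 x) ->
  \int[P]_w (f1 (Rec a w) * f2 (Rec (p + a) w) * f3 (Rec (q + (p + a)) w)) =
  iter a.+1 J (fun s => f1 (G s) * iter p J (fun s => f2 (G s) *
    iter q J (fun y => f3 (G y) * (expR (- y))%:E) s) s) 0%R.
Proof.
move=> m1 p1 m2 p2 m3 p3.
rewrite (record_joint X_indep X_law F_cdf mu_F1) //.
exact: (integral_iter_exp_quantile F_cdf mu_atomless F_l).
Qed.

(** Every record is at least the first observation, which exceeds l almost surely since F l = 0. *)
Lemma record_gt_left j : {ae P, forall w, (l < Rec j w)%R}.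
Proof.
exists (X 1%N @^-1` `]-oo, l]%classic); split.
- exact: measurable_funPTI.
- by apply: (eq_trans (X_law (leqnn _) (measurable_itv _))); rewrite -[RHS]/(0%R%:E) -F_l; exact: F_cdf.
move=> w /= H; rewrite in_itv /= leNgt; apply/negP => lX; apply: H.
apply: (lt_le_trans lX).
exact: (record_value_nd (fun j => X j w) (leq0n j)).
Qed.

(** Records exceed l almost surely, so [phi (Rec j w)] is [Rec j w - l] up to a null set; being
    nonnegative, it can be integrated before integrability is known. *)
Let phi x : R := `|x - l|%R.

Let phi0 x : (0 <= phi x)%R.
Proof. exact: normr_ge0. Qed.

Let mphi : measurable_fun setT phi.
Proof.
apply: (@measurableT_comp _ _ _ _ _ _ (@Num.norm R R)) => //.
exact: measurable_funB.
Qed.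

Lemma integrable_record_dist j E : measurable E ->
  P.-integrable E (EFin \o (fun w => phi (Rec j w))) ->
  P.-integrable E (EFin \o Rec j).
Proof.
move=> mE iphi; have mR := measurable_record_rv X j.
have i1 : P.-integrable E (EFin \o cst `|l|%R) by exact: finite_measure_integrable_cst.
apply: (le_integrable mE _ _ (integrableD mE i1 iphi)).
  exact/measurable_EFinP/measurable_funTS.
move=> w _ /=; rewrite lee_fin [X in (_ <= X)%R]ger0_norm ?addr_ge0 ?phi0 ?normr_ge0 //.
by rewrite -[X in (`|X| <= _)%R](subrK l) addrC ler_normD.
Qed.

Lemma integral_record_dist j E : measurable E ->
  P.-integrable E (EFin \o (fun w => phi (Rec j w))) ->
  fine (\int[P]_(w in E) (Rec j w)%:E) =
  (l * fine (P E) + fine (\int[P]_(w in E) (phi (Rec j w))%:E))%R.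
Proof.
move=> mE iphi.
have i1 : P.-integrable E (EFin \o cst 1%R).
  by apply: finite_measure_integrable_cst.
have := integral_lin2 l 1%R mE i1 iphi.
have -> : \int[P]_(w in E) (cst 1%R w)%:E = P E.
  by rewrite (eq_integral (cst 1%:E)) // integral_cst // mul1e.
rewrite mul1r => H; rewrite -[RHS]/(fine (_ + _)%:E) -H; congr fine.
have mR := measurable_record_rv X j.
apply: ae_eq_integral => //.
- exact/measurable_EFinP/measurable_funTS.
- apply/measurable_EFinP/measurable_funTS; apply: measurable_funD.
    exact: measurable_funM.
  by apply: measurable_funM => //; apply: measurableT_comp.
have [N [mN N0 sub]] := record_gt_left j.
exists N; split=> // w /= nw; apply: sub => /= lw; apply: nw => _.
by rewrite /cst mulr1 mul1r /phi ger0_norm ?subr_ge0 1?ltW // addrC subrK.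
Qed.

Variable c : R.
Hypothesis c0 : (0 < c)%R.
Hypothesis G_lin : forall s, (0 <= s)%R -> G s = (l + s / c)%R.

Let phiG s : (0 <= s)%R -> (phi (G s))%:E = (c^-1)%:E * `|s|%:E.
Proof.
move=> s0; rewrite /phi G_lin // addrC addKr normrM muleC -EFinM.
by rewrite [`|c^-1|%R]ger0_norm // invr_ge0 ltW.
Qed.

Let c1 : (0 <= c^-1)%R.
Proof. by rewrite invr_ge0 ltW. Qed.

Let mexpRN : measurable_fun setT (fun y : R => (expR (- y))%:E : \bar R).
Proof. by apply/measurable_EFinP; exact: measurableT_comp. Qed.

(** The mean of a Gamma variable: exp (-y) is fixed by J, so J^(j+1) applied to y exp (-y) takes the
    value j + 1 at 0. *)
Lemma record_moment j : \int[P]_w (phi (Rec j w))%:E = (j.+1%:R / c)%:E.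
Proof.
have m1 : measurable_fun setT (cst 1 : R -> \bar R) by exact: measurable_cst.
have e1 : forall x : R, 0 <= cst 1 x :> \bar R by move=> x; exact: lee01.
have mp : measurable_fun setT (EFin \o phi) by exact/measurable_EFinP.
have p0 : forall x, 0 <= (EFin \o phi) x by move=> x; rewrite lee_fin phi0.
have := @record_joint_exp j 0 0 (EFin \o phi) (cst 1) (cst 1) mp p0 m1 e1 m1 e1.
under eq_integral do rewrite /cst !mule1.
move=> ->.
transitivity ((c^-1)%:E * iter j.+1 J (fun s => `|s|%:E * (expR (- s))%:E) 0%R).
  have mn : measurable_fun setT (fun s : R => `|s|%:E * (expR (- s))%:E).
    by apply: emeasurable_funM => //; apply/measurable_EFinP; exact: normr_measurable.
  have n0 (y : R) : 0 <= `|y|%:E * (expR (- y))%:E.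
    by rewrite mule_ge0 // lee_fin ?normr_ge0 ?expR_ge0.
  rewrite -(iter_leb_tailZ j.+1 0%R mn n0 c1).
  by apply: eq_iter_leb_tail => y y0; rewrite /cst /= !mul1e phiG // muleA.
have e0 (y : R) : 0 <= (expR (- y))%:E by rewrite lee_fin expR_ge0.
rewrite (iter_leb_tail_mulr j.+1 mexpRN e0 (lexx 0%R)).
by rewrite !iter_leb_tail_expRN oppr0 expR0 mule1 add0e mule1 -EFinM mulrC.
Qed.

Let iphi j (E : set T) : measurable E ->
  P.-integrable E (EFin \o (fun w => phi (Rec j w))).
Proof.
move=> mE; apply: (integrableS measurableT) => //.
apply/integrableP; split.
  apply/measurable_EFinP; apply: measurableT_comp => //.
  exact: measurable_record_rv.
under eq_integral do rewrite gee0_abs ?lee_fin ?phi0 //.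
by rewrite record_moment ltry.
Qed.

(** In J^p (y J^(d-p) w) = y J^d w + p J^(d+1) w the index p occurs only as a coefficient; this is
    the linear interpolation of the records. [U] and [V] below come from the two terms. *)
Lemma record_rectangles a d (A B : set R) : (0 < d)%N ->
  measurable A -> measurable B ->
  exists u v : R, forall p, (p <= d)%N ->
    \int[P]_(w in (fun w => (Rec a w, Rec (d + a) w)) @^-1` (A `*` B))
      (phi (Rec (p + a) w))%:E = (u + p%:R * v)%:E.
Proof.
move=> d0 mA mB.
pose f1 x : \bar R := (\1_A x)%:E; pose f3 x : \bar R := (\1_B x)%:E.
have m1 : measurable_fun setT f1 by apply/measurable_EFinP; exact: measurable_indic.
have m3 : measurable_fun setT f3 by apply/measurable_EFinP; exact: measurable_indic.
have p1 x : 0 <= f1 x by rewrite lee_fin.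
have p3 x : 0 <= f3 x by rewrite lee_fin.
have m2 : measurable_fun setT (EFin \o phi) by exact/measurable_EFinP.
have p2 x : 0 <= (EFin \o phi) x by rewrite lee_fin phi0.
have mG := measurable_exp_quantile F_cdf mu_atomless F_l.
have mG1 : measurable_fun setT (fun s => f1 (G s)).
  by apply: (@measurableT_comp _ _ _ _ _ _ f1).
pose w3 (y : R) : \bar R := f3 (G y) * (expR (- y))%:E.
have mw : measurable_fun setT w3.
  by apply: emeasurable_funM => //; apply: (@measurableT_comp _ _ _ _ _ _ f3).
have w0 y : 0 <= w3 y by rewrite mule_ge0 // lee_fin expR_ge0.
have [mH H0] := iter_leb_tail d mw w0.
have [mH1 H10] := iter_leb_tail d.+1 mw w0.
pose hU s := f1 (G s) * (`|s|%:E * iter d J w3 s).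
pose hV s := f1 (G s) * iter d.+1 J w3 s.
have mn : measurable_fun setT (fun s : R => `|s|%:E : \bar R).
  by apply/measurable_EFinP; exact: normr_measurable.
have mU : measurable_fun setT hU by apply: emeasurable_funM => //; exact: emeasurable_funM.
have mV : measurable_fun setT hV by exact: emeasurable_funM.
have U0 s : 0 <= hU s by rewrite !mule_ge0.
have V0 s : 0 <= hV s by exact: mule_ge0 (p1 _) (H10 s).
pose U := iter a.+1 J hU 0%R; pose V := iter a.+1 J hV 0%R.
have UE : 0 <= U by have [_] := iter_leb_tail a.+1 mU U0; exact.
have VE : 0 <= V by have [_] := iter_leb_tail a.+1 mV V0; exact.
have main p : (p <= d)%N ->
    \int[P]_(w in (fun w => (Rec a w, Rec (d + a) w)) @^-1` (A `*` B))
      (phi (Rec (p + a) w))%:E = (c^-1)%:E * (U + p%:R%:E * V).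
  move=> pd.
  have da : ((d - p) + (p + a) = d + a)%N by lia.
  have := record_joint_exp a p (d - p) m1 p1 m2 p2 m3 p3.
  rewrite da => H.
  transitivity (\int[P]_w (f1 (Rec a w) * (EFin \o phi) (Rec (p + a) w) * f3 (Rec (d + a) w))).
    rewrite integral_mkcond; apply: eq_integral => w _.
    rewrite patchE /f1 /f3 !indicE; case: ifPn => [/set_mem [/= Aw Bw]|AB].
      by rewrite !mem_set // mul1e mule1.
    have [Aw|Aw] := boolP (Rec a w \in A); last by rewrite !mul0e.
    have [Bw|Bw] := boolP (Rec (d + a) w \in B); last by rewrite mule0.
    by move/negP: AB; case; apply/mem_set; split; exact: set_mem.
  rewrite H.
  have mpV : measurable_fun setT (fun s => p%:R%:E * hV s) by exact: measurable_funeM.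
  have pV0 s : 0 <= p%:R%:E * hV s by rewrite mule_ge0 // lee_fin.
  have mUV : measurable_fun setT (fun s => hU s + p%:R%:E * hV s) by exact: emeasurable_funD.
  have UV0 s : 0 <= hU s + p%:R%:E * hV s by rewrite adde_ge0.
  rewrite /V -(iter_leb_tailZ a.+1 0%R mV V0 (ler0n _ p)).
  rewrite -(iter_leb_tailD a.+1 0%R mU U0 mpV pV0).
  rewrite -(iter_leb_tailZ a.+1 0%R mUV UV0 c1).
  apply: eq_iter_leb_tail => s s0.
  have [mq q0] := iter_leb_tail (d - p) mw w0.
  have mnq : measurable_fun setT (fun y : R => `|y|%:E * iter (d - p) J w3 y).
    exact: emeasurable_funM.
  have nq0 (y : R) : 0 <= `|y|%:E * iter (d - p) J w3 y by rewrite mule_ge0.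
  transitivity (f1 (G s) * ((c^-1)%:E *
      iter p J (fun y => `|y|%:E * iter (d - p) J w3 y) s)).
    congr (_ * _); rewrite -(iter_leb_tailZ p s mnq nq0 c1).
    apply: eq_iter_leb_tail => y sy.
    by rewrite /= phiG ?(le_trans s0) // muleA.
  rewrite (iter_leb_tail_mulr p mq q0 s0) -iterD -iterD addSn subnKC //.
  rewrite muleCA; congr (_ * _).
  have A1 : 0 <= s%:E * iter d J w3 s by exact: mule_ge0.
  have A2 : 0 <= p%:R%:E * iter d.+1 J w3 s by apply: mule_ge0 => //; rewrite lee_fin.
  rewrite (ge0_muleDr _ A1 A2).
  by rewrite /hU /hV ger0_norm // [p%:R%:E * (_ * _)]muleCA.
have fin p : (p <= d)%N -> \int[P]_(w in (fun w => (Rec a w, Rec (d + a) w)) @^-1` (A `*` B))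
      (phi (Rec (p + a) w))%:E < +oo.
  move=> pd; apply: (@le_lt_trans _ _ (\int[P]_w (phi (Rec (p + a) w))%:E)).
    apply: ge0_subset_integral => //.
    - rewrite -[X in measurable X]setTI.
      apply: (measurable_fun_pair (measurable_record_rv X a) (measurable_record_rv X (d + a))) => //.
      exact: measurableX.
    - apply/measurable_EFinP; apply: measurableT_comp => //; exact: measurable_record_rv.
    - by move=> w _; rewrite lee_fin phi0.
  by rewrite record_moment ltry.
have c1' : (0 < c^-1)%R by rewrite invr_gt0.
(* Finiteness of the integral at p = 0 controls U alone, and at p = d > 0 it controls V. *)
have Ufin : U \is a fin_num.
  rewrite ge0_fin_numE // ltey; apply/eqP => Uoo.
  by have := fin 0%N (leq0n _); rewrite main // mul0e adde0 Uoo gt0_muley ?lte_fin.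
have Vfin : V \is a fin_num.
  rewrite ge0_fin_numE // ltey; apply/eqP => Voo.
  have := fin d (leqnn _); rewrite main // Voo gt0_muley ?lte_fin ?ltr0n //.
  by rewrite addey ?gt0_muley ?lte_fin // -ltNye (lt_le_trans _ UE).
exists (c^-1 * fine U)%R, (c^-1 * fine V)%R => p pd; rewrite main //.
have UV : (c^-1)%:E * (U + p%:R%:E * V) = (c^-1 * (fine U + p%:R * fine V))%:E.
  by rewrite EFinM EFinD EFinM !fineK.
by rewrite UV; congr EFin; ring.
Qed.

Let pairE a b C : measurable C ->
  measurable ((fun w => (Rec a w, Rec b w)) @^-1` C).
Proof.
move=> mC; rewrite -[X in measurable X]setTI.
exact: (measurable_fun_pair (measurable_record_rv X a) (measurable_record_rv X b)).
Qed.

Lemma record_regression a d p C : (0 < d)%N -> (p <= d)%N -> measurable C ->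
  let E := (fun w => (Rec a w, Rec (d + a) w)) @^-1` C in
  let rho j := fine (\int[P]_(w in E) (Rec j w)%:E) in
  (d%:R * rho (p + a)%N = (d - p)%:R * rho a + p%:R * rho (d + a)%N)%R.
Proof.
move=> d0 pd mC E rho.
have mE : measurable E by exact: pairE.
pose f j w := phi (Rec j w).
have mf j : measurable_fun setT (f j).
  by apply: measurableT_comp => //; exact: measurable_record_rv.
have f0 j w : (0 <= f j w)%R by exact: phi0.
(* Multiplying by d and keeping each record on its side makes both combinations nonnegative, as
   needed to pass from rectangles to all events. The zero term gives [h1] the shape of
   [integral_lin2]. *)
pose h1 w := (d%:R * f (p + a)%N w + 0 * f a w)%R.
pose h2 w := ((d - p)%:R * f a w + p%:R * f (d + a)%N w)%R.
have H : \int[P]_(w in E) (h1 w)%:E = \int[P]_(w in E) (h2 w)%:E.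
  apply: (eq_integral_rectangles (Z := fun w => (Rec a w, Rec (d + a) w))) => //.
  - exact: (measurable_fun_pair (measurable_record_rv X a) (measurable_record_rv X (d + a))).
  - by apply: measurable_funD; apply: measurable_funM.
  - by move=> w; rewrite addr_ge0 // mulr_ge0.
  - by apply: measurable_funD; apply: measurable_funM.
  - by move=> w; rewrite addr_ge0 // mulr_ge0.
  - by rewrite (integral_lin2 _ _ measurableT (iphi _ measurableT) (iphi _ measurableT)) ltry.
  move=> A B mA mB; have mAB := pairE a (d + a) (measurableX mA mB).
  rewrite !(integral_lin2 _ _ mAB (iphi _ mAB) (iphi _ mAB)).
  have [u [v uv]] := record_rectangles a d0 mA mB.
  have := uv 0%N (leq0n _); rewrite add0n => ->.
  rewrite (uv p pd) (uv d (leqnn d)) /= natrB //.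
  by congr EFin; ring.
move: H; rewrite !(integral_lin2 _ _ mE (iphi _ mE) (iphi _ mE)) => -[].
rewrite /rho !(integral_record_dist mE (iphi _ mE)) natrB // => H.
rewrite !mulrDr; move: H; set I1 := fine _; set I2 := fine _; set I3 := fine _ => H.
have -> : (d%:R * I1 = (d%:R - p%:R) * I2 + p%:R * I3)%R.
  by rewrite -H; ring.
by ring.
Qed.

(** Each record contributes its interpolation: [p] steps after the left end, the right end has
    weight p / d. *)
Lemma record_cond_exp a d p1 p2 (x1 x2 : R) : (0 < d)%N ->
  (p1 <= d)%N -> (p2 <= d)%N ->
  is_cond_exp P (fun w => x1 * Rec (p1 + a) w + x2 * Rec (p2 + a) w)%R
    (fun w => (Rec a w, Rec (d + a) w))
    (fun z => (x1 * (d - p1)%:R + x2 * (d - p2)%:R) / d%:R * z.1 +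
              (x1 * p1%:R + x2 * p2%:R) / d%:R * z.2)%R.
Proof.
move=> d0 p1d p2d.
have iR j (E : set T) : measurable E -> P.-integrable E (EFin \o Rec j).
  by move=> mE; exact: integrable_record_dist mE (iphi j mE).
split.
- by apply: measurable_funD; apply: measurable_funM.
- exists (fun=> setT); split=> //; first by rewrite bigcup_const.
  by move=> _; rewrite preimage_setT; apply: integrable_lin2 => //; exact: iR.
move=> C mC _; have mE := pairE a (d + a) mC.
split; first exact: (integrable_lin2 _ _ mE (iR a _ mE) (iR (d + a)%N _ mE)).
rewrite (integral_lin2 _ _ mE (iR (p1 + a)%N _ mE) (iR (p2 + a)%N _ mE)).
rewrite (integral_lin2 _ _ mE (iR a _ mE) (iR (d + a)%N _ mE)).
have := record_regression a d0 p1d mC; have := record_regression a d0 p2d mC.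
rewrite /=; set r1 := fine _; set r2 := fine _; set r3 := fine _; set r4 := fine _ => H1 H2.
have dn0 : (d%:R != 0 :> R)%R by rewrite pnatr_eq0 -lt0n.
congr EFin; apply: (mulfI dn0).
rewrite mulrDr (mulrCA _ x1) (mulrCA _ x2) H1 H2.
by field.
Qed.

End ExponentialRecords.

(** * The functional equation on the half-line *)

Section TailBounded.
Context {R : realType}.
Local Open Scope ereal_scope.
Local Notation J := (@leb_tail R).

(** The class in which J is finite on the half-line and real calculus applies. It is stable under J
    and contains g J^j w even for unbounded g. The bound concerns y >= 0, where g is monotone. *)
Definition tail_bounded (beta : R) (f : R -> \bar R) :=
  [/\ measurable_fun setT f, forall y, 0 <= f y,
      exists M : R, forall y, (0 <= y)%R -> f y <= M%:E &
      forall y, (beta < y)%R -> f y = 0].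

Lemma tail_bounded_fin (beta : R) f (s : R) : tail_bounded beta f -> (0 <= s)%R ->
  f s \is a fin_num.
Proof.
move=> [_ f0 [M fM] _] s0; rewrite ge0_fin_numE //.
by rewrite (le_lt_trans (fM _ s0)) // ltry.
Qed.

Lemma tail_bounded_leb_tail (beta : R) f : (0 <= beta)%R -> tail_bounded beta f ->
  tail_bounded beta (J f).
Proof.
move=> b0 [mf f0 [M fM] fb]; split.
- exact: measurable_leb_tail.
- by move=> y; exact: leb_tail_ge0.
- have M0 : (0 <= M)%R by rewrite -lee_fin (le_trans (f0 0%R)) // fM.
  (* Only the part of the ray inside ]0, beta] contributes. *)
  exists (M * beta)%R => s s0.
  have mI : measurable (`]0%R, beta]%classic : set (measurableTypeR R)) by exact: measurable_itv.
  apply: (@le_trans _ _ (\int[lebesgue_measure]_(y in `]0%R, beta]) (cst M%:E y))); last first.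
    rewrite integral_cst // EFinM lee_wpmul2l ?lee_fin //.
    have H := lebesgue_measure_itv `]0%R, beta].
    by rewrite [X in X <= _]H /=; case: ifP => _; rewrite ?sube0 ?lee_fin.
  have mr (D : set (measurableTypeR R)) (h : measurableTypeR R -> \bar R) :
      measurable D -> measurable_fun setT h -> measurable_fun setT (h \_ D).
    by move=> mD mh; apply/(measurable_restrictT _ mD); exact: measurable_funTS.
  rewrite /leb_tail integral_mkcond [leRHS]integral_mkcond.
  apply: ge0_le_integral => //.
  + by move=> y _; rewrite patchE; case: ifP.
  + by apply: (mr _ f); [exact: measurable_itv|move=> _ B mB; exact: (mf measurableT _ mB)].
  + by apply: mr => //; exact: measurable_cst.
  move=> y _; rewrite !patchE; case: ifPn => [|_]; last by case: ifP => _; rewrite ?lee_fin.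
  rewrite inE /= in_itv /= andbT => sy; have y0 := le_lt_trans s0 sy.
  case: ifPn => [_|]; first exact/fM/ltW.
  rewrite notin_setE /= in_itv /= y0 /= => /negP; rewrite -ltNge => by_.
  by rewrite fb.
- move=> y by_; apply: integral0_eq => z /=; rewrite in_itv /= andbT => yz.
  by rewrite fb // (lt_trans by_).
Qed.

Lemma tail_bounded_iter (beta : R) j f : (0 <= beta)%R -> tail_bounded beta f ->
  tail_bounded beta (iter j J f).
Proof. by move=> b0 bf; elim: j => [//|j IH]; exact: tail_bounded_leb_tail. Qed.

(** Replaces the tail by an integral from the fixed point 0, the form to which the fundamental
    theorem of calculus applies. *)
Lemma fine_leb_tailE (beta : R) f (s : R) : (0 <= beta)%R -> tail_bounded beta f -> (0 <= s)%R ->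
  (fine (J f s) = fine (J f 0) - \int[lebesgue_measure]_(t in `[0, s]) fine (f t))%R.
Proof.
move=> b0 bf s0; have [mf f0 _ _] := bf.
have bJ := tail_bounded_leb_tail b0 bf.
have Js := tail_bounded_fin bJ s0; have J0 := tail_bounded_fin bJ (lexx 0%R).
have mf' (D : set (measurableTypeR R)) : measurable_fun D f.
  by apply: (@measurable_funTS _ _ (measurableTypeR R)).
have H : J f 0%R = \int[lebesgue_measure]_(t in `[0%R, s]) f t + J f s.
  rewrite -integral_itv_obnd_cbnd; last exact: mf'.
  rewrite /leb_tail.
  rewrite -ge0_integral_setU //; first congr (integral _ _ _).
  - apply/seteqP; split=> y; rewrite /= !in_itv /= !andbT.
      by move=> y0; case: (leP y s) => ys; [left|right]; rewrite /= ?in_itv /= ?y0 ?ys.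
    by case=> [/andP[]//|]; exact: le_lt_trans.
  - apply/disj_setPS => y /= []; rewrite !in_itv /= andbT => /andP[_ ys] sy.
    by have := le_lt_trans ys sy; rewrite ltxx.
have If : \int[lebesgue_measure]_(t in `[0%R, s]) f t \is a fin_num.
  rewrite ge0_fin_numE; last by apply: integral_ge0.
  apply: (@le_lt_trans _ _ (J f 0%R)); last by rewrite -ge0_fin_numE // leb_tail_ge0.
  by rewrite H leeDl // leb_tail_ge0.
have IE : fine (\int[lebesgue_measure]_(t in `[0%R, s]) f t) =
    (\int[lebesgue_measure]_(t in `[0, s]) fine (f t))%R.
  rewrite /Rintegral; congr fine; apply: eq_integral => t.
  rewrite inE /= in_itv /= => /andP[t0 _]; rewrite fineK //.
  exact: tail_bounded_fin bf t0.
have HD : fine (J f 0%R) =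
    (fine (\int[lebesgue_measure]_(t in `[0%R, s]) f t) + fine (J f s))%R.
  by rewrite H; exact: fineD.
by rewrite HD IE addrAC subrr add0r.
Qed.

Lemma tail_bounded_integrable (beta : R) f (s : R) : tail_bounded beta f -> (0 <= s)%R ->
  (@lebesgue_measure R).-integrable `[0%R, s] (EFin \o (fine \o f)).
Proof.
move=> bf s0; have [mf f0 [M fM] _] := bf.
apply: measurable_bounded_integrable => //.
- have H := lebesgue_measure_itv `[0%R, s].
  by rewrite [X in X < _]H /=; case: ifP => _; rewrite ?ltry // -EFinB ltry.
- apply: (@measurable_funTS _ _ (measurableTypeR R)).
  exact: (measurableT_comp (fine_measurable _) mf).
exists M; split=> [|x Mx t /=]; first exact: num_real.
rewrite in_itv /= => /andP[t0 _].
have ft := tail_bounded_fin bf t0.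
rewrite ger0_norm ?fine_ge0 // -lee_fin fineK //.
by rewrite (le_trans (fM _ t0)) // lee_fin ltW.
Qed.

Lemma near_fine_leb_tailE (beta : R) f (s : R) : (0 <= beta)%R -> tail_bounded beta f ->
  (0 < s)%R ->
  \forall x \near s, (fine (J f 0) - \int[lebesgue_measure]_(t in `[0, x]) fine (f t))%R =
    fine (J f x).
Proof.
move=> b0 bf s0.
apply: filterS (lt_nbhsr s0) => x x0; apply/esym.
exact: (fine_leb_tailE b0 bf (ltW x0)).
Qed.

Lemma continuous_fine_leb_tail (beta : R) f (s : R) : (0 <= beta)%R -> tail_bounded beta f ->
  (0 < s)%R -> {for s, continuous (fun x => fine (J f x))}.
Proof.
move=> b0 bf s0.
have s1 : (0 <= s + 1)%R by rewrite addr_ge0 ?ltW.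
have H := parameterized_integral_continuous s1 (tail_bounded_integrable bf s1).
have s01 : (0 < s + 1)%R by rewrite (lt_trans s0) // ltrDl.
have [c _ _] := (continuous_within_itvP _ s01).1 H.
have cs : {for s, continuous (fun x => parameterized_integral lebesgue_measure 0%R x (fine \o f))}.
  by apply: c; rewrite in_itv /= s0 ltrDl ltr01.
have cg : {for s, continuous (fun x => fine (J f 0) - parameterized_integral lebesgue_measure 0%R x (fine \o f))%R}.
  by apply: cvgB => //; exact: cvg_cst.
have E := near_fine_leb_tailE b0 bf s0.
suff : fine (J f x) @[x --> s] --> fine (J f s) by [].
rewrite -(nbhs_singleton E); apply: cvg_trans cg.
exact: (near_eq_cvg E).
Qed.

Lemma is_derive_fine_leb_tail (beta : R) f (s : R) : (0 <= beta)%R -> tail_bounded beta f ->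
  (0 < s)%R -> {for s, continuous (fun x => fine (f x))} ->
  is_derive s 1%R (fun x => fine (J f x)) (- fine (f s))%R.
Proof.
move=> b0 bf s0 cf.
have s1 : (0 <= s + 1)%R by rewrite addr_ge0 ?ltW.
have ss1 : (s < s + 1)%R by rewrite ltrDl.
have [dF FE] := continuous_FTC1_closed ss1 (tail_bounded_integrable bf s1) s0 cf.
apply: near_eq_is_derive (near_fine_leb_tailE b0 bf s0) _.
rewrite -[X in is_derive _ _ _ X]sub0r.
apply: is_deriveB.
by apply: DeriveDef => //; rewrite -derive1E FE.
Qed.

End TailBounded.

(** * Null sets and a second-order Taylor expansion *)

Section RealAnalysis.
Context {R : realType}.
Local Open Scope ring_scope.

Lemma ae_exists (Q : R -> Prop) (a b : R) : a < b ->
  {ae (@lebesgue_measure R), forall y, Q y} -> exists2 y, a < y < b & Q y.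
Proof.
move=> ab [N [mN N0 sub]]; apply: contrapT => H.
have abN : (`]a, b[%classic : set R) `<=` N.
  move=> y; rewrite /= in_itv /= => yab; apply: sub => /= Qy.
  by apply: H; exists y.
have mI : measurable (`]a, b[%classic : set (measurableTypeR R)) by exact: measurable_itv.
have : ((@lebesgue_measure R) `]a, b[%classic <= (@lebesgue_measure R) N)%E.
  by apply: le_measure => //; rewrite inE.
have := lebesgue_measure_itv `]a, b[ => L.
rewrite [X in (X <= _)%E]L N0 /= lte_fin ab -EFinB lee_fin subr_le0.
by rewrite leNgt ab.
Qed.

(** The second derivative is given at s only, so the mean value theorem is applied once, to the
    Taylor remainder, whose derivative is o(y - s) by differentiability of [dg] at s. The right side
    of s is the one that J sees. *)
Lemma taylor2 (g dg : R -> R) (s d2 eta : R) : 0 < eta ->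
  (forall x, s - eta < x < s + eta -> is_derive x 1 g (dg x)) ->
  is_derive s 1 dg d2 ->
  forall e, 0 < e -> exists2 d, 0 < d & forall x, s <= x <= s + d ->
    `|g x - g s - dg s * (x - s) - d2 / 2 * (x - s) ^+ 2| <= e * (x - s) ^+ 2.
Proof.
move=> eta0 Dg Ddg e e0.
have [/cvg_ex[l Hl] Dl] := Ddg.
have lE : l = d2 by rewrite -Dl; apply/esym/cvg_lim.
move: Hl; rewrite lE => /cvgrPdist_le/(_ _ e0).
move=> [d0 /= d00 Hd0].
exists (Num.min (d0 / 2) (eta / 2)).
  by rewrite lt_min !divr_gt0.
move=> x /andP[sx]; have [->|sx' xd] := eqVneq x s.
  by rewrite !subrr expr0n /= !mulr0 !subr0 normr0.
have {sx sx'} sx : s < x by rewrite lt_neqAle eq_sym sx' sx.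
have xd0 : x <= s + d0 / 2 by rewrite (le_trans xd) // lerD2l ge_min lexx.
have xeta : x <= s + eta / 2 by rewrite (le_trans xd) // lerD2l ge_min lexx orbT.
pose f y := g y - dg s * (y - s) - d2 / 2 * (y - s) ^+ 2.
pose df y := dg y - dg s - d2 * (y - s).
have Df y : y \in `[s, x] -> is_derive y 1 f (df y).
  rewrite in_itv /= => /andP[sy yx].
  have Dgy : is_derive y 1 g (dg y).
    by apply: Dg; apply/andP; split; lra.
  rewrite /f; apply: is_derive_eq.
  rewrite /df /GRing.scale /=; by field.
have cf : {within `[s, x], continuous f}.
  by apply: derivable_within_continuous => y yx; have [] := Df y yx.
have Df' y : y \in `]s, x[%R -> is_derive y 1 f (df y).
  by move=> yI; apply: Df; move: yI; rewrite !in_itv /= => /andP[/ltW -> /ltW ->].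
have [y yI fE] := MVT sx Df' cf.
move: yI; rewrite in_itv /= => /andP[sy yx].
have -> : g x - g s - dg s * (x - s) - d2 / 2 * (x - s) ^+ 2 = f x - f s.
  by rewrite /f; field.
have xs0 : 0 <= x - s by rewrite subr_ge0 ltW.
rewrite fE normrM (ger0_norm xs0) expr2 mulrA; apply: ler_wpM2r => //.
have ys0 : 0 < y - s by rewrite subr_gt0.
have := Hd0 (y - s).
rewrite /= sub0r normrN gtr0_norm // => /(_ _ _).
have yd0 : y - s < d0 by lra.
move=> /(_ yd0); rewrite gt_eqF // => /(_ isT).
rewrite /GRing.scale /= mulr1 subrK => H.
have -> : df y = (y - s) * - (d2 - (y - s)^-1 * (dg y - dg s)).
  by rewrite /df; field; rewrite gt_eqF.
rewrite normrM normrN gtr0_norm // mulrC.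
by apply: ler_pM => //; [exact: ltW|rewrite lerBlDr subrK ltW].
Qed.

End RealAnalysis.

(** * Moments of J about its evaluation point *)

Section TailMoments.
Context {R : realType}.
Local Open Scope ereal_scope.
Local Notation J := (@leb_tail R).

Lemma leb_tail_le (f g : R -> \bar R) s : measurable_fun setT f ->
  (forall y, 0 <= f y) -> measurable_fun setT g ->
  (forall y, (s < y)%R -> f y <= g y) -> J f s <= J g s.
Proof.
move=> mf f0 mg fg; rewrite /leb_tail.
apply: ge0_le_integral => //.
- by apply: (@measurable_funTS _ _ (measurableTypeR R)).
- by apply: (@measurable_funTS _ _ (measurableTypeR R)).
- by move=> y; rewrite /= in_itv /= andbT; exact: fg.
Qed.

Lemma iter_leb_tail_le j (f g : R -> \bar R) s : measurable_fun setT f ->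
  (forall y, 0 <= f y) -> measurable_fun setT g -> (forall y, 0 <= g y) ->
  (forall y, (s <= y)%R -> f y <= g y) -> iter j J f s <= iter j J g s.
Proof.
move=> mf f0 mg g0; elim: j s => [|j IH] s fg /=; first exact: fg.
have [mj j0] := iter_leb_tail j mf f0.
have [mk k0] := iter_leb_tail j mg g0.
apply: leb_tail_le => // y sy; apply: IH => z yz.
by rewrite fg // (le_trans _ yz) // ltW.
Qed.

Lemma tail_boundedM (beta M : R) (h : R -> R) f : measurable_fun setT h ->
  (forall y, 0 <= h y)%R -> (forall y, 0 <= y <= beta -> h y <= M)%R ->
  tail_bounded beta f -> tail_bounded beta (fun y => (h y)%:E * f y).
Proof.
move=> mh h0 hM [mf f0 [M' fM] fb]; split.
- by apply: emeasurable_funM => //; exact/measurable_EFinP.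
- by move=> y; rewrite mule_ge0 ?lee_fin.
- exists (Num.max 0 M * Num.max 0 M')%R => y y0; case: (leP y beta) => yb.
    rewrite EFinM; apply: lee_pmul => //; rewrite ?lee_fin ?h0 //.
      by rewrite le_max hM ?orbT // y0 yb.
    by rewrite (le_trans (fM _ y0)) // lee_fin le_max lexx orbT.
  by rewrite fb // mule0 lee_fin mulr_ge0 // le_max lexx.
- by move=> y yb; rewrite fb // mule0.
Qed.

Lemma tail_boundedD (beta : R) f g : tail_bounded beta f -> tail_bounded beta g ->
  tail_bounded beta (fun y => f y + g y).
Proof.
move=> [mf f0 [M fM] fb] [mg g0 [M' gM] gb]; split.
- exact: emeasurable_funD.
- by move=> y; rewrite adde_ge0.
- by exists (M + M')%R => y y0; rewrite EFinD leeD ?fM ?gM.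
- by move=> y yb; rewrite fb // gb // adde0.
Qed.

Variables (beta : R) (b0 : (0 <= beta)%R).

Lemma measurable_distr (s : R) : measurable_fun setT (fun y : R => `|y - s|%R).
Proof.
by apply: measurableT_comp => //; apply: measurable_funB => //; exact: measurable_cst.
Qed.

Lemma tail_bounded_dist f (s : R) : tail_bounded beta f ->
  tail_bounded beta (fun y => `|y - s|%:E * f y).
Proof.
move=> bf; apply: (@tail_boundedM beta (beta + `|s|)%R (fun y => `|y - s|%R)) => //.
  exact: measurable_distr.
move=> y /andP[y0 yb]; rewrite (le_trans (ler_normB _ _)) // lerD2r ger0_norm //.
Qed.

(** Centring at the evaluation point removes the term s J^j f from [iter_leb_tail_mulr]; that term
    is finite, so it may be subtracted. *)
Lemma iter_leb_tail_dist j f (s : R) : tail_bounded beta f -> (0 <= s)%R ->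
  iter j J (fun y => `|y - s|%:E * f y) s = j%:R%:E * iter j.+1 J f s.
Proof.
move=> bf s0; have [mf f0 _ _] := bf.
have [md d0 _ _] := tail_bounded_dist s bf.
have sf := tail_bounded_fin (tail_bounded_iter j b0 bf) s0.
have := iter_leb_tail_mulr j mf f0 s0.
rewrite (@eq_iter_leb_tail _ _ _ (fun y => s%:E * f y + `|y - s|%:E * f y)); last first.
  move=> y sy; rewrite -ge0_muleDl ?lee_fin // -EFinD ger0_norm ?(le_trans s0) //.
  by rewrite ger0_norm ?subr_ge0 // addrC subrK.
rewrite iter_leb_tailD //; first last.
- by move=> y; rewrite mule_ge0 ?lee_fin.
- by apply: emeasurable_funM => //; exact: measurable_cst.
rewrite iter_leb_tailZ // => H.
have sfin : s%:E * iter j J f s \is a fin_num by rewrite fin_numM.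
by rewrite -[LHS](addeK _ sfin) [_ + s%:E * _]addeC H addeC addeA [- _ + _]addeC subee // add0e.
Qed.

(** The quadratic term uses [iter_leb_tail_dist] twice, with exponents j and j + 1, hence the
    product j (j + 1). *)
Lemma iter_leb_tail_poly j f (s c0 c1 c2 : R) : tail_bounded beta f -> (0 <= s)%R ->
  (0 <= c0)%R -> (0 <= c1)%R -> (0 <= c2)%R ->
  iter j J (fun y => (c0 + c1 * `|y - s| + c2 * `|y - s| ^+ 2)%:E * f y) s =
  c0%:E * iter j J f s + (c1 * j%:R)%:E * iter j.+1 J f s +
  (c2 * (j * j.+1)%:R)%:E * iter j.+2 J f s.
Proof.
move=> bf s0 c00 c10 c20; have [mf f0 _ _] := bf.
have b1 := tail_bounded_dist s bf; have [m1 d1 _ _] := b1.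
have b2 := tail_bounded_dist s b1; have [m2 d2 _ _] := b2.
rewrite (_ : (fun y => _) = (fun y => (c0%:E * f y + c1%:E * (`|y - s|%:E * f y)) +
    c2%:E * (`|y - s|%:E * (`|y - s|%:E * f y)))); last first.
  apply/funext => y; rewrite EFinD ge0_muleDl ?lee_fin ?addr_ge0 ?mulr_ge0 ?exprn_ge0 //.
  by rewrite EFinD ge0_muleDl ?lee_fin ?mulr_ge0 // expr2 !EFinM !muleA.
have mZ h (c : R) : measurable_fun setT h -> measurable_fun setT (fun y : R => c%:E * h y).
  by move=> mh; apply: emeasurable_funM => //; exact: measurable_cst.
have Z0 (h : R -> \bar R) (c : R) : (forall y, 0 <= h y) -> (0 <= c)%R ->
    forall y, 0 <= c%:E * h y.
  by move=> h0 c_ge0 y; rewrite mule_ge0 ?lee_fin.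
rewrite iter_leb_tailD; first last.
- exact: Z0.
- exact: mZ.
- by move=> y; apply: adde_ge0; rewrite mule_ge0 ?lee_fin.
- by apply: emeasurable_funD; exact: mZ.
rewrite iter_leb_tailD; [|exact: mZ|exact: Z0|exact: mZ|exact: Z0].
rewrite !iter_leb_tailZ // (iter_leb_tail_dist j b1 s0) !iter_leb_tail_dist //.
by rewrite natrM !EFinM !muleA.
Qed.

(** Taylor coefficients may be negative, while additivity of J is available for nonnegative
    functions: a common polynomial is added to both sides and cancelled after passing to the
    reals. *)
Lemma iter_leb_tail_taylor j f (g : R -> R) (s a q e M : R) :
  tail_bounded beta f -> (0 <= s)%R -> (0 <= e)%R ->
  measurable_fun setT g -> (forall y, 0 <= g y)%R ->
  (forall y, 0 <= y <= beta -> g y <= M)%R ->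
  (forall y, s <= y <= beta ->
    `|g y - g s - a * (y - s) - q * (y - s) ^+ 2| <= e * (y - s) ^+ 2)%R ->
  (`|fine (iter j J (fun y => (g y)%:E * f y)%E s) - g s * fine (iter j J f s) -
     a * j%:R * fine (iter j.+1 J f s) -
     q * (j * j.+1)%:R * fine (iter j.+2 J f s)| <=
   e * (j * j.+1)%:R * fine (iter j.+2 J f s))%R.
Proof.
move=> bf s0 e0 mg g0 gM gT; have [mf f0 _ fb] := bf.
have bg := tail_boundedM mg g0 gM bf; have [mgf gf0 _ _] := bg.
have fin i h : tail_bounded beta h -> iter i J h s = (fine (iter i J h s))%:E.
  by move=> bh; rewrite fineK // (tail_bounded_fin (tail_bounded_iter i b0 bh)).
(* Adding [C] makes the quadratic coefficients q - e and q + e nonnegative; |a| does the same for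
   the linear one. *)
pose C := (`|q| + e)%R; have C0 : (0 <= C)%R by rewrite addr_ge0.
pose p c0 c1 c2 (y : R) := (c0 + c1 * `|y - s| + c2 * `|y - s| ^+ 2)%R.
have p0 c0 c1 c2 y : (0 <= c0 -> 0 <= c1 -> 0 <= c2 -> 0 <= p c0 c1 c2 y)%R.
  by move=> *; rewrite !addr_ge0 ?mulr_ge0 ?exprn_ge0.
have mp c0 c1 c2 : measurable_fun setT (fun y => (p c0 c1 c2 y)%:E * f y).
  apply: emeasurable_funM => //; apply/measurable_EFinP.
  apply: measurable_funD; first apply: measurable_funD.
  - exact: measurable_cst.
  - by apply: measurable_funM; [exact: measurable_cst|exact: measurable_distr].
  - apply: measurable_funM; first exact: measurable_cst.
    by apply: measurable_funX; exact: measurable_distr.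
have aa : (0 <= a + `|a|)%R by have := ler_norm (- a)%R; rewrite normrN; lra.
have qq : (0 <= q + C - e)%R.
  by have := ler_norm (- q)%R; rewrite normrN /C; lra.
have qq' : (0 <= q + C + e)%R by lra.
have pf0 c0 c1 c2 (y : R) : (0 <= c0)%R -> (0 <= c1)%R -> (0 <= c2)%R ->
    0 <= (p c0 c1 c2 y)%:E * f y.
  by move=> *; rewrite mule_ge0 ?lee_fin ?p0.
have E : iter j J (fun y => (g y)%:E * f y + (p 0%R `|a|%R C y)%:E * f y) s =
    iter j J (fun y => (g y)%:E * f y) s +
    iter j J (fun y => (p 0%R `|a|%R C y)%:E * f y) s.
  by apply: iter_leb_tailD => // y; exact: pf0.
have mE : measurable_fun setT (fun y => (g y)%:E * f y + (p 0%R `|a|%R C y)%:E * f y).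
  exact: emeasurable_funD.
have E0 y : 0 <= (g y)%:E * f y + (p 0%R `|a|%R C y)%:E * f y.
  by rewrite adde_ge0 ?pf0.
have U : iter j J (fun y => (g y)%:E * f y + (p 0%R `|a|%R C y)%:E * f y) s <=
    iter j J (fun y => (p (g s) (a + `|a|)%R (q + C + e)%R y)%:E * f y) s.
  apply: iter_leb_tail_le => //; first by move=> y; rewrite pf0.
  move=> y sy; case: (leP y beta) => yb; last by rewrite !fb // !mule0 adde0.
  rewrite -ge0_muleDl ?lee_fin ?p0 // lee_wpmul2r // -EFinD lee_fin /p.
  have : (s <= y <= beta)%R by rewrite sy.
  move=> /gT /ler_normlP[]; rewrite (ger0_norm (_ : (0 <= y - s)%R)) ?subr_ge0 //.
  by lra.
have L : iter j J (fun y => (p (g s) (a + `|a|)%R (q + C - e)%R y)%:E * f y) s <=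
    iter j J (fun y => (g y)%:E * f y + (p 0%R `|a|%R C y)%:E * f y) s.
  apply: iter_leb_tail_le => //; first by move=> y; rewrite pf0.
  move=> y sy; case: (leP y beta) => yb; last by rewrite !fb // !mule0 adde0.
  rewrite -ge0_muleDl ?lee_fin ?p0 // lee_wpmul2r // -EFinD lee_fin /p.
  have : (s <= y <= beta)%R by rewrite sy.
  move=> /gT /ler_normlP[]; rewrite (ger0_norm (_ : (0 <= y - s)%R)) ?subr_ge0 //.
  by lra.
move: U L; rewrite E !iter_leb_tail_poly // (fin j _ bg) (fin j _ bf) (fin j.+1 _ bf) (fin j.+2 _ bf) mul0e add0e.
rewrite -!EFinM -!EFinD !lee_fin => U L.
by apply/ler_normlP; split; lra.
Qed.

End TailMoments.

(** * Solutions of the functional equation are affine *)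

Section AffineSolutions.
Context {R : realType}.
Local Open Scope ereal_scope.
Local Notation J := (@leb_tail R).
Local Notation leb := (@lebesgue_measure R).

(** The weight w of the overview. *)
Definition trunc_exp (beta y : R) : \bar R :=
  (\1_(`[0%R, beta]%classic : set R) y * expR (- y))%:E.

Lemma trunc_expE (beta y : R) : (0 <= y <= beta)%R ->
  trunc_exp beta y = (expR (- y))%:E.
Proof. by move=> yb; rewrite /trunc_exp indicE mem_set ?mul1r //= in_itv. Qed.

Lemma tail_bounded_trunc_exp (beta : R) : tail_bounded beta (trunc_exp beta).
Proof.
split.
- apply/measurable_EFinP; apply: measurable_funM; first exact: measurable_indic.
  by apply: measurableT_comp => //; exact: measurableT_comp.
- by move=> y; rewrite lee_fin mulr_ge0 ?expR_ge0.
- exists 1%R => y y0; rewrite lee_fin indicE.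
  by rewrite mulr_ile1 ?expR_ge0 ?ler0n ?lern1 ?leq_b1 // expR_le1 oppr_le0.
- move=> y yb; rewrite /trunc_exp indicE memNset ?mul0r //= in_itv /=.
  by move=> /andP[_]; rewrite leNgt yb.
Qed.

(** At infinite [y] both sides are 0, by the default value of [fine]. *)
Lemma fine_EFinM (x : R) (y : \bar R) : fine (x%:E * y) = (x * fine y)%R.
Proof.
case: y => [y| |] //=; rewrite mulr0.
  by rewrite mulry; case: sgrP => _; rewrite ?mul0e ?mul1e // mulN1e.
by rewrite mulrNy; case: sgrP => _; rewrite ?mul0e ?mul1e // mulN1e.
Qed.

Section Derivatives.
Variables (beta : R) (b0 : (0 <= beta)%R) (f : R -> \bar R).
Hypothesis bf : tail_bounded beta f.

Lemma continuous_fine_iter j (s : R) :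
  (forall x : R, (0 < x)%R -> {for x, continuous (fun y => fine (f y))}) ->
  (0 < s)%R -> {for s, continuous (fun y => fine (iter j J f y))}.
Proof.
move=> cf s0; case: j => [|j] /=; first exact: cf.
by apply: continuous_fine_leb_tail b0 _ s0; exact: tail_bounded_iter.
Qed.

Lemma is_derive_fine_iter j (s : R) :
  (forall x : R, (0 < x)%R -> {for x, continuous (fun y => fine (f y))}) ->
  (0 < s)%R ->
  is_derive s 1%R (fun y => fine (iter j.+1 J f y)) (- fine (iter j J f s))%R.
Proof.
move=> cf s0 /=.
apply: (is_derive_fine_leb_tail b0 (tail_bounded_iter j b0 bf) s0).
exact: continuous_fine_iter.
Qed.

Lemma derivable_fine_iter j (s : R) :
  (forall x : R, (0 < x)%R -> derivable (fun y => fine (f y)) x 1) ->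
  (0 < s)%R -> derivable (fun y => fine (iter j J f y)) s 1.
Proof.
move=> df s0; case: j => [|j]; first exact: df.
have cf (x : R) : (0 < x)%R -> {for x, continuous (fun y => fine (f y))}.
  by move=> x0; apply: differentiable_continuous; apply/derivable1_diffP; exact: df.
by have [] := is_derive_fine_iter j cf s0.
Qed.

End Derivatives.

(** With N = K + c, the terms of order 0 and 1 cancel in N UB - K UA and q N K c W2 remains. The
    remainders add up to at most e N K (N + K + 2) W2, and [e] is chosen to make this half of |q| N
    K c W2. *)
Lemma second_order_contradiction (K c q e a y W0 W1 W2 XA XB : R) :
  (0 < K)%R -> (0 < c)%R -> q != 0%R ->
  e = (`|q| * c / (2 * (K + c + K + 2)))%R -> (0 < W2)%R ->
  (`|XA - y * W0 - a * (K + c) * W1 - q * ((K + c) * (K + c + 1)) * W2| <=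
    e * ((K + c) * (K + c + 1)) * W2)%R ->
  (`|XB - y * W0 - a * K * W1 - q * (K * (K + 1)) * W2| <=
    e * (K * (K + 1)) * W2)%R ->
  (c * (y * W0) = (K + c) * XB - K * XA)%R -> False.
Proof.
move=> K0 c0 q0 eE W2_gt0; set N := (K + c)%R in eE *.
set UA := (XA - _ - _ - _)%R; set UB := (XB - _ - _ - _)%R => TA TB E.
have qE : (q * (N * K * c * W2) = N * UB - K * UA)%R.
  have {}E : (N * XB = K * XA + c * (y * W0))%R by rewrite E addrC subrK.
  by rewrite /UA /UB !mulrBr E /N; ring.
have N0 : (0 < N)%R by rewrite addr_gt0.
have : (`|q| * (N * K * c * W2) <=
    N * (e * (K * (K + 1)) * W2) + K * (e * (N * (N + 1)) * W2))%R.
  rewrite -(gtr0_norm (_ : 0 < N * K * c * W2)%R) ?mulr_gt0 // -normrM qE.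
  rewrite (le_trans (ler_normB _ _)) // !normrM (gtr0_norm N0) (gtr0_norm K0).
  by rewrite lerD // ler_pM2l.
rewrite (_ : _ + _ = (`|q| * (N * K * c * W2)) / 2)%R; last first.
  rewrite eE /N; field.
  by apply: lt0r_neq0; lra.
have : (0 < `|q| * (N * K * c * W2))%R by rewrite !mulr_gt0 ?normr_gt0.
lra.
Qed.

Section FunctionalEquation.
Variables (g : R -> R) (k p r : nat).
Hypothesis mg : measurable_fun setT g.
Hypothesis g0 : forall y, (0 <= g y)%R.
Hypothesis g_nd : forall x y : R, (0 <= x)%R -> (x <= y)%R -> (g x <= g y)%R.
Hypothesis g_right : forall s e : R, (0 < s)%R -> (0 < e)%R ->
  exists2 t, (s < t)%R & (g t < g s + e)%R.
Let h beta j := iter j J (trunc_exp beta).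
Let fa beta (y : R) := (g y)%:E * h beta r.+1 y.
Let fb beta (y : R) := (g y)%:E * h beta (p.+1 + r.+1) y.
Hypothesis g_eq : forall beta : R, (0 < beta)%R -> {ae leb, forall s : R, (0 < s)%R ->
  k.+1%:R%:E * iter (k.+1 + p.+1) J (fa beta) s +
    p.+1%:R%:E * ((g s)%:E * h beta (k.+1 + p.+1 + r.+1) s) =
  (k.+1 + p.+1)%:R%:E * iter k.+1 J (fb beta) s}.

Let A beta j s := fine (iter j J (fa beta) s).
Let B beta j s := fine (iter j J (fb beta) s).
Let H beta j s := fine (h beta j s).
(** [k.+1], [p.+1] and [r.+1] stand for k, n - m and r of the theorem. [D.+1] is the exponent N + r
    of the overview, and [D] the one left after a differentiation. *)
Let D := (k + p.+1 + r.+1)%N.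
Let Phi beta (s : R) : R :=
  ((k.+1 + p.+1)%:R * B beta k.+1 s - k.+1%:R * A beta (k.+1 + p.+1) s)%R.

Lemma tail_bounded_h (beta : R) j : (0 <= beta)%R -> tail_bounded beta (h beta j).
Proof. by move=> b0; apply: tail_bounded_iter => //; exact: tail_bounded_trunc_exp. Qed.

Lemma tail_bounded_gh (beta : R) j : (0 <= beta)%R ->
  tail_bounded beta (fun y => (g y)%:E * h beta j y).
Proof.
move=> b0; apply: (@tail_boundedM _ beta (g beta)) => //.
  by move=> y /andP[y0 yb]; exact: g_nd.
exact: tail_bounded_h.
Qed.

(** The weight w is positive on [0, beta], so J^j w cannot vanish at s < beta; this permits division
    by it. *)
Lemma H_gt0 (beta : R) j (s : R) : (0 <= s)%R -> (s < beta)%R -> (0 < H beta j s)%R.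
Proof.
move=> s0 sb; have b0 : (0 <= beta)%R by rewrite (le_trans s0) // ltW.
have bw := tail_bounded_trunc_exp beta; have [mw w0 _ _] := bw.
have bh := tail_bounded_h j b0; have [_ h0 _ _] := bh.
rewrite fine_gt0 // lt0e h0 andbT -ge0_fin_numE // (tail_bounded_fin bh) // andbT.
apply/eqP; rewrite /h; case: j {bh h0} => [|j] /=.
  rewrite trunc_expE ?s0 ?ltW // => /eqP.
  by rewrite eqe gt_eqF ?expR_gt0.
move=> /(iter_leb_tail_eq0 mw w0)/(leb_tail_eq0P s mw w0) aew.
have [y /andP[sy yb]] := ae_exists sb aew.
rewrite /= in_itv /= sy andbT => /(_ isT).
rewrite trunc_expE ?(ltW yb) ?(le_trans s0 (ltW sy)) // => /eqP.
by rewrite eqe gt_eqF ?expR_gt0.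
Qed.

Lemma continuous_H (beta : R) j (s : R) : (0 <= beta)%R -> (0 < j)%N -> (0 < s)%R ->
  {for s, continuous (H beta j)}.
Proof.
move=> b0; case: j => [//|j] _ s0.
exact: continuous_fine_leb_tail b0 (tail_bounded_h j b0) s0.
Qed.

Lemma is_derive_H (beta : R) j (s : R) : (0 <= beta)%R -> (0 < j)%N -> (0 < s)%R ->
  is_derive s 1%R (H beta j.+1) (- H beta j s)%R.
Proof.
move=> b0 j0 s0; apply: (is_derive_fine_leb_tail b0 (tail_bounded_h j b0) s0).
exact: continuous_H.
Qed.

Lemma continuous_Phi (beta s : R) : (0 <= beta)%R -> (0 < s)%R ->
  {for s, continuous (Phi beta)}.
Proof.
move=> b0 s0; apply: cvgB; apply: cvgM; try exact: cvg_cst.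
  apply: (continuous_fine_leb_tail b0 _ s0); apply: tail_bounded_iter => //.
  exact: tail_bounded_gh.
apply: (continuous_fine_leb_tail b0 _ s0); apply: tail_bounded_iter => //.
exact: tail_bounded_gh.
Qed.

(* All terms but [g s] are continuous in [s] and [g] is right-continuous, so the
   exceptional null set is empty. *)
Lemma g_eq_everywhere (beta s : R) : (0 < s)%R -> (s < beta)%R ->
  (p.+1%:R * (g s * H beta D.+1 s) = Phi beta s)%R.
Proof.
move=> s0 sb; have bt0 := lt_trans s0 sb; have b0 := ltW bt0.
pose psi y := (p.+1%:R * (g y * H beta D.+1 y) - Phi beta y)%R.
suff : psi s == 0%R by rewrite subr_eq0 => /eqP.
apply: contrapT => /negP psi0.
have cg : g y @[y --> s^'+] --> g s.
  apply/cvgrPdist_lt => e e0; have [t st gt] := g_right s0 e0.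
  near=> y.
  have sy : (s < y)%R by near: y; exact: nbhs_right_gt.
  have yt : (y < t)%R by near: y; exact: nbhs_right_lt.
  rewrite distrC ger0_norm ?subr_ge0; last by apply: g_nd; rewrite ltW.
  rewrite ltrBlDl (le_lt_trans _ gt) // g_nd ?ltW //.
  exact: lt_trans sy.
have cpsi : psi y @[y --> s^'+] --> psi s.
  apply: cvgB; last by apply: cvg_at_right_filter; exact: continuous_Phi.
  apply: cvgM; first exact: cvg_cst.
  by apply: cvgM => //; apply: cvg_at_right_filter; exact: continuous_H.
have [e /= e0 He] := cvgr_neq0 _ cpsi psi0.
have se : (s < s + e)%R by rewrite ltrDl.
have [y /andP[sy ye]] := ae_exists se (g_eq bt0).
have y0 := lt_trans s0 sy.
move=> /(_ y0) E.
have ye' : ball_ [eta Num.norm] s e y.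
  by rewrite /= distrC ger0_norm ?subr_ge0 ?(ltW sy) // ltrBlDl.
have /eqP := He y ye' sy; apply.
apply/eqP; rewrite subr_eq0; apply/eqP.
have bA := tail_bounded_iter (k.+1 + p.+1) b0 (tail_bounded_gh r.+1 b0).
have bB := tail_bounded_iter k.+1 b0 (tail_bounded_gh (p.+1 + r.+1) b0).
have bH := tail_bounded_h (k.+1 + p.+1 + r.+1) b0.
have fA := tail_bounded_fin bA (ltW y0).
have fB := tail_bounded_fin bB (ltW y0).
have fH := tail_bounded_fin bH (ltW y0).
have := congr1 fine E; rewrite fineD ?fin_numM // !fine_EFinM.
by rewrite /Phi /A /B /H /D => <-; rewrite addrC addKr.
Unshelve. all: by end_near. Qed.

(** The source of regularity: near s, g is a quotient of images of J, hence one degree smoother than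
    the integrands, which involve g itself. Taking beta > s keeps the denominator positive. *)
Lemma near_g_formula (beta s : R) : (0 < s)%R -> (s < beta)%R ->
  \forall y \near s, (Phi beta y * (p.+1%:R * H beta D.+1 y)^-1)%R = g y.
Proof.
move=> s0 sb; apply: filterS2 (lt_nbhsr s0) (lt_nbhsl sb) => y y0 yb.
rewrite -(g_eq_everywhere y0 yb) mulrCA mulfK //.
by rewrite mulf_neq0 ?pnatr_eq0 // gt_eqF // H_gt0 // ltW.
Qed.

Lemma denom_neq0 (beta s : R) : (0 < s)%R -> (s < beta)%R ->
  (p.+1%:R * H beta D.+1 s)%R != 0%R.
Proof. by move=> s0 sb; rewrite mulf_neq0 ?pnatr_eq0 // gt_eqF // H_gt0 // ltW. Qed.

Lemma continuous_g (s : R) : (0 < s)%R -> {for s, continuous g}.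
Proof.
move=> s0; have sb : (s < s + 1)%R by rewrite ltrDl.
have b0 : (0 <= s + 1)%R by rewrite addr_ge0 ?ltW.
have E := near_g_formula s0 sb.
suff : g x @[x --> s] --> g s by [].
rewrite -[in X in _ --> X](nbhs_singleton E); apply: cvg_trans (near_eq_cvg E) _.
apply: cvgM; first exact: continuous_Phi.
apply: cvgV; first exact: denom_neq0.
by apply: cvgM; [exact: cvg_cst|exact: continuous_H].
Qed.

Lemma continuous_gH (beta : R) j (s : R) : (0 <= beta)%R -> (0 < j)%N -> (0 < s)%R ->
  {for s, continuous (fun y => fine ((g y)%:E * h beta j y))}.
Proof.
move=> b0 j0 s0; rewrite (_ : (fun y => _) = (fun y => g y * H beta j y)%R).
  by apply: cvgM; [exact: continuous_g|exact: continuous_H].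
by apply/funext => y; rewrite fine_EFinM.
Qed.

Let dPhi beta (s : R) : R :=
  (k.+1%:R * A beta (k + p.+1) s - (k.+1 + p.+1)%:R * B beta k s)%R.

Lemma is_derive_Phi (beta s : R) : (0 <= beta)%R -> (0 < s)%R ->
  is_derive s 1%R (Phi beta) (dPhi beta s).
Proof.
move=> b0 s0.
have dA : is_derive s 1%R (A beta (k.+1 + p.+1)) (- A beta (k + p.+1) s)%R.
  have cf (x : R) : (0 < x)%R -> {for x, continuous (fun y => fine (fa beta y))}.
    exact: continuous_gH.
  exact: (is_derive_fine_iter b0 (tail_bounded_gh r.+1 b0) (k + p.+1)%N cf s0).
have dB : is_derive s 1%R (B beta k.+1) (- B beta k s)%R.
  have cf (x : R) : (0 < x)%R -> {for x, continuous (fun y => fine (fb beta y))}.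
    exact: continuous_gH.
  exact: (is_derive_fine_iter b0 (tail_bounded_gh (p.+1 + r.+1) b0) k cf s0).
have := is_deriveB (is_deriveZ (k.+1 + p.+1)%:R%R dB) (is_deriveZ k.+1%:R%R dA).
move=> d; apply: (is_derive_eq d).
by rewrite /dPhi /GRing.scale /= !mulrN opprK addrC.
Qed.

Lemma derivable_g (s : R) : (0 < s)%R -> derivable g s 1%R.
Proof.
move=> s0; have sb : (s < s + 1)%R by rewrite ltrDl.
have b0 : (0 <= s + 1)%R by rewrite addr_ge0 ?ltW.
apply: (near_eq_derivable (near_g_formula s0 sb)).
apply: derivableM; first by have [] := is_derive_Phi b0 s0.
apply: derivableV; first exact: denom_neq0.
apply: derivableM; first exact: derivable_cst.
by have [] := @is_derive_H (s + 1)%R D s b0 _ s0; rewrite /D addnS.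
Qed.

(** Differentiates the product equation for g and solves for g'; the resulting formula is what gets
    differentiated once more. *)
Lemma derive_g_formula (beta s : R) : (0 < s)%R -> (s < beta)%R ->
  ((dPhi beta s + p.+1%:R * (g s * H beta D s)) * (p.+1%:R * H beta D.+1 s)^-1)%R =
  'D_1 g s.
Proof.
move=> s0 sb; have b0 := ltW (lt_trans s0 sb).
have dg := derivableP (derivable_g s0).
have D0 : (0 < D)%N by rewrite /D addnS.
have dH := is_derive_H b0 D0 s0.
have dl := is_deriveZ p.+1%:R%R (is_deriveM dg dH).
have E : \forall y \near s, (p.+1%:R * (g y * H beta D.+1 y))%R = Phi beta y.
  by apply: filterS2 (lt_nbhsr s0) (lt_nbhsl sb) => y; exact: g_eq_everywhere.
have dl' := near_eq_is_derive E dl.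
have [_ e1] := dl'; have [_ e2] := is_derive_Phi b0 s0.
move: e1; rewrite e2 /GRing.scale /= => ->.
apply: (canLR (mulfK (denom_neq0 s0 sb))).
by ring.
Qed.

Lemma derivable_gH (beta : R) j (s : R) : (0 <= beta)%R -> (1 < j)%N -> (0 < s)%R ->
  derivable (fun y => fine ((g y)%:E * h beta j y)) s 1%R.
Proof.
move=> b0 j1 s0; rewrite (_ : (fun y => _) = (fun y => g y * H beta j y)%R).
  apply: derivableM; first exact: derivable_g.
  by case: j j1 => // j j1; have [] := is_derive_H b0 j1 s0.
by apply/funext => y; rewrite fine_EFinM.
Qed.

Lemma derivable_derive_g (s : R) : (0 < s)%R -> derivable (fun x : R => 'D_(1%R) g x) s 1%R.
Proof.
move=> s0; have sb : (s < s + 1)%R by rewrite ltrDl.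
have b0 : (0 <= s + 1)%R by rewrite addr_ge0 ?ltW.
have E : \forall y \near s, ((dPhi (s + 1) y + p.+1%:R * (g y * H (s + 1) D y)) *
    (p.+1%:R * H (s + 1) D.+1 y)^-1 = 'D_1 g y)%R.
  by apply: filterS2 (lt_nbhsr s0) (lt_nbhsl sb) => y; exact: derive_g_formula.
have dH j : (1 < j)%N -> derivable (H (s + 1)%R j) s 1%R.
  by case: j => // j j1; have [] := is_derive_H b0 j1 s0.
apply: (near_eq_derivable E); apply: derivableM; last first.
  apply: derivableV; first exact: denom_neq0.
  apply: derivableM; first exact: derivable_cst.
  by apply: dH; rewrite /D addnS.
have dA : derivable (A (s + 1)%R (k + p.+1)) s 1%R.
  rewrite addnS.
  have cf (x : R) : (0 < x)%R -> {for x, continuous (fun y => fine (fa (s + 1)%R y))}.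
    exact: continuous_gH.
  by have [] := is_derive_fine_iter b0 (tail_bounded_gh r.+1 b0) (k + p)%N cf s0.
(* For [k] = 0 no J stands in front of g here, and differentiability comes from [derivable_g]. *)
have dB : derivable (B (s + 1)%R k) s 1%R.
  have df (x : R) : (0 < x)%R -> derivable (fun y => fine (fb (s + 1)%R y)) x 1%R.
    by move=> x0; apply: derivable_gH; rewrite ?addnS.
  have bf := tail_bounded_gh (p.+1 + r.+1) b0.
  refine (@derivable_fine_iter (s + 1)%R b0 (fb (s + 1)%R) bf k s df s0).
have dP : derivable (dPhi (s + 1)%R) s 1%R.
  exact: (derivableB (derivableZ (k := k.+1%:R%R) dA)
    (derivableZ (k := (k.+1 + p.+1)%:R%R) dB)).
have dD : derivable (H (s + 1)%R D) s 1%R by apply: dH; rewrite /D !addnS.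
exact: (derivableD dP (derivableZ (k := p.+1%:R%R) (derivableM (derivable_g s0) dD))).
Qed.

(* With the truncation point just above [s], only the second-order Taylor
   expansion of [g] at [s] enters the equation; the terms of order 0 and 1
   cancel and the quadratic one is bounded by the remainder. *)
Lemma derive2_g_eq0 (s : R) : (0 < s)%R -> 'D_(1%R) (fun x => 'D_(1%R) g x) s = 0%R.
Proof.
move=> s0; apply/eqP; apply: contrapT => /negP q0.
set q2 := 'D_(1%R) (fun x => 'D_(1%R) g x) s in q0.
pose a := 'D_(1%R) g s; pose q := (q2 / 2)%R.
have {q0} q0 : q != 0%R by rewrite mulf_neq0 // invr_neq0 // pnatr_eq0.
pose c : R := p.+1%:R; pose K : R := k.+1%:R; pose N : R := (k.+1 + p.+1)%:R.
have NE : N = (K + c)%R by rewrite /N natrD.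
have c0 : (0 < c)%R by rewrite ltr0n.
have K0 : (0 < K)%R by rewrite ltr0n.
pose e := (`|q| * c / (2 * (N + K + 2)))%R.
have e0 : (0 < e)%R by rewrite divr_gt0 ?mulr_gt0 ?normr_gt0 //; lra.
(* The radius s keeps the neighbourhood inside the positive half-line. *)
have dg x : (s - s < x < s + s)%R -> is_derive x 1%R g ('D_(1%R) g x).
  by rewrite subrr => /andP[x0 _]; apply/derivableP; exact: derivable_g.
have d2g : is_derive s 1%R (fun x => 'D_(1%R) g x) q2.
  by apply/derivableP; exact: derivable_derive_g.
have [d d0 gT] := taylor2 s0 dg d2g e0.
(* To the right of s the weights now live on [s, s + d], where the Taylor bound holds. *)
pose beta := (s + d)%R.
have sb : (s < beta)%R by rewrite ltrDl.
have b0 : (0 <= beta)%R by rewrite (le_trans (ltW s0)) // ltW.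
have gM y : (0 <= y <= beta)%R -> (g y <= g beta)%R.
  by move=> /andP[y0 yb]; exact: g_nd.
have TA := iter_leb_tail_taylor b0 (k.+1 + p.+1) (tail_bounded_h r.+1 b0)
  (ltW s0) (ltW e0) mg g0 gM gT.
have TB := iter_leb_tail_taylor b0 k.+1 (tail_bounded_h (p.+1 + r.+1) b0)
  (ltW s0) (ltW e0) mg g0 gM gT.
have iA j i : iter j J (h beta i) = h beta (j + i) by rewrite /h iterD.
have := g_eq_everywhere s0 sb; move: TA TB; rewrite !iA /Phi /H /D /A /B /fa /fb.
rewrite !(addnS, addSn) !addnA.
have W2 : (0 < fine (h beta (k + p + r).+1.+4 s))%R := H_gt0 _ (ltW s0) sb.
rewrite !natrM (_ : (k + p).+3%:R = K + c + 1)%R; last by rewrite -NE /N !addSn !addnS natr1.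
rewrite (_ : (k + p).+2%:R = K + c)%R; last by rewrite -NE /N !addSn !addnS.
rewrite (_ : k.+2%:R = K + 1)%R; last by rewrite /K natr1.
move=> TA TB E.
by apply: (second_order_contradiction K0 c0 q0 _ W2 TA TB E); rewrite /e NE.
Qed.

Lemma affine_solution : exists a b : R, forall s, (0 < s)%R -> (g s = a + b * s)%R.
Proof.
have dconst (s t : R) : (0 < s)%R -> (s < t)%R -> 'D_(1%R) g s = 'D_(1%R) g t.
  move=> s0 st.
  have dd x : x \in `]s, t[%R -> is_derive x 1%R (fun y => 'D_(1%R) g y) 0%R.
    rewrite in_itv /= => /andP[sx _]; have x0 := lt_trans s0 sx.
    by rewrite -(derive2_g_eq0 x0); apply/derivableP; exact: derivable_derive_g.
  have [|y _ /eqP] := MVT st dd; last by rewrite mul0r subr_eq0 => /eqP ->.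
  apply: derivable_within_continuous => x; rewrite in_itv /= => /andP[sx _].
  by apply: derivable_derive_g; exact: lt_le_trans sx.
have dE (s : R) : (0 < s)%R -> 'D_(1%R) g s = 'D_(1%R) g 1%R.
  move=> s0; case: (ltgtP s 1%R) => [s1|s1|->//]; first exact: dconst.
  by apply/esym; exact: dconst.
pose b := 'D_(1%R) g 1%R.
have gE (s t : R) : (0 < s)%R -> (s < t)%R -> (g t - g s = b * (t - s))%R.
  move=> s0 st.
  have dg x : x \in `]s, t[%R -> is_derive x 1%R g b.
    rewrite in_itv /= => /andP[sx _]; have x0 := lt_trans s0 sx.
    by rewrite /b -(dE x x0); apply/derivableP; exact: derivable_g.
  have [|y _ //] := MVT st dg.
  apply: derivable_within_continuous => x; rewrite in_itv /= => /andP[sx _].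
  by apply: derivable_g; exact: lt_le_trans sx.
exists (g 1 - b)%R, b => s s0; case: (ltgtP s 1%R) => [s1|s1|->].
- by have := gE _ _ s0 s1; lra.
- by have := gE _ _ ltr01 s1; lra.
- by lra.
Qed.

End FunctionalEquation.
End AffineSolutions.

(** * Records and the functional equation *)

Section TailAe.
Context {R : realType}.
Local Open Scope ereal_scope.
Local Notation J := (@leb_tail R).
Local Notation leb := (@lebesgue_measure R).

(** Tested on S = {f > g}: J^(a+1) of the positive part of f - g vanishes at 0, so this part is
    null. *)
Lemma iter_leb_tail_ae_le (beta : R) a (f g : R -> \bar R) : (0 <= beta)%R ->
  tail_bounded beta f -> tail_bounded beta g ->
  (forall S : set R, measurable S ->
    iter a.+1 J (fun s => (\1_S s)%:E * f s) 0%R =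
    iter a.+1 J (fun s => (\1_S s)%:E * g s) 0%R) ->
  {ae leb, forall s : R, (0 < s)%R -> f s <= g s}.
Proof.
move=> b0 bf bg fg; have [mf f0 _ _] := bf; have [mg g0 _ _] := bg.
have mrf (h : R -> \bar R) : measurable_fun setT h -> measurable_fun setT (fun s => fine (h s)).
  by move=> mh; exact: (measurableT_comp (fine_measurable _) mh).
have fb h s : tail_bounded beta h -> (0 <= s)%R -> h s = (fine (h s))%:E.
  by move=> bh s0; rewrite fineK // (tail_bounded_fin bh).
pose dl s := (fine (f s) - fine (g s))%R.
have mdl : measurable_fun setT dl by apply: measurable_funB; exact: mrf.
pose S := dl @^-1` `]0%R, +oo[%classic.
have mS : measurable S.
  by rewrite -[X in measurable X]setTI; apply: mdl => //; exact: measurable_itv.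
pose e s := (Num.max 0 (dl s))%:E.
have me : measurable_fun setT e.
  by apply/measurable_EFinP; apply: measurable_maxr => //; exact: measurable_cst.
have e0 s : 0 <= e s by rewrite lee_fin le_max lexx.
pose gS s := (\1_S s)%:E * g s.
have bS : tail_bounded beta gS.
  apply: (@tail_boundedM _ beta 1%R (fun s => \1_S s)) => //.
  exact: measurable_indic.
have [mgS gS0 _ _] := bS.
have fin := tail_bounded_fin (tail_bounded_iter a.+1 b0 bS) (lexx 0%R).
have : iter a.+1 J e 0%R = 0.
  have H := fg S mS.
  rewrite (@eq_iter_leb_tail _ _ _ (fun s => gS s + e s)) in H; last first.
    move=> s s0; rewrite /gS /e indicE; have [/set_mem|/negP] := boolP (s \in S).
      rewrite /S /= in_itv /= andbT => ds; rewrite !mul1e (max_idPr (ltW ds)) /dl.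
      by rewrite (fb f) // (fb g) // -EFinD addrC subrK.
    move=> nS; have : ~ S s by move=> Ss; apply: nS; exact/mem_set.
    rewrite /S /= in_itv /= andbT => /negP; rewrite -leNgt => ds.
    by rewrite !mul0e add0e (max_idPl ds).
  rewrite iter_leb_tailD // in H.
  by rewrite -[LHS]add0e -(subee fin) -addeA [- _ + _]addeC addeA H subee.
move=> /(iter_leb_tail_eq0 me e0)/(leb_tail_eq0P _ me e0).
move=> [N [mN N0 sub]]; exists N; split=> // s nH; apply: sub => /= H; apply: nH => s0.
move: H; rewrite in_itv /= andbT => /(_ s0) -[] e_0.
rewrite (fb f s bf (ltW s0)) (fb g s bg (ltW s0)) lee_fin -subr_le0.
by rewrite -/(dl s) -e_0 le_max lexx orbT.
Qed.

Lemma iter_leb_tail_ae_eq (beta : R) a (f g : R -> \bar R) : (0 <= beta)%R ->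
  tail_bounded beta f -> tail_bounded beta g ->
  (forall S : set R, measurable S ->
    iter a.+1 J (fun s => (\1_S s)%:E * f s) 0%R =
    iter a.+1 J (fun s => (\1_S s)%:E * g s) 0%R) ->
  {ae leb, forall s : R, (0 < s)%R -> f s = g s}.
Proof.
move=> b0 bf bg fg.
have H1 := iter_leb_tail_ae_le b0 bf bg fg.
have H2 := iter_leb_tail_ae_le b0 bg bf (fun S mS => esym (fg S mS)).
apply: negligibleS (negligibleU H1 H2) => s /= H; apply: contrapT => /not_orP[].
move=> /contrapT h1 /contrapT h2; apply: H => s0; apply/eqP.
by rewrite eq_le h1 ?h2.
Qed.

End TailAe.

(** * The functional equation for the quantile function *)

Section RecordRectangles.
Context {disp : measure_display} {T : measurableType disp} {R : realType}.
Variables (P : probability T R) (X : nat -> {RV P >-> R}).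
Hypothesis X_indep : mutually_independent P [set i | (1 <= i)%N] X.
Variables (mu : probability R R) (F : R -> R).
Hypothesis X_law : forall i, (1 <= i)%N ->
  forall B, measurable B -> P (X i @^-1` B) = mu B.
Hypothesis F_cdf : forall x, mu `]-oo, x]%classic = (F x)%:E.
Hypothesis mu_atomless : forall x, mu [set x] = 0%E.
Variable l : R.
Hypothesis F_l : F l = 0.
Local Open Scope ereal_scope.
Local Notation J := (@leb_tail R).
Local Notation G := (exp_quantile F).
Local Notation Rec := (record_rv X).

Let tau x : R := - ln (1 - F x).

Let measurable_tau : measurable_fun setT tau.
Proof.
apply: measurableT_comp => //; apply: measurableT_comp => //.
by apply: measurable_funB => //; exact: (measurable_cdf F_cdf).
Qed.

Let tauG s : (0 <= s)%R -> tau (G s) = s.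
Proof.
move=> s0; rewrite /tau (cdf_exp_quantile F_cdf mu_atomless F_l) //.
by rewrite subKr expRK opprK.
Qed.

(* The first condition reads [s \in S] at z.1 = G s, as - ln (1 - F (G s)) = s. *)
Definition record_rect (S : set R) beta : set (R * R) :=
  [set z | S (- ln (1 - F z.1)) /\ z.2 <= G beta]%R.

Lemma measurable_record_rect S (beta : R) : measurable S ->
  measurable (record_rect S beta).
Proof.
move=> mS; apply: measurableI.
  rewrite -[X in measurable X]setTI.
  have mf : measurable_fun setT (fun z : R * R => tau z.1).
    by apply: measurableT_comp => //; exact: measurable_fst.
  exact: mf.
rewrite -[X in measurable X]setTI -/(_ @^-1` `]-oo, G beta]%classic).
have mf : measurable_fun setT (fun z : R * R => z.2) by exact: measurable_snd.
have := mf measurableT `]-oo, G beta]%classic (measurable_itv _).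
by congr (measurable (_ `&` _)); apply/seteqP; split=> z; rewrite /= in_itv.
Qed.

(** In exponential coordinates the event becomes s in S together with a truncation at beta, strict
    monotonicity of G making G z <= G beta equivalent to z <= beta. *)
Lemma integral_record_rect a p q S beta (f : R -> \bar R) :
  measurable S -> (0 <= beta)%R ->
  measurable_fun setT f -> (forall x, 0 <= f x) ->
  \int[P]_(w in (fun w => (Rec a w, Rec (q + p + a) w)) @^-1` record_rect S beta)
    f (Rec (p + a) w) =
  iter a.+1 J (fun s => (\1_S s)%:E *
    iter p J (fun y => f (G y) * iter q J (trunc_exp beta) y) s) 0%R.
Proof.
move=> mS b0 mf f0.
pose A := tau @^-1` S; pose B := `]-oo, G beta]%classic : set R.
have mA : measurable A by rewrite -[X in measurable X]setTI; exact: (measurable_tau measurableT mS).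
pose f1 x : \bar R := (\1_A x)%:E; pose f3 x : \bar R := (\1_B x)%:E.
have m1 : measurable_fun setT f1 by apply/measurable_EFinP; exact: measurable_indic.
have m3 : measurable_fun setT f3.
  by apply/measurable_EFinP; apply: measurable_indic; exact: measurable_itv.
have p1 x : 0 <= f1 x by rewrite lee_fin.
have p3 x : 0 <= f3 x by rewrite lee_fin.
transitivity (\int[P]_w (f1 (Rec a w) * f (Rec (p + a) w) * f3 (Rec (q + (p + a)) w))).
  rewrite integral_mkcond; apply: eq_integral => w _.
  rewrite patchE /f1 /f3 !indicE addnA; case: ifPn => [/set_mem [/= Aw Bw]|AB].
    by rewrite !mem_set ?mul1e ?mule1 //= /B /= in_itv.
  have [Aw|Aw] := boolP (Rec a w \in A); last by rewrite !mul0e.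
  have [Bw|Bw] := boolP (Rec (q + p + a) w \in B); last by rewrite mule0.
  move/negP: AB; case; apply/mem_set; split; first exact: set_mem.
  by move: Bw => /set_mem; rewrite /B /= in_itv.
rewrite (record_joint_exp X_indep X_law F_cdf mu_atomless F_l) //.
apply: eq_iter_leb_tail => s s0; congr (_ * _).
  by rewrite /f1 !indicE /A /= -{2}(tauG s0).
apply: eq_iter_leb_tail => y sy; congr (_ * _).
apply: eq_iter_leb_tail => z yz; rewrite /trunc_exp EFinM; congr (_ * _).
have z0 : (0 <= z)%R by rewrite (le_trans s0) // (le_trans sy).
rewrite /f3 !indicE /B; congr (_%:R%:E); congr nat_of_bool.
apply/idP/idP => /set_mem; rewrite /= in_itv /= => H; apply/mem_set; rewrite /= in_itv /=.
  rewrite z0 leNgt; apply/negP => bz.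
  by have := exp_quantile_lt F_cdf mu_atomless F_l b0 bz; rewrite ltNge H.
by move/andP: H => [_ zb]; exact: (exp_quantile_nd F_cdf mu_atomless F_l zb).
Qed.

Section Equation.
Variables (k p r a : nat).
(** [k.+1], [p.+1], [r.+1] and [a.+1] are k, n - m, r and m - k of the theorem; [N] is n - m + k,
    and [D] the number of steps from R_{m-k} to R_{n+r}. *)
Let N := (k.+1 + p.+1)%N.
Let D := (N + r.+1)%N.
Let phi (x : R) : R := `|x - l|%R.
Let g y := phi (G y).
Let h beta j := iter j J (trunc_exp beta).
Let Z w := (Rec a w, Rec (D + a) w).
Let E (S : set R) beta := Z @^-1` record_rect S beta.
Let I j (S : set R) beta :=
  iter a.+1 J (fun s => (\1_S s)%:E * iter j J (fun y => (g y)%:E * h beta (D - j) y) s) 0%R.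

Let gE s : (0 <= s)%R -> g s = (G s - l)%R.
Proof.
move=> s0; rewrite /g /phi ger0_norm // subr_ge0.
exact: (exp_quantile_ge F_cdf mu_atomless F_l).
Qed.

Let g0 s : (0 <= g s)%R.
Proof. exact: normr_ge0. Qed.

Let mphi : measurable_fun setT phi.
Proof. exact: measurable_distr. Qed.

Let mg : measurable_fun setT g.
Proof.
apply: (measurableT_comp mphi).
exact: (measurable_exp_quantile F_cdf mu_atomless F_l).
Qed.

Let g_nd x y : (0 <= x)%R -> (x <= y)%R -> (g x <= g y)%R.
Proof.
move=> x0 xy; rewrite !gE ?(le_trans x0) // lerD2r.
exact: (exp_quantile_nd F_cdf mu_atomless F_l).
Qed.

Let mE S beta : measurable S -> measurable (E S beta).
Proof.
move=> mS; rewrite -[X in measurable X]setTI.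
exact: (measurable_fun_pair (measurable_record_rv X a) (measurable_record_rv X (D + a))
  measurableT (measurable_record_rect beta mS)).
Qed.

Let bS (S : set R) beta f : measurable S -> tail_bounded beta f ->
  tail_bounded beta (fun s => (\1_S s)%:E * f s).
Proof.
move=> mS bf; apply: (@tail_boundedM _ beta 1%R (fun s => \1_S s)) => //.
exact: measurable_indic.
Qed.

Let bg (beta : R) i : (0 <= beta)%R -> tail_bounded beta (fun y => (g y)%:E * h beta i y).
Proof.
move=> b0; apply: (@tail_boundedM _ beta (g beta)) => //.
  by move=> y /andP[y0 yb]; exact: g_nd.
exact: tail_bounded_h.
Qed.

Let IE j S beta : measurable S -> (0 <= beta)%R -> (j <= D)%N ->
  \int[P]_(w in E S beta) (phi (Rec (j + a) w))%:E = I j S beta.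
Proof.
move=> mS b0 jD.
have m2 : measurable_fun setT (EFin \o phi) by exact/measurable_EFinP.
have p2 x : 0 <= (EFin \o phi) x by rewrite lee_fin normr_ge0.
by have := integral_record_rect a j (D - j) mS b0 m2 p2; rewrite subnK.
Qed.

Let I_fin j S beta : measurable S -> (0 <= beta)%R -> I j S beta \is a fin_num.
Proof.
move=> mS b0.
have bj := tail_bounded_iter j b0 (bg (D - j) b0).
exact: (tail_bounded_fin (tail_bounded_iter a.+1 b0 (bS mS bj)) (lexx 0%R)).
Qed.

Let probE S beta : measurable S -> (0 <= beta)%R ->
  P (E S beta) = iter a.+1 J (fun s => (\1_S s)%:E * h beta D s) 0%R.
Proof.
move=> mS b0.
have := integral_record_rect a 0 D mS b0 (@measurable_cst _ _ R (\bar R) setT 1) (fun=> lee01).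
rewrite addn0 integral_cst ?mul1e => [->|]; last exact: mE.
by congr (iter a.+1 J _ 0%R); apply/funext => s /=; rewrite mul1e.
Qed.

Let iphi j S beta : measurable S -> (0 <= beta)%R -> (j <= D)%N ->
  P.-integrable (E S beta) (EFin \o (fun w => phi (Rec (j + a) w))).
Proof.
move=> mS b0 jD; apply/integrableP; split.
  apply/measurable_EFinP/measurable_funTS; apply: measurableT_comp => //.
  exact: measurable_record_rv.
under eq_integral do rewrite gee0_abs ?lee_fin ?normr_ge0 //.
by rewrite (IE mS b0 jD) -ge0_fin_numE ?I_fin // -(IE mS b0 jD); apply: integral_ge0 => w _; rewrite lee_fin normr_ge0.
Qed.

Variables (E1 : R * R -> R) (kappa : R).
Hypothesis E1_cond : is_cond_exp P
  (fun w => k.+1%:R * Rec (N + a) w - N%:R * Rec (k.+1 + a) w)%R Z E1.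
Hypothesis E1_lin : forall u v, (l < u)%R -> (u < v)%R -> E1 (u, v) = (kappa * u)%R.

(** The conditional expectation is tested on the event, where the records have finite mean, and
    [c j] is the integral of the record [j] steps after the left one. The form of [E1] applies
    because l < R_{m-k} < R_{n+r} almost surely. *)
Lemma record_linear_eq S beta : measurable S -> (0 <= beta)%R ->
  let c j := (l * fine (P (E S beta)) + fine (I j S beta))%R in
  (k.+1%:R * c N - N%:R * c k.+1 = kappa * c 0%N)%R.
Proof.
move=> mS b0 c; have mES := mE beta mS.
have [mE1 _ E1P] := E1_cond.
have kN : (k.+1 <= D)%N by rewrite /D /N; lia.
have ND : (N <= D)%N by rewrite /D; lia.
have iR j : (j <= D)%N -> P.-integrable (E S beta) (EFin \o Rec (j + a)).
  by move=> jD; exact: (integrable_record_dist mES (iphi mS b0 jD)).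
have cE j : (j <= D)%N -> fine (\int[P]_(w in E S beta) (Rec (j + a) w)%:E) = c j.
  move=> jD.
  by rewrite (integral_record_dist X_law F_cdf F_l mES (iphi mS b0 jD)) (IE mS b0 jD).
have YE : (fun w => k.+1%:R * Rec (N + a) w - N%:R * Rec (k.+1 + a) w)%R =
    (fun w => k.+1%:R * Rec (N + a) w + - N%:R * Rec (k.+1 + a) w)%R.
  by apply/funext => w; rewrite mulNr.
rewrite YE in E1P.
have iY := integrable_lin2 k.+1%:R (- N%:R) mES (iR _ ND) (iR _ kN).
have [_ eqE] := E1P _ (measurable_record_rect beta mS) iY.
have eqY : \int[P]_(w in E S beta) (k.+1%:R * Rec (N + a) w + - N%:R * Rec (k.+1 + a) w)%:E =
    \int[P]_(w in E S beta) (E1 (Z w))%:E.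
  by rewrite -[RHS]eqE; apply: eq_integral => w _; rewrite mulNr.
have eqZ : \int[P]_(w in E S beta) (E1 (Z w))%:E =
    \int[P]_(w in E S beta) (kappa * Rec (0 + a) w + 0 * Rec (0 + a) w)%:E.
  have mR j := measurable_record_rv X j.
  apply: ae_eq_integral => //.
  - apply/measurable_EFinP/measurable_funTS; apply: (measurableT_comp mE1).
    exact: measurable_fun_pair.
  - by apply/measurable_EFinP/measurable_funTS; apply: measurable_funD; apply: measurable_funM.
  have lt1 := record_gt_left X_law F_cdf F_l a.
  have lt2 := record_rv_lt X_indep X_law F_cdf (cdf_eq1_null F_cdf mu_atomless F_l)
    (_ : (a < D + a)%N).
  have aD : (a < D + a)%N by rewrite /D /N; lia.
  apply: filterS2 lt1 (lt2 aD) => w l1 l2 _ /=.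
  by rewrite mul0r addr0 E1_lin.
have := eq_trans (esym (integral_lin2 _ _ mES (iR _ ND) (iR _ kN))) (eq_trans eqY eqZ).
rewrite (integral_lin2 _ _ mES (iR _ (leq0n _)) (iR _ (leq0n _))) => -[].
by rewrite !cE // => H; rewrite -mulNr H mul0r addr0.
Qed.

Let S_ (alpha : R) : set R := `]alpha, +oo[%classic.

Let mS_ alpha : measurable (S_ alpha).
Proof. exact: measurable_itv. Qed.

Let prob_gt0 alpha beta : (0 <= alpha)%R -> (alpha < beta)%R ->
  (0 < fine (P (E (S_ alpha) beta)))%R.
Proof.
move=> a0 ab; have b0 := le_trans a0 (ltW ab).
have bf := bS (mS_ alpha) (tail_bounded_h D b0); have [mf f0 _ _] := bf.
rewrite probE //; have bi := tail_bounded_iter a.+1 b0 bf; have [_ i0 _ _] := bi.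
rewrite fine_gt0 // lt0e i0 andbT -ge0_fin_numE // (tail_bounded_fin bi) // andbT.
apply/eqP => /(iter_leb_tail_eq0 mf f0)/(leb_tail_eq0P _ mf f0) aef.
have [y /andP[ay yb]] := ae_exists ab aef.
have y0 := le_lt_trans a0 ay.
rewrite /= in_itv /= y0 => /(_ isT).
rewrite indicE mem_set /S_ /= ?in_itv /= ?ay // mul1e => H.
by have /lt0r_neq0/eqP := H_gt0 D (ltW y0) yb; apply; exact: (congr1 fine H).
Qed.

(** On this event the records lie between G alpha and G beta; the bounds are read off the iterated
    integrals by monotonicity of g and J. *)
Let I_bounds alpha beta j : (0 <= alpha)%R -> (alpha < beta)%R -> (j <= D)%N ->
  (g alpha * fine (P (E (S_ alpha) beta)) <= fine (I j (S_ alpha) beta) <=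
   g beta * fine (P (E (S_ alpha) beta)))%R.
Proof.
move=> a0 ab jD; have b0 := le_trans a0 (ltW ab).
have bD := bS (mS_ alpha) (tail_bounded_h D b0); have [mD D0 _ _] := bD.
have bj := bS (mS_ alpha) (tail_bounded_iter j b0 (bg (D - j) b0)).
have [mj j0 _ _] := bj.
have [mh h0 _ hb] := tail_bounded_h (D - j) b0.
have [mgh gh0 _ _] := bg (D - j) b0.
have hD s : h beta D s = iter j J (h beta (D - j)) s by rewrite /h -iterD subnKC.
have Pfin : P (E (S_ alpha) beta) \is a fin_num.
  by rewrite fin_num_measure //; exact: mE.
have mZ (x : R) f : measurable_fun setT f -> measurable_fun setT (fun y : R => x%:E * f y).
  by move=> mf; exact: measurable_funeM.
have Z0 (x : R) (f : R -> \bar R) : (0 <= x)%R -> (forall y, 0 <= f y) ->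
    forall y, 0 <= x%:E * f y.
  by move=> x0 f0 y; rewrite mule_ge0 ?lee_fin.
rewrite -!lee_fin !EFinM !fineK ?I_fin // probE //.
rewrite -(iter_leb_tailZ a.+1 0%R mD D0 (g0 alpha)) -(iter_leb_tailZ a.+1 0%R mD D0 (g0 beta)).
have le1 (s : R) (x y : \bar R) : (S_ alpha s -> x <= y) -> (\1_(S_ alpha) s)%:E * x <= (\1_(S_ alpha) s)%:E * y.
  rewrite indicE; have [/set_mem Ss /(_ Ss) xy|_ _] := boolP (s \in S_ alpha).
    by rewrite !mul1e.
  by rewrite !mul0e.
apply/andP; split.
  apply: iter_leb_tail_le => //; [exact: mZ|exact: Z0|].
  move=> s s0; rewrite muleCA; apply: le1 => Ss.
  have as_ : (alpha <= s)%R by move: Ss; rewrite /S_ /= in_itv /= andbT => /ltW.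
  rewrite -[X in _ * X <= _]/(h beta D s) hD -(iter_leb_tailZ j s mh h0 (g0 alpha)).
  apply: iter_leb_tail_le => //; [exact: mZ|exact: Z0|].
  by move=> y sy; rewrite lee_wpmul2r // lee_fin g_nd // (le_trans as_).
apply: iter_leb_tail_le => //; [exact: mZ|exact: Z0|].
move=> s s0; rewrite [leRHS]muleCA; apply: le1 => _.
rewrite -[X in _ <= _ * X]/(h beta D s) hD -(iter_leb_tailZ j s mh h0 (g0 beta)).
apply: iter_leb_tail_le => //; [exact: mZ|exact: Z0|].
move=> y sy; case: (leP y beta) => yb; last first.
  by rewrite [X in _ * X <= _](hb y yb) [X in _ <= _ * X](hb y yb) !mule0.
apply: lee_wpmul2r; first exact: h0.
by rewrite lee_fin; apply: g_nd => //; exact: le_trans s0 sy.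
Qed.

(* On the event G alpha < R_{a+1} <= R_{D+a+1} <= G beta all records are close to
   G alpha when [beta] is close to [alpha]. *)
Lemma slope_eq : kappa = (- p.+1%:R)%R.
Proof.
(* G is strictly increasing, so G 1 and G 2 are not both 0. *)
suff H alpha : (0 <= alpha)%R -> ((kappa + p.+1%:R) * G alpha)%R = 0%R.
  apply/eqP; rewrite -subr_eq0 opprK; apply/negPn/negP => k0.
  have /eqP := H 1%R ler01; rewrite mulf_eq0 (negPf k0) /= => /eqP G1.
  have /eqP := H 2%R (ler0n _ _); rewrite mulf_eq0 (negPf k0) /= => /eqP G2.
  have := exp_quantile_lt F_cdf mu_atomless F_l ler01 (_ : 1 < 2)%R.
  by rewrite G1 G2 ltxx ltr1n => /(_ isT).
move=> a0; apply/eqP; apply/negPn/negP => x0.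
(* [C] is the sum of the absolute values of the coefficients of the three deviations in [E1']
   below. *)
pose C : R := (k.+1%:R + N%:R + `|kappa|)%R.
have C0 : (0 < C)%R by rewrite /C !ltr_pwDl // ltr0n.
have e0 : (0 < `|(kappa + p.+1%:R) * G alpha| / C)%R by rewrite divr_gt0 ?normr_gt0.
have [beta ab Gab] := exp_quantile_right F_cdf mu_atomless F_l a0 e0.
have b0 := le_trans a0 (ltW ab).
have := record_linear_eq (mS_ alpha) b0.
have pr0 := prob_gt0 a0 ab.
have kN : (k.+1 <= D)%N by rewrite /D /N; lia.
have ND : (N <= D)%N by rewrite /D; lia.
have := I_bounds a0 ab ND; have := I_bounds a0 ab kN; have := I_bounds a0 ab (leq0n D).
move: pr0; set pr := fine (P _); set I0 := fine (I 0 _ _); set Ik := fine (I k.+1 _ _).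
set IN := fine (I N _ _) => pr0 b_0 bk bN; rewrite /=.
rewrite -/I0 -/Ik -/IN !gE // in b_0 bk bN * => E0.
(* Deviations from the value at alpha: the constants combine to (kappa + n - m) G alpha times the
   probability, since k - N = -(n - m). *)
pose y0 := (I0 - (G alpha - l) * pr)%R; pose yk := (Ik - (G alpha - l) * pr)%R.
pose yN := (IN - (G alpha - l) * pr)%R; pose dl := ((G beta - G alpha) * pr)%R.
have E1' : ((kappa + p.+1%:R) * G alpha * pr = k.+1%:R * yN - N%:R * yk - kappa * y0)%R.
  have NE : (N%:R = k.+1%:R + p.+1%:R :> R)%R by rewrite /N natrD.
  rewrite NE in E0 *; rewrite /y0 /yk /yN.
  rewrite !mulrBr (_ : kappa * I0 = (k.+1%:R * (l * pr + IN) -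
    (k.+1%:R + p.+1%:R) * (l * pr + Ik)) - kappa * (l * pr))%R; last by rewrite E0; ring.
  by ring.
have nb y : ((G alpha - l) * pr <= y <= (G beta - l) * pr)%R ->
    (`|y - (G alpha - l) * pr| <= dl)%R.
  move=> /andP[y1 y2]; rewrite ger0_norm ?subr_ge0 // /dl.
  by move: y2; rewrite !mulrBl; lra.
have : (`|(kappa + p.+1%:R) * G alpha| * pr <= C * dl)%R.
  rewrite -{1}(gtr0_norm pr0) -normrM E1' /C !mulrDl.
  apply: (le_trans (ler_normB _ _)); apply: lerD; last by rewrite normrM ler_wpM2l ?nb.
  apply: (le_trans (ler_normB _ _)); apply: lerD; rewrite normrM normr_nat ler_wpM2l ?nb //.
apply/negP; rewrite -ltNge /dl mulrA ltr_pM2r //.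
by rewrite mulrC -ltr_pdivlMr // ltrBlDl.
Qed.

(** With kappa = -(n - m) = k - N the terms l P(E) cancel, which leaves an equation in g alone;
    varying S removes the outer integral. *)
Lemma quantile_equation (beta : R) : (0 < beta)%R ->
  {ae (@lebesgue_measure R), forall s : R, (0 < s)%R ->
    k.+1%:R%:E * iter N J (fun y => (g y)%:E * h beta r.+1 y) s +
      p.+1%:R%:E * ((g s)%:E * h beta D s) =
    N%:R%:E * iter k.+1 J (fun y => (g y)%:E * h beta (p.+1 + r.+1) y) s}.
Proof.
move=> bt0; have b0 := ltW bt0.
have bZ (x : R) f : (0 <= x)%R -> tail_bounded beta f ->
    tail_bounded beta (fun s => x%:E * f s).
  by move=> x0 bf; apply: (@tail_boundedM _ beta x (fun=> x)) => //; exact: measurable_cst.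
have bN := tail_bounded_iter N b0 (bg r.+1 b0).
have bk := tail_bounded_iter k.+1 b0 (bg (p.+1 + r.+1) b0).
have b_0 := bg D b0.
have bL : tail_bounded beta (fun s =>
    k.+1%:R%:E * iter N J (fun y => (g y)%:E * h beta r.+1 y) s +
    p.+1%:R%:E * ((g s)%:E * h beta D s)).
  by apply: tail_boundedD; exact: bZ.
have bM := bZ _ _ (ler0n _ N) bk.
apply: (iter_leb_tail_ae_eq (a := a) b0 bL bM) => S mS.
have kN : (k.+1 <= D)%N by rewrite /D /N; lia.
have ND : (N <= D)%N by rewrite /D; lia.
have IN : I N S beta = iter a.+1 J (fun s => (\1_S s)%:E *
    iter N J (fun y => (g y)%:E * h beta r.+1 y) s) 0%R.
  by rewrite /I (_ : D - N = r.+1)%N // /D; lia.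
have Ik : I k.+1 S beta = iter a.+1 J (fun s => (\1_S s)%:E *
    iter k.+1 J (fun y => (g y)%:E * h beta (p.+1 + r.+1) y) s) 0%R.
  by rewrite /I (_ : D - k.+1 = p.+1 + r.+1)%N // /D /N; lia.
have I0 : I 0 S beta = iter a.+1 J (fun s => (\1_S s)%:E * ((g s)%:E * h beta D s)) 0%R.
  by rewrite /I subn0.
have bSN := bS mS bN; have [mN N0 _ _] := bSN.
have bSk := bS mS bk; have [mk k0 _ _] := bSk.
have bS0 := bS mS b_0; have [m_0 z0 _ _] := bS0.
have bZN := bZ _ _ (ler0n _ k.+1) bSN; have [mZN ZN0 _ _] := bZN.
have bZ0 := bZ _ _ (ler0n _ p.+1) bS0; have [mZ0 Z00 _ _] := bZ0.
rewrite (_ : (fun s => _) = (fun s => k.+1%:R%:E * ((\1_S s)%:E *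
    iter N J (fun y => (g y)%:E * h beta r.+1 y) s) +
    p.+1%:R%:E * ((\1_S s)%:E * ((g s)%:E * h beta D s)))); last first.
  apply/funext => s; rewrite indicE; case: (s \in S); first by rewrite !mul1e.
  by rewrite !mul0e !mule0 adde0.
rewrite (_ : (fun s => (\1_S s)%:E * (N%:R%:E * _)) = (fun s => N%:R%:E * ((\1_S s)%:E *
    iter k.+1 J (fun y => (g y)%:E * h beta (p.+1 + r.+1) y) s))); last first.
  by apply/funext => s; rewrite muleCA.
rewrite (iter_leb_tailD _ _ mZN ZN0 mZ0 Z00).
rewrite (iter_leb_tailZ _ _ mN N0 (ler0n _ _)) (iter_leb_tailZ _ _ m_0 z0 (ler0n _ _)).
rewrite (iter_leb_tailZ _ _ mk k0 (ler0n _ _)) -IN -Ik -I0.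
rewrite -(fineK (I_fin N mS b0)) -(fineK (I_fin k.+1 mS b0)) -(fineK (I_fin 0 mS b0)).
rewrite -!EFinM -EFinD; congr EFin.
have := record_linear_eq mS b0; rewrite slope_eq /=.
have -> : (N%:R = k.+1%:R + p.+1%:R :> R)%R by rewrite /N natrD.
by rewrite !mulrDl; lra.
Qed.

Lemma affine_quantile :
  exists b c : R, forall s : R, (0 < s)%R -> G s = (b + c * s)%R.
Proof.
have g_right (s e : R) : (0 < s)%R -> (0 < e)%R -> exists2 t, (s < t)%R & (g t < g s + e)%R.
  move=> s0 e0; have [t st Gt] := exp_quantile_right F_cdf mu_atomless F_l (ltW s0) e0.
  exists t => //; rewrite !gE ?(ltW s0) //; first by lra.
  by rewrite (le_trans (ltW s0)) // ltW.
have [b [c gs]] := affine_solution mg g0 g_nd g_right quantile_equation.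
exists (l + b)%R, c => s s0; move: (gs s s0); rewrite gE ?ltW //; lra.
Qed.

End Equation.

End RecordRectangles.

Lemma probability_unique_cdf (R : realType) (m1 m2 : probability R R) :
  (forall x, m1 `]-oo, x]%classic = m2 `]-oo, x]%classic) ->
  forall A, measurable A -> m1 A = m2 A.
Proof.
move=> m12 A mA.
apply: (@measure_unique _ R R (@RGenOInfty.G R)
  (fun n => `](- n%:R)%R, +oo[%classic)) => //.
- exact: RGenOInfty.measurableE.
- move=> _ _ [x ->] [y ->]; exists (Num.max x y).
  by apply/seteqP; split=> z /=; rewrite !in_itv /= !andbT gt_max;
    [move=> [-> ->]|move=> /andP[]].
- by move=> n; exists (- n%:R)%R.
- apply/seteqP; split=> // x _; exists (Num.truncn `|x|).+1 => //=.
  rewrite in_itv /= andbT ltrNl.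
  by rewrite (le_lt_trans _ (truncnS_gt _)) // -normrN ler_norm.
- move=> _ [x ->]; rewrite -setCitvl; have mI : measurable (`]-oo, x]%classic : set R) by exact: measurable_itv.
  apply: (eq_trans (probability_setC m1 mI)); apply/esym.
  by apply: (eq_trans (probability_setC m2 mI)); rewrite m12.
- by move=> n; rewrite (le_lt_trans (probability_le1 m1 (measurable_itv _))) // ltry.
Qed.

(** * Exponential laws and affine quantile functions *)

Section ExponentialCdf.
Context {R : realType}.
Variables (mu : probability R R) (F : R -> R).
Hypothesis F_cdf : forall x, mu `]-oo, x]%classic = (F x)%:E.
Hypothesis mu_atomless : forall x, mu [set x] = 0%E.
Local Notation l := (left_endpoint F).
Hypothesis F_l : F l = 0.
Local Notation G := (exp_quantile F).

Lemma exponential_exp_quantile (c : R) : 0 < c ->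
  (forall x, l <= x -> F x = 1 - expR (- (c * (x - l)))) ->
  forall s, 0 <= s -> G s = l + s / c.
Proof.
move=> c0 Fe s s0.
have lG := exp_quantile_ge F_cdf mu_atomless F_l s0.
have := cdf_exp_quantile F_cdf mu_atomless F_l s0; rewrite Fe //.
move=> /addrI/oppr_inj/expR_inj/oppr_inj sE.
by rewrite -[X in X / c]sE mulrAC mulfV ?gt_eqF // mul1r addrC subrK.
Qed.

(** The formula for G is given for s > 0; monotonicity and right continuity extend it to 0, after
    which b is recognised as the left endpoint. *)
Lemma exponential_affine_quantile (b c : R) :
  has_lbound (cdf_support F) ->
  (forall s, 0 < s -> G s = b + c * s) -> is_exponential F.
Proof.
move=> hl Gs.
have c0 : 0 < c.
  have := exp_quantile_lt F_cdf mu_atomless F_l ler01 (_ : 1 < 2).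
  by rewrite ltr1n !Gs // => /(_ isT); lra.
have G0 : G 0 = b.
  apply/eqP; rewrite eq_le; apply/andP; split; apply/ler_addgt0Pr => e e0.
    have ec : 0 < e / c by rewrite divr_gt0.
    have := exp_quantile_nd F_cdf mu_atomless F_l (ltW ec).
    by rewrite (Gs _ ec) mulrCA mulfV ?gt_eqF // mulr1.
  have [t t0 Gt] := exp_quantile_right F_cdf mu_atomless F_l (lexx 0) e0.
  rewrite (Gs _ t0) in Gt; have := mulr_gt0 c0 t0; lra.
have Fb s : 0 <= s -> F (b + c * s) = 1 - expR (- s).
  rewrite le_eqVlt => /predU1P[<-|s0].
    by rewrite mulr0 addr0 -G0 (cdf_exp_quantile F_cdf mu_atomless F_l (lexx 0)).
  by rewrite -Gs // (cdf_exp_quantile F_cdf mu_atomless F_l (ltW s0)).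
have Fx x : b <= x -> F x = 1 - expR (- (c^-1 * (x - b))).
  move=> bx; have xs : 0 <= c^-1 * (x - b).
    by rewrite mulr_ge0 ?subr_ge0 // invr_ge0 ltW.
  rewrite -Fb //.
  by rewrite mulrA mulfV ?gt_eqF // mul1r addrC subrK.
have Fb0 : F b = 0 by rewrite Fx // subrr mulr0 oppr0 expR0 subrr.
have F0 x : x <= b -> F x = 0.
  move=> xb; apply/eqP; rewrite eq_le (cdf_ge0 F_cdf) andbT -Fb0.
  exact: (cdf_nd F_cdf).
have bS : cdf_support F b.
  move=> e e0; rewrite F0 ?gerBl ?ltW // Fx ?lerDl ?ltW //.
  by rewrite subr_gt0 -expR0 ltr_expR ltrNl oppr0 mulr_gt0 ?invr_gt0 // addrC addKr.
have lb : l = b.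
  apply/eqP; rewrite eq_le; apply/andP; split; first exact: ge_inf.
  apply: lb_le_inf; first by exists b.
  move=> x xS; rewrite leNgt; apply/negP => xb.
  have /xS : 0 < b - x by rewrite subr_gt0.
  rewrite (_ : x + (b - x) = b); last by rewrite addrC subrK.
  by rewrite Fb0 F0 ?ltxx //; lra.
exists c^-1; split; first by rewrite invr_gt0.
by move=> x; rewrite lb; exact: Fx.
Qed.

End ExponentialCdf.

(** The right-hand side is u times a function of (s, t). Any (u, v) is compared with a fixed (u0,
    v0) through a common s below and a common t above both. *)
Lemma regression_slope (R : realType) (E1 E2 : R * R -> R) (d l : R) :
  (forall s u v t : R, l < s -> s < u -> u < v -> v < t ->
    (d + 1) * s - t != 0 -> E1 (u, v) = d * u / ((d + 1) * s - t) * E2 (s, t)) ->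
  exists kappa, forall u v, l < u -> u < v -> E1 (u, v) = kappa * u.
Proof.
(* [u0] is above l and positive, so that it can be divided by. *)
move=> H; pose u0 := Num.max l 0 + 1; pose v0 := u0 + 1.
have lu0 : l < u0 by rewrite /u0 ltr_pwDr // le_max lexx.
have u00 : u0 != 0 by rewrite gt_eqF // /u0 ltr_wpDl // le_max lexx orbT.
exists (E1 (u0, v0) / u0) => u v lu uv.
pose s := (l + Num.min u u0) / 2.
have lm : l < Num.min u u0 by rewrite lt_min lu.
have ls : l < s by rewrite /s; lra.
have sm : s < Num.min u u0 by rewrite /s; lra.
have [su su0] : s < u /\ s < u0 by move: sm; rewrite lt_min => /andP.
(* The denominator vanishes for a single t, so t1 or t1 + 1 works. *)
have [t [vt v0t nz]] : exists t, [/\ v < t, v0 < t & (d + 1) * s - t != 0].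
  pose t1 := Num.max v v0 + 1.
  have vt1 : v < t1 by rewrite /t1 ltr_pwDr // le_max lexx.
  have v0t1 : v0 < t1 by rewrite /t1 ltr_pwDr // le_max lexx orbT.
  have [e|ne] := eqVneq ((d + 1) * s - t1) 0; last by exists t1.
  exists (t1 + 1); split; [by lra|by lra|].
  by rewrite opprD addrA e sub0r oppr_eq0 oner_neq0.
have u0v0 : u0 < v0 by rewrite /v0 ltrDl.
rewrite (H s u v t) // (H s u0 v0 t) //.
by field; rewrite nz u00.
Qed.

Lemma record_value_rv (disp : measure_display) (T : measurableType disp) (R : realType)
    (P : probability T R) (X : nat -> {RV P >-> R}) i j w : i = j.+1 ->
  record_value (fun n => X n w) i = record_rv X j w.
Proof. by move=> ->. Qed.

(** * Common law of the observations *)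

Section Laws.
Context {disp : measure_display} {T : measurableType disp} {R : realType}.
Variables (P : probability T R) (X : nat -> {RV P >-> R}) (F : R -> R).
Hypothesis X_cdf : forall i, (1 <= i)%N -> forall x, cdf (X i) x = (F x)%:E.
Hypothesis F_abs_cont : distribution P (X 1%N) `<< lebesgue_measure.
Let mu : probability R R := distribution P (X 1%N).

Lemma law_cdf x : mu `]-oo, x]%classic = (F x)%:E.
Proof. by rewrite -(X_cdf (leqnn 1)). Qed.

Lemma law_eq i : (1 <= i)%N -> forall B, measurable B -> P (X i @^-1` B) = mu B.
Proof.
move=> i1 B mB; apply: (@probability_unique_cdf R (distribution P (X i)) mu) => // x.
by rewrite law_cdf -(X_cdf i1).
Qed.

Lemma law_atomless x : mu [set x] = 0%E.
Proof.
have leb0 : (@lebesgue_measure R).-null_set [set x].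
  by move=> B mB /subset_set1[->|->]; [exact: measure0|exact: lebesgue_measure_set1].
exact: F_abs_cont leb0 [set x] (measurable_set1 x) (@subset_refl _ _).
Qed.

End Laws.

Theorem theorem3 (R : realType) (disp : measure_display)
    (T : measurableType disp) (P : probability T R)
    (X : nat -> {RV P >-> R}) (F : R -> R) (k r m n : nat)
    (hk : (1 <= k <= m - 1)%N) (hr : (1 <= r)%N) (hm : (2 <= m <= n - 1)%N)
    (X_indep : mutually_independent P [set i | (1 <= i)%N] X)
    (X_cdf : forall i, (1 <= i)%N -> forall x, cdf (X i) x = (F x)%:E)
    (F_abs_cont : distribution P (X 1%N) `<< lebesgue_measure)
    (lF_finite : has_lbound (cdf_support F)) :
  let Rec i := fun w => record_value (fun j => X j w) i in
  let Y := fun w => k%:R * Rec n w - (n - m + k)%:R * Rec m w in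
  let d := (n - m + k + r - 2)%N in
  is_exponential F <->
  exists E1 E2 : R * R -> R,
    [/\ is_cond_exp P Y (fun w => (Rec (m - k)%N w, Rec (n + r)%N w)) E1,
        is_cond_exp P Y
          (fun w => (Rec (m - k + 1)%N w, Rec (n + r - 1)%N w)) E2 &
        forall s u v t : R,
          left_endpoint F < s -> s < u -> u < v -> v < t ->
          (d + 1)%:R * s - t != 0 ->
          E1 (u, v) = d%:R * u / ((d + 1)%:R * s - t) * E2 (s, t)].
Proof.
move=> Rec Y d.
pose mu : probability R R := distribution P (X 1%N).
have F_cdf := law_cdf X_cdf; have X_law := law_eq X_cdf.
have mu0 := law_atomless F_abs_cont.
have F_l := cdf_left_endpoint F_cdf mu0 lF_finite.
case: k hk @Y @d => // k' hk' Y d.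
case: r hr @d => // r' _ d.
(* [record_rv] counts from 0, so R_{m-k} is [record_rv X a]. *)
have [a ma] : exists a, m = (k'.+1 + a).+1 by exists (m - k'.+2)%N; lia.
have [p np] : exists p, n = (k'.+1 + p.+1 + a).+1 by exists (n - m).-1; lia.
pose N := (k'.+1 + p.+1)%N; pose D := (N + r'.+1)%N.
have NE : (n - m + k'.+1 = N)%N by rewrite /N; lia.
have dE : d = D.-2 by rewrite /d NE /D; lia.
have dR : d%:R + 2 = D%:R :> R by rewrite dE -natrD; congr _%:R; rewrite /D /N; lia.
have D0 : (0 < D)%N by rewrite /D /N; lia.
have d0 : (0 < d)%N by rewrite dE /D /N; lia.
have YE : Y = (fun w => k'.+1%:R * record_rv X (N + a) w - N%:R * record_rv X (k'.+1 + a) w).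
  by apply/funext => w; rewrite /Y /Rec NE np ma.
have ZE : (fun w => (Rec (m - k'.+1)%N w, Rec (n + r'.+1)%N w)) =
    (fun w => (record_rv X a w, record_rv X (D + a) w)).
  apply/funext => w; rewrite /Rec.
  by congr pair; apply: record_value_rv; rewrite ?np ?ma /D /N; lia.
split=> [[c [c0 Fe]]|[E1 [E2 [hE1 _ hE]]]]; last first.
  have [kappa E1_lin] : exists kappa, forall u v, left_endpoint F < u -> u < v ->
      E1 (u, v) = kappa * u.
    apply: (regression_slope (d := d%:R) (E2 := E2)) => s u v t ls su uv vt.
    by have := hE s u v t ls su uv vt; rewrite natrD.
  rewrite YE ZE in hE1.
  have [b [c Gs]] := affine_quantile X_indep X_law F_cdf mu0 F_l hE1 E1_lin.
  exact: (exponential_affine_quantile F_cdf mu0 F_l lF_finite Gs).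
have G_lin := exponential_exp_quantile F_cdf mu0 F_l c0 Fe.
have ND : (N <= D)%N by rewrite /D; lia.
have kD : (k'.+1 <= D)%N by rewrite /D /N; lia.
have N1d : (N.-1 <= d)%N by rewrite dE /D; lia.
have k1d : (k' <= d)%N by rewrite dE /D /N; lia.
have cE1 := record_cond_exp X_indep X_law F_cdf mu0 F_l c0 G_lin a k'.+1%:R (- N%:R) D0 ND kD.
(* The inner pair starts one record later and ends one earlier: the offsets of R_n and R_m drop by 1
   and the length [D] by 2. *)
have cE2 := record_cond_exp X_indep X_law F_cdf mu0 F_l c0 G_lin a.+1 k'.+1%:R (- N%:R) d0 N1d k1d.
eexists; eexists; split.
- rewrite ZE YE.
  have -> : (fun w => k'.+1%:R * record_rv X (N + a) w - N%:R * record_rv X (k'.+1 + a) w) =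
    (fun w => k'.+1%:R * record_rv X (N + a) w + - N%:R * record_rv X (k'.+1 + a) w).
    by apply/funext => w; rewrite mulNr.
  exact: cE1.
- have -> : (fun w => (Rec (m - k'.+1 + 1)%N w, Rec (n + r'.+1 - 1)%N w)) =
      (fun w => (record_rv X a.+1 w, record_rv X (d + a.+1) w)).
    apply/funext => w; rewrite /Rec.
    by congr pair; apply: record_value_rv; rewrite ?np ?ma ?dE /D /N; lia.
  have -> : Y = (fun w => k'.+1%:R * record_rv X (N.-1 + a.+1) w + - N%:R * record_rv X (k' + a.+1) w).
    have e1 : (N.-1 + a.+1 = N + a)%N by rewrite /N; lia.
    have e2 : (k' + a.+1 = k'.+1 + a)%N by lia.
    by rewrite YE; apply/funext => w; rewrite mulNr e1 e2.
  exact: cE2.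
move=> s u v t _ _ _ _ st /=.
have dn0 : d%:R != 0 :> R by rewrite pnatr_eq0 -lt0n.
have Dn0 : d%:R + 2 != 0 :> R by rewrite dR pnatr_eq0 -lt0n.
have NR : (k' + p.+1)%:R = N%:R - 1 :> R by rewrite /N addSn -[in RHS]natr1 addrK.
have kR : k'%:R = k'.+1%:R - 1 :> R by rewrite -natr1 addrK.
rewrite natrD in st *; rewrite (natrB _ ND) (natrB _ kD) (natrB _ N1d) (natrB _ k1d).
rewrite -dR NR kR.
by field; rewrite dn0 st Dn0.
Qed.
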